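(* Let $\Omega\subset\mathbb R^n$, $n\in\{2,3\}$, be a bounded convex domain with a Lipschitz continuous boundary and assume that the spaces $V^h=S^1_d(\mathcal T)$ have the optimal approximation property and satisfy the inverse estimates stated in the context. Let $u_h$ be the unique strictly convex solution of the discrete problem: $u_h\in V^h$, $u_h=g_h$ on $\partial\Omega$, $$-\frac1n\int_\Omega(\operatorname{cof}D^2u_h)Du_h\cdot Dw_h\,dx=\int_\Omega fw_h\,dx\quad\forall w_h\in V_0^h .$$ Then there is a suitable $\nu>0$ such that, for any initial guess $u_0\in Y^h$ (with $\delta$ sufficiently small in the definition of $Y^h$), the sequence defined by $u_{k+1}\in V^h$, $u_{k+1}=g_h$ on $\partial\Omega$ and $$\nu\int_\Omega Du_{k+1}\cdot D\psi_h\,dx=\nu\int_\Omega Du_k\cdot D\psi_h\,dx+\int_\Omega(\det D^2u_k-f)\psi_h\,dx\quad\forall\psi_h\in V_0^h$$ converges to $u_h$ with a linear convergence rate, i.e. there is $\rho\in(0,1)$ with $|u_{k+1}-u_h|_1\le\rho|u_k-u_h|_1$ for all $k\ge0$.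
   Context: $\mathcal T=\mathcal T_h$ is a family of shape-regular, quasi-uniform triangulations of $\Omega$ into simplices with maximal diameter $h$; $S_d^1(\mathcal T)=\{s\in C^1(\Omega): s|_K\in\mathcal P_d\ \forall K\in\mathcal T\}$, with $\mathcal P_d$ the polynomials of degree at most $d$; $V_0^h=V^h\cap H_0^1(\Omega)$. $\|\cdot\|_{k,p}$, $|\cdot|_{k,p}$ are the norm and seminorm of $W^{k,p}(\Omega)$, and $\|\cdot\|_k,|\cdot|_k$ those of $H^k(\Omega)$. $\operatorname{cof}A$ is the matrix of cofactors of $A$. Optimal approximation property: there are a linear quasi-interpolation operator $Q_h:L^1(\Omega)\to V^h$ and a constant $C$ independent of $h$ with $\|v-Q_hv\|_{k,p}\le Ch^{l+1-k}|v|_{l+1,p}$ for $v\in W^{l+1,p}(\Omega)$, $1\le p\le\infty$, $0\le k\le l\le d$. Inverse estimates: $\|v\|_{s,p}\le Ch^{l-s+\min(0,n/p-n/q)}\|v\|_{l,q}$ for all $v\in V^h$, $0\le l\le s$, $1\le p,q\le\infty$, norms being understood element by element when necessary. $f\in C(\Omega)$, $f>0$, is such that $\psi_h\mapsto\int_\Omega f\psi_h\,dx$ is well defined on $V_0^h$; $g\in C(\partial\Omega)$ and $g_h$ is the interpolant in $V^h$ of a smooth extension of $g$. Standing assumption: the discrete problem has a unique strictly convex solution $u_h$. Set $$Y^h=\Big\{v_h\in V^h:\ v_h=g_h\text{ on }\partial\Omega,\ \|v_h-u_h\|_1<\tfrac{\delta h^{1+n/2}}4\Big\},$$ where $\delta>0$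 is a small constant, which may be chosen as small as needed. $0<m\le M$ are constants such that for every $v_h\in Y^h$ all eigenvalues of $\operatorname{cof}D^2v_h(x)$ lie in $[m,M]$ for a.e. $x\in\Omega$ (the choice of $\delta$ ensures such constants exist). *)

(* Defs.v *)
From HB Require Import structures.
From mathcomp Require Import all_boot all_order all_algebra.
From mathcomp Require Import all_classical all_reals all_analysis.
Set Implicit Arguments. Unset Strict Implicit. Unset Printing Implicit Defensive.
Import Order.TTheory GRing.Theory Num.Theory.
Import numFieldNormedType.Exports.
Local Open Scope classical_set_scope.
Local Open Scope ring_scope.

(* Borel sigma-algebra and Lebesgue measure on R^n = 'rV[R]_n: the product
   sigma-algebra, and the n-fold product of the Lebesgue measure of R. *)
Section measurable_rV.
Variables (R : realType) (n : nat).

Definition rV_coord (i : 'I_n) (x : 'rV[R]_n) : measurableTypeR R := x ord0 i.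

Let m0 : g_sigma_preimage rV_coord set0.
Proof. exact: sigma_algebra0. Qed.
Let mC A : g_sigma_preimage rV_coord A -> g_sigma_preimage rV_coord (~` A).
Proof. exact: sigma_algebraC. Qed.
Let mU (F : _^nat) : (forall i, g_sigma_preimage rV_coord (F i)) ->
  g_sigma_preimage rV_coord (\bigcup_i (F i)).
Proof. exact: sigma_algebra_bigcup. Qed.

HB.instance Definition _ := @isMeasurable.Build default_measure_display
  'rV[R]_n (g_sigma_preimage rV_coord) m0 mC mU.

Lemma measurable_rV_coord i : measurable_fun setT (rV_coord i).
Proof.
move=> _ A mA; rewrite setTI; apply: sub_sigma_algebra.
by rewrite (bigD1 i)//=; left; exists A => //; rewrite setTI.
Qed.

Lemma measurable_fun_rVP d (T : measurableType d) (f : T -> 'rV[R]_n) :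
  (forall i, measurable_fun setT (rV_coord i \o f)) -> measurable_fun setT f.
Proof.
move=> mf; apply: (@measurability _ _ _ _ _ _ (\big[setU/set0]_(i < n)
  preimage_set_system setT (rV_coord i) measurable)) => //.
move=> _ [B + <-]; rewrite setTI.
elim/big_rec : _ => [[]|i X _ IH [[A mA <-]|/IH//]].
by rewrite setTI -[X in measurable X]setTI; exact: mf.
Qed.

End measurable_rV.

Section lebesgue_rV.
Variable R : realType.

Definition rV_cons n (p : measurableTypeR R * 'rV[R]_n) : 'rV[R]_n.+1 :=
  \row_i oapp (p.2 ord0) (p.1 : R) (unlift ord0 i).

Lemma measurable_rV_cons n : measurable_fun setT (@rV_cons n).
Proof.
apply: measurable_fun_rVP => i.
have [j ->|->] := unliftP ord0 i.
  rewrite (_ : _ \o _ = (@rV_coord R n j) \o snd); last first.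
    by apply/funext => p; rewrite /rV_coord /= mxE liftK.
  apply: measurableT_comp; first exact: measurable_rV_coord.
  exact: measurable_snd.
rewrite (_ : _ \o _ = fst); first exact: measurable_fst.
by apply/funext => p; rewrite /rV_coord /= mxE unlift_none.
Qed.

Definition rV_uncons n (x : 'rV[R]_n.+1) : measurableTypeR R * 'rV[R]_n :=
  (x ord0 ord0, \row_j x ord0 (lift ord0 j)).

Lemma rV_consK n : cancel (@rV_cons n) (@rV_uncons n).
Proof.
case=> a v; rewrite /rV_uncons mxE unlift_none/=; congr pair.
by apply/rowP => j; rewrite !mxE liftK.
Qed.

Lemma measurable_rV_uncons n : measurable_fun setT (@rV_uncons n).
Proof.
apply/measurable_fun_pairP; split; first exact: (@measurable_rV_coord R _ ord0).
apply: measurable_fun_rVP => j.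
rewrite (_ : _ \o _ = @rV_coord R _ (lift ord0 j)).
  exact: measurable_rV_coord.
by apply/funext => x; rewrite /rV_coord /= mxE.
Qed.

Section cons_measure.
Variables (n : nat) (m : {sigma_finite_measure set 'rV[R]_n -> \bar R}).

Definition cons_measure : set 'rV[R]_n.+1 -> \bar R :=
  pushforward (@lebesgue_measure R \x m)%E (@rV_cons n).

HB.instance Definition _ := Measure.copy cons_measure
  (measure_function_pushforward__canonical__measure_function_Measure
    (@lebesgue_measure R \x m)%E (@measurable_rV_cons n)).

Let cons_sigma_finite : sigma_finite setT cons_measure.
Proof.
have /sigma_finiteP[F [TF ndF Foo]] := sigma_finiteT (@lebesgue_measure R).
have /sigma_finiteP[G [TG ndG Goo]] := sigma_finiteT m.
exists (fun k => @rV_uncons n @^-1` (F k `*` G k)).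
  apply/esym; rewrite -subTset => x _.
  have [i _ Fi] : (\bigcup_i F i) (rV_uncons x).1 by rewrite -TF.
  have [j _ Gj] : (\bigcup_j G j) (rV_uncons x).2 by rewrite -TG.
  exists (maxn i j) => //; split.
    by move: Fi; exact/subsetPset/ndF/leq_maxl.
  by move: Gj; exact/subsetPset/ndG/leq_maxr.
move=> k; have [mF Fk] := Foo k; have [mG Gk] := Goo k.
have mFG : measurable (F k `*` G k) by exact: measurableX.
split; first by rewrite -[X in measurable X]setTI; exact: measurable_rV_uncons.
rewrite /cons_measure /pushforward -comp_preimage.
rewrite (_ : _ \o _ = id); last by apply/funext => p /=; rewrite rV_consK.
by rewrite preimage_id product_measure1E// lte_mul_pinfty// ge0_fin_numE.
Qed.

HB.instance Definition _ :=
  Measure_isSigmaFinite.Build _ _ _ cons_measure cons_sigma_finite.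

End cons_measure.

Fixpoint lebesgue_rV n : {sigma_finite_measure set 'rV[R]_n -> \bar R} :=
  match n with
  | 0%N => @dirac _ 'rV[R]_0 0 R
  | k.+1 => cons_measure (lebesgue_rV k)
  end.

End lebesgue_rV.

Section geometry.
Variables (R : realType) (n : nat).
Local Notation U := 'rV[R]_n.

(* The library norm of 'rV[R]_n is the sup norm; diameters, inscribed balls and
   gradients are measured with the Euclidean one. *)
Definition dotv (x y : U) : R := \sum_i x ord0 i * y ord0 i.
Definition enorm (x : U) : R := Num.sqrt (dotv x x).

Definition ediam (A : set U) : R :=
  sup [set r | exists x y, [/\ A x, A y & r = enorm (x - y)]].

Definition inradius (A : set U) : R :=
  sup [set r | 0 <= r /\ exists c, [set x | enorm (x - c) <= r] `<=` A].

Definition boundary (A : set U) : set U := closure A `\` A°.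

(* Near each boundary point A is the strict epigraph, in some unit direction
   [e], of a Lipschitz function [gamma] of the coordinates orthogonal to [e]
   (invariance along [e]). *)
Definition lipschitz_boundary (A : set U) : Prop :=
  forall x0, boundary A x0 ->
  exists (e : U) (gamma : U -> R) (L : R), [/\ enorm e = 1,
    forall x t, gamma (x + t *: e) = gamma x,
    forall x y, `|gamma x - gamma y| <= L * enorm (x - y) &
    \forall x \near x0, A x <-> gamma x < dotv x e].

(* The rows of A are the n + 1 vertices of a simplex. *)
Definition face (A : 'M[R]_(n.+1, n)) (I : {set 'I_n.+1}) : set U :=
  [set x | exists t : 'rV[R]_n.+1, [/\ forall i, 0 <= t ord0 i,
    forall i, i \notin I -> t ord0 i = 0, \sum_i t ord0 i = 1 & x = t *m A]].

Definition simplex (A : 'M[R]_(n.+1, n)) : set U := face A [set: 'I_n.+1]%SET.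

Definition affinely_independent (A : 'M[R]_(n.+1, n)) : bool :=
  row_free (row_mx (const_mx 1 : 'cV[R]_n.+1) A).

Definition triangulation (Omega : set U) (T : seq 'M[R]_(n.+1, n)) : Prop :=
  [/\ uniq T, {in T, forall A, affinely_independent A},
    closure Omega = \bigcup_(A in [set` T]) simplex A &
    {in T &, forall A B, A != B -> exists I J : {set 'I_n.+1},
       [/\ I \proper [set: 'I_n.+1]%SET, J \proper [set: 'I_n.+1]%SET,
           simplex A `&` simplex B = face A I &
           simplex A `&` simplex B = face B J]}].

Definition max_diameter (T : seq 'M[R]_(n.+1, n)) (h : R) : Prop :=
  {in T, forall A, ediam (simplex A) <= h} /\
  exists2 A, A \in T & ediam (simplex A) = h.

Definition shape_regular (H : set R) (T : R -> seq 'M[R]_(n.+1, n)) : Prop :=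
  exists sigma : R, forall h, H h -> {in T h, forall A,
    ediam (simplex A) <= sigma * inradius (simplex A)}.

Definition quasi_uniform (H : set R) (T : R -> seq 'M[R]_(n.+1, n)) : Prop :=
  exists tau : R, forall h, H h -> {in T h, forall A,
    h <= tau * ediam (simplex A)}.

End geometry.

Section calculus.
Variables (R : realType) (n : nat).
Local Notation U := 'rV[R]_n.

Definition basis_vec (i : 'I_n) : U := delta_mx ord0 i.

Definition partial (i : 'I_n) (f : U -> R) : U -> R :=
  fun x => 'D_(basis_vec i) f x.

Definition grad (f : U -> R) (x : U) : U := \row_i partial i f x.

(* For a C^1 piecewise polynomial f this is meaningful off the faces of the
   triangulation, hence almost everywhere. *)
Definition hess (f : U -> R) (x : U) : 'M[R]_n :=
  \matrix_(i, j) partial i (partial j f) x.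

Definition cofmx (A : 'M[R]_n) : 'M[R]_n := \matrix_(i, j) cofactor A i j.

Definition pderiv (a : 'I_n -> nat) (f : U -> R) : U -> R :=
  foldr partial f (flatten [seq nseq (a i) i | i <- enum 'I_n]).

Definition C1_on (Omega : set U) (f : U -> R) : Prop :=
  forall x, Omega x -> forall i : 'I_n,
    derivable f x (basis_vec i) /\ {for x, continuous (partial i f)}.

Definition smooth (f : U -> R) : Prop :=
  forall s : seq 'I_n, continuous (foldr partial f s) /\
    forall i x, derivable (foldr partial f s) x (basis_vec i).

Definition test_function (Omega : set U) (phi : U -> R) : Prop :=
  smooth phi /\ exists K : set U, [/\ compact K, K `<=` Omega &
    forall x, ~ K x -> phi x = 0].

Definition poly_le (d : nat) (p : U -> R) : Prop :=
  exists c : {ffun 'I_n -> 'I_d.+1} -> R, forall x,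
    p x = \sum_(a : {ffun 'I_n -> 'I_d.+1} | (\sum_i a i <= d)%N)
            c a * \prod_i x ord0 i ^+ a i.

Definition strictly_convex_on (Omega : set U) (f : U -> R) : Prop :=
  forall x y (t : R), Omega x -> Omega y -> x != y -> 0 < t < 1 ->
    f (t *: x + (1 - t) *: y) < t * f x + (1 - t) * f y.

End calculus.

Section sobolev.
Variables (R : realType) (n : nat).
Local Notation U := 'rV[R]_n.
Local Notation mu := (lebesgue_rV R n).

Definition order (a : 'I_n -> nat) : nat := (\sum_i a i)%N.

Definition multi_indices (k : nat) : seq ('I_n -> nat) :=
  [seq (fun i => nat_of_ord (a i)) | a : {ffun 'I_n -> 'I_k.+1}].

Definition Lp_norm (p : \bar R) (A : set U) (f : U -> R) : \bar R :=
  Lnorm mu p (EFin \o (f \_ A)).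

Definition in_Lp (p : \bar R) (A : set U) (f : U -> R) : Prop :=
  measurable_fun A f /\ (Lp_norm p A f < +oo)%E.

Definition lp_sum (p : \bar R) (s : seq (\bar R)) : \bar R :=
  match p with
  | r%:E => ((\sum_(x <- s) x `^ r) `^ r^-1)%E
  | _ => \big[maxe/0%E]_(x <- s) x
  end.

(* Sobolev (semi)norms are computed from a family J of functions, J a standing
   for the derivative of multi-index a, and summed over a list E of open sets.
   E = [:: Omega] gives the usual norm; the list of the interiors of the
   elements of a triangulation gives the element by element norm. *)
Definition sob_norm_of (P : pred nat) (E : seq (set U)) (k : nat) (p : \bar R)
    (J : ('I_n -> nat) -> U -> R) : \bar R :=
  lp_sum p [seq Lp_norm p A (J a) |
    A <- E, a <- [seq a <- multi_indices k | P (order a)]].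

Definition sob_norm E k := sob_norm_of (fun j => (j <= k)%N) E k.
Definition sob_seminorm E k := sob_norm_of (fun j => j == k) E k.

Definition jet (f : U -> R) : ('I_n -> nat) -> U -> R := fun a => pderiv a f.

Definition H1_norm (Omega : set U) (f : U -> R) : \bar R :=
  sob_norm [:: Omega] 1 2%:E (jet f).
Definition H1_seminorm (Omega : set U) (f : U -> R) : \bar R :=
  sob_seminorm [:: Omega] 1 2%:E (jet f).

Definition elements (T : seq 'M[R]_(n.+1, n)) : seq (set U) :=
  [seq (simplex A)° | A <- T].

Definition weak_derivative (Omega : set U) (a : 'I_n -> nat) (v w : U -> R) :
    Prop :=
  (forall K, compact K -> K `<=` Omega ->
    mu.-integrable K (EFin \o v) /\ mu.-integrable K (EFin \o w)) /\
  forall phi, test_function Omega phi ->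
    \int[mu]_(x in Omega) (v x * pderiv a phi x) =
    (-1) ^+ order a * \int[mu]_(x in Omega) (w x * phi x).

(* v belongs to W^{k,p}(Omega), with weak derivatives J *)
Definition sobolev (Omega : set U) (k : nat) (p : \bar R) (v : U -> R)
    (J : ('I_n -> nat) -> U -> R) : Prop :=
  forall a, (order a <= k)%N ->
    weak_derivative Omega a v (J a) /\ in_Lp p Omega (J a).

(* Membership in H_0^1(Omega), the H^1 closure of the test functions, for
   functions of class C^1 in Omega: their weak gradient is the classical one. *)
Definition in_H10 (Omega : set U) (v : U -> R) : Prop :=
  forall e : R, 0 < e -> exists2 phi, test_function Omega phi &
    (H1_norm Omega (v \- phi)%R < e%:E)%E.

End sobolev.

Section spline.
Variables (R : realType) (n : nat).
Local Notation U := 'rV[R]_n.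
Local Notation mu := (lebesgue_rV R n).
Variables (Omega : set U) (d : nat).

(* S_d^1(T). Elements are functions on R^n of which only the values on
   closure Omega matter: there, being polynomial on each closed simplex,
   they are continuous. *)
Definition spline_space (T : seq 'M[R]_(n.+1, n)) : set (U -> R) :=
  [set s | C1_on Omega s /\
    {in T, forall A, exists2 p, poly_le d p & {in simplex A, s =1 p}}].

Definition spline_space0 (T : seq 'M[R]_(n.+1, n)) : set (U -> R) :=
  spline_space T `&` in_H10 Omega.

Definition einv (p : \bar R) : R := if p is r%:E then r^-1 else 0.

Definition approximation_property (H : set R)
    (T : R -> seq 'M[R]_(n.+1, n)) : Prop :=
  exists Q : R -> (U -> R) -> U -> R,
    (forall h, H h ->
      [/\ forall v, in_Lp 1%E Omega v -> spline_space (T h) (Q h v),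
          forall v w, in_Lp 1%E Omega v -> in_Lp 1%E Omega w ->
            {ae mu, forall x, Omega x -> v x = w x} ->
            {in Omega, Q h v =1 Q h w} &
          forall (c : R) v w, in_Lp 1%E Omega v -> in_Lp 1%E Omega w ->
            {in Omega, Q h (c \*o v \+ w) =1 c \*o Q h v \+ Q h w}]) /\
    forall (k l : nat) (p : \bar R), (k <= l <= d)%N -> (1 <= p)%E ->
    exists C : R, forall h, H h -> forall v J, sobolev Omega l.+1 p v J ->
      (sob_norm (elements (T h)) k p
         (fun a => J a \- pderiv a (Q h v))%R <=
       (C * h ^+ (l.+1 - k))%:E * sob_seminorm [:: Omega] l.+1 p J)%E.

Definition inverse_estimates (H : set R)
    (T : R -> seq 'M[R]_(n.+1, n)) : Prop :=
  forall (l s : nat) (p q : \bar R), (l <= s)%N -> (1 <= p)%E -> (1 <= q)%E ->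
  exists C : R, forall h, H h -> forall v, spline_space (T h) v ->
    (sob_norm (elements (T h)) s p (jet v) <=
     (C * h `^ (l%:R - s%:R
                + Num.min 0 (n%:R * einv p - n%:R * einv q)))%:E *
     sob_norm (elements (T h)) l q (jet v))%E.

(* v is the interpolant of G in the spline space for some unisolvent family of
   degrees of freedom (linear functionals) phi_i. *)
Definition interpolant (T : seq 'M[R]_(n.+1, n)) (G v : U -> R) : Prop :=
  exists (N : nat) (phi : 'I_N -> (U -> R) -> R),
    [/\ forall i (c : R) u w, phi i (c \*o u \+ w) = c * phi i u + phi i w,
        forall i u w, {in closure Omega, u =1 w} -> phi i u = phi i w,
        forall w, spline_space T w -> (forall i, phi i w = 0) ->
          {in closure Omega, w =1 cst 0},
        spline_space T v & forall i, phi i v = phi i G].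

Definition agree_on_boundary (u v : U -> R) : Prop :=
  {in boundary Omega, u =1 v}.

Definition discrete_solution (T : seq 'M[R]_(n.+1, n)) (f gh u : U -> R) :
    Prop :=
  [/\ spline_space T u, agree_on_boundary u gh &
    forall w, spline_space0 T w ->
      - n%:R^-1 * \int[mu]_(x in Omega)
          dotv (grad u x *m (cofmx (hess u x))^T) (grad w x)
      = \int[mu]_(x in Omega) (f x * w x)].

Definition Yset (T : seq 'M[R]_(n.+1, n)) (gh uh : U -> R) (delta h : R) :
    set (U -> R) :=
  [set v | [/\ spline_space T v, agree_on_boundary v gh &
    (H1_norm Omega (v \- uh)%R < (delta * h `^ (1 + n%:R / 2) / 4)%:E)%E]].

Definition time_marching (T : seq 'M[R]_(n.+1, n)) (f gh : U -> R) (nu : R)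
    (u0 : U -> R) (u : nat -> U -> R) : Prop :=
  u 0%N = u0 /\ forall k,
    [/\ spline_space T (u k.+1), agree_on_boundary (u k.+1) gh &
      forall psi, spline_space0 T psi ->
        nu * \int[mu]_(x in Omega) dotv (grad (u k.+1) x) (grad psi x) =
        nu * \int[mu]_(x in Omega) dotv (grad (u k) x) (grad psi x) +
        \int[mu]_(x in Omega) ((\det (hess (u k) x) - f x) * psi x)].

End spline.

(* Main.v *)
(* Off the hyperplanes carrying the faces of the mesh, splines are smooth, and
   integrals ignore these hyperplanes.  For splines v, e and a spline psi vanishing
   on the boundary, div (cof D^2 v) = 0 holds weakly, although cof D^2 v jumps
   across faces:
     int (cof D^2 v : D^2 e) psi = - int (cof D^2 v) De . Dpsi,
   because det (Df_1, .., Df_n) integrates to zero whenever the f_k are Lipschitz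
   and one of them is zero outside the domain; Bernstein polynomials, which keep
   the Lipschitz bounds, reduce this to the smooth case.
   The determinant is a polynomial of degree at most 3, so Simpson's rule gives
   det D^2 u_k - det D^2 u_h = A : D^2 e_k, where e_k = u_k - u_h and A averages
   the cofactor matrices at u_h, u_h + e_k / 2 and u_k, which all belong to the
   given neighbourhood of u_h.  Hence nu (De_(k+1), Dpsi) = ((nu - A) De_k, Dpsi);
   with nu = m + M one has m <= nu - A <= M, and psi = e_(k+1) yields
   |e_(k+1)|_1^2 <= M / (M + 2 m) |e_k|_1^2.  Poincare's inequality keeps the
   iterates in the neighbourhood.
   Splines in H^1_0 are those vanishing on the boundary: a nonzero boundary value
   is detected by a radial field centred outside the domain, and conversely
   truncated Bernstein polynomials are test functions. *)
Require Import Defs.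
From mathcomp Require Import all_boot all_order all_algebra fingroup perm.
From mathcomp Require Import all_classical all_reals all_analysis measurable_realfun.
From mathcomp Require Import ring lra.
Set Implicit Arguments. Unset Strict Implicit. Unset Printing Implicit Defensive.
Import Order.TTheory GRing.Theory Num.Theory.
Import numFieldNormedType.Exports.
Local Open Scope classical_set_scope.
Local Open Scope ring_scope.

(** * Lebesgue measure *)

(** The only integration by parts is the fundamental theorem of calculus along one coordinate of a
    cube containing the domain, for functions extended by zero. Such extensions are Lipschitz and no
    better, which explains the class used below: Lipschitz functions that are regular off a null
    set, approximated with bounded gradients converging almost everywhere.

    The rate comes from [2 (B x . y) <= M (|x|^2 + |y|^2)] for symmetric [B] between [0] and [M].
    With [B = nu - A] and the two errors it reads [2 (m + M) |e_(k+1)|_1^2 <= M (|e_k|_1^2 +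
    |e_(k+1)|_1^2)], and the last term is absorbed on the left.

    The contraction acts on the seminorm, whereas the eigenvalue bounds hold in a ball of the full
    norm. Let [cP] be the constant bounding the norm by the seminorm on splines vanishing on the
    boundary. A start within [r] of [u_h] keeps every error below [r] in seminorm, hence below
    [cP r] in norm; this is why [delta1 = delta0 / cP]. As [cP] only depends on the size of the
    domain, neither [nu] nor [delta1] depends on [h]. *)

Section null_sets.
Context d (X : measurableType d) (R : realType).
Variable mu : {measure set X -> \bar R}.
Import HBNNSimple.

(** A nonnegative integral is a supremum over the simple functions below the integrand. Cutting such
    a function off on [N] keeps it simple and preserves its integral, so both suprema agree even if
    [f] is not measurable. *)
Lemma ge0_integral_setD_null (D N : set X) (f : X -> \bar R) :
  measurable N -> mu N = 0%E -> (forall x, D x -> (0 <= f x)%E) ->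
  (\int[mu]_(x in D) f x = \int[mu]_(x in D `\` N) f x)%E.
Proof.
move=> mN N0 f0.
rewrite !ge0_integralE//; last by move=> x [Dx _]; exact: f0.
apply/eqP; rewrite eq_le; apply/andP; split.
  apply: ge_ereal_sup => _ [h /= hf <-]; apply: ereal_sup_ubound.
  have mCN : measurable (~` N) by exact: measurableC.
  exists (proj_nnsfun h mCN); last first.
    rewrite (_ : (proj_nnsfun h mCN : X -> R) = h \_ (~` N)); last first.
      by rewrite mrestrict.
    rewrite -integral_nnsfun// -setTD -ge0_negligible_integral//.
    - by rewrite integral_nnsfun// patch_setT.
    - exact/measurable_EFinP.
    - by move=> x _; rewrite lee_fin.
  move=> x /=; rewrite /patch mindicE.
  have := hf x; rewrite /patch; case: (boolP (x \in D)) => Dx.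
    case: (boolP (x \in ~` N)) => Nx; rewrite ?mulr1 ?mulr0.
      rewrite ifT//; rewrite !inE in Dx Nx *.
      by split.
    by rewrite ifF//; apply/negbTE; apply: contra Nx; rewrite !inE => -[].
  rewrite lee_fin => hx; rewrite ifF.
    by rewrite lee_fin mulr_le0_ge0// ler0n.
  by apply/negbTE; apply: contra Dx; rewrite !inE => -[].
apply: ge_ereal_sup => _ [h /= hf <-]; apply: ereal_sup_ubound.
exists h => // x; apply: (le_trans (hf x)).
rewrite /patch; case: ifPn => [|_]; first by rewrite !inE => -[Dx _]; rewrite mem_set.
by case: ifPn => //; rewrite inE; exact: f0.
Qed.

(* No measurability: second derivatives of splines are junk on the faces. *)
Lemma integral_setD_null (D N : set X) (f : X -> \bar R) :
  measurable N -> mu N = 0%E ->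
  (\int[mu]_(x in D) f x = \int[mu]_(x in D `\` N) f x)%E.
Proof.
move=> mN N0; rewrite integralE [RHS]integralE.
by rewrite !(@ge0_integral_setD_null D N)//.
Qed.

Lemma Rintegral_setD_null (D N : set X) (f : X -> R) :
  measurable N -> mu N = 0%E ->
  \int[mu]_(x in D) f x = \int[mu]_(x in D `\` N) f x.
Proof. by move=> mN N0; rewrite /Rintegral (@integral_setD_null D N). Qed.

End null_sets.

(** * Borel sets, cubes and slices of R^n *)

Section rV_measure.
Context {R : realType}.
Local Notation mu n := (lebesgue_rV R n).

Lemma measurable_coordinate n (i : 'I_n) :
  measurable_fun setT (fun x : 'rV[R]_n => x ord0 i).
Proof. exact: measurable_rV_coord. Qed.

Lemma measurable_box n (I : 'I_n -> interval R) :
  measurable [set x : 'rV[R]_n | forall i, x ord0 i \in I i].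
Proof.
rewrite (_ : [set _ | _] =
    \big[setI/setT]_(i < n) ((fun x : 'rV[R]_n => x ord0 i) @^-1` [set` I i])).
  apply: bigsetI_measurable => i _; rewrite -[X in measurable X]setTI.
  exact: (measurable_coordinate i).
apply/seteqP; split => x /= h.
  by elim/big_rec : _ => //= i A _ Ax; split => //; exact: h.
by move=> i; move: h; rewrite (bigD1 i)//= => -[].
Qed.

Lemma normr_coord n (x : 'rV[R]_n) i : `|x ord0 i| <= `|x|.
Proof.
rewrite /Num.norm/= mx_normrE; apply: (le_bigmax _ (fun i : 'I_1 * 'I_n => `|x i.1 i.2|) (ord0, i)).
Qed.

Lemma normr_rV_le n (x : 'rV[R]_n) (r : R) : 0 <= r ->
  (forall i, `|x ord0 i| <= r) -> `|x| <= r.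
Proof.
by move=> r0 h; rewrite [X in X <= _]mx_normrE; apply: bigmax_le => // -[i j] _ /=; rewrite ord1.
Qed.

Definition cube n (c : 'rV[R]_n) (r : R) : set 'rV[R]_n :=
  [set x | forall i, `|x ord0 i - c ord0 i| <= r].

Lemma cubeE n (c : 'rV[R]_n) r : cube c r =
  [set x | forall i, x ord0 i \in `[c ord0 i - r, c ord0 i + r]].
Proof.
apply/seteqP; split => x /= h i; have := h i; rewrite ler_distl in_itv/=;
  lra.
Qed.

Lemma measurable_cube n (c : 'rV[R]_n) r : measurable (cube c r).
Proof. by rewrite cubeE; exact: measurable_box. Qed.

Lemma ball_cube n (c : 'rV[R]_n) (r : R) : 0 < r -> cube c (r / 2) `<=` ball c r.
Proof.
move=> r0 x /= h; rewrite -ball_normE /= /ball_ /=.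
apply: (@le_lt_trans _ _ (r / 2)); last lra.
by apply: normr_rV_le => [|i]; [lra|rewrite !mxE distrC; exact: h].
Qed.

(** The sigma-algebra is generated by the coordinates, so openness has to be reduced to boxes: an
    open set is the union of the cubes it contains with rational centre and radius [1 / (k + 1)], a
    countable family. *)
Lemma open_measurable_rV n (O : set 'rV[R]_n) : open O -> measurable O.
Proof.
move=> oO.
pose B (q : {ffun 'I_n -> rat} * nat) : set 'rV[R]_n :=
  cube (\row_i ratr (q.1 i)) (q.2.+1%:R^-1).
rewrite (_ : O = \bigcup_q (if `[< B q `<=` O >] then B q else set0)).
  apply: countable_bigcupT_measurable; first exact: countableP.
  by move=> q; case: ifPn => // _; exact: measurable_cube.
apply/seteqP; split => x /=; last first.
  by move=> [q _]; case: asboolP => // /[apply].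
move=> Ox; have /nbhs_ballP[e /= e0 xeO] : nbhs x O by exact: open_nbhs_nbhs.
(* Every point of the rational cube chosen below is then within [2 / (k + 1) < e / 2] of [x]. *)
have [k ke] : exists k : nat, k.+1%:R^-1 < e / 4.
  have e4 : 0 < e / 4 by lra.
  have := near_infty_natSinv_lt (PosNum e4) => -[k _ /(_ k (leqnn k)) /= ?].
  by exists k.
have k0 : 0 < k.+1%:R^-1 :> R by rewrite invr_gt0.
have qE i : {q : rat | `|x ord0 i - ratr q| <= k.+1%:R^-1}.
  apply: cid; have [q] := @rat_in_itvoo R (x ord0 i - k.+1%:R^-1)
    (x ord0 i + k.+1%:R^-1) ltac:(move: k0; set a := k.+1%:R^-1; lra).
  by rewrite in_itv/= => a; exists q; rewrite ler_distl; move: k0 a; set b := k.+1%:R^-1; lra.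
exists ([ffun i => sval (qE i)], k) => //.
have Bx : B ([ffun i => sval (qE i)], k) x.
  by move=> i /=; rewrite mxE ffunE; exact: (svalP (qE i)).
case: asboolP => // -[]; apply: subset_trans xeO => y By.
apply: (@ball_cube _ x e e0) => i.
rewrite (le_trans (ler_distD (ratr (sval (qE i))) _ _))//.
have := By i; have := Bx i; rewrite /= !mxE !ffunE [`|x _ _ - _|]distrC; move: ke; set a := k.+1%:R^-1; lra.
Qed.

Lemma open_continuous_measurable_rV n (O : set 'rV[R]_n) (f : 'rV[R]_n -> R) :
  open O -> {in O, continuous f} -> measurable_fun O f.
Proof.
move=> oO fc.
apply: (measurability _ (RGenOpens.measurableE R)) => _ [_ [a [b ->] <-]].
apply: open_measurable_rV.
rewrite openE => x [Ox fx]; apply: filterI; first exact: open_nbhs_nbhs.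
apply: fc; first by rewrite inE.
by apply: open_nbhs_nbhs; split => //; exact: interval_open.
Qed.

Lemma integrable_rV_cons n (F : 'rV[R]_n.+1 -> \bar R) :
  (mu n.+1).-integrable setT F ->
  (@lebesgue_measure R \x mu n)%E.-integrable setT (F \o @rV_cons R n).
Proof.
move=> iF; have mF := measurable_int _ iF.
have mc := @measurable_rV_cons R n.
apply/integrableP; split; first exact: measurableT_comp.
have /integrableP[_] := iF.
rewrite /= /cons_measure ge0_integral_pushforward//.
exact: measurableT_comp.
Qed.

Lemma integral_lebesgue_rVS n (F : 'rV[R]_n.+1 -> \bar R) :
  (mu n.+1).-integrable setT F ->
  (\int[mu n.+1]_x F x =
   \int[@lebesgue_measure R]_a \int[mu n]_v F (rV_cons (a, v)))%E.
Proof.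
move=> iF; have mc := @measurable_rV_cons R n.
have iF' := integrable_rV_cons iF.
rewrite /= /cons_measure integral_pushforward//; last exact: measurable_int iF.
by rewrite -integral12_prod_meas1.
Qed.

Lemma integral_lebesgue_rVS_swap n (F : 'rV[R]_n.+1 -> \bar R) :
  (mu n.+1).-integrable setT F ->
  (\int[mu n.+1]_x F x =
   \int[mu n]_v \int[@lebesgue_measure R]_a F (rV_cons (a, v)))%E.
Proof.
move=> iF; have iF' := integrable_rV_cons iF.
by rewrite integral_lebesgue_rVS// (Fubini iF').
Qed.

Lemma cube_rV_cons n (c : 'rV[R]_n.+1) r :
  @rV_cons R n @^-1` cube c r =
  `[c ord0 ord0 - r, c ord0 ord0 + r] `*` cube (\row_j c ord0 (lift ord0 j)) r.
Proof.
apply/seteqP; split => -[a v] /=.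
  move=> h; split.
    have := h ord0; rewrite mxE unlift_none/= in_itv/= ler_distl; lra.
  by move=> j /=; have := h (lift ord0 j); rewrite !mxE liftK.
move=> [ha hv] i; have [j ->|->] := unliftP ord0 i.
  by have := hv j; rewrite !mxE liftK.
rewrite mxE unlift_none/=; move: ha; rewrite in_itv/= ler_distl; lra.
Qed.

Lemma lebesgue_rV_cube n (c : 'rV[R]_n) (r : R) : 0 <= r ->
  mu n (cube c r) = ((r *+ 2) ^+ n)%:E.
Proof.
move=> r0; elim: n c => [|n IH] c.
  by rewrite /= diracE mem_set// => -[].
rewrite /= /cons_measure /pushforward cube_rV_cons product_measure1E//; last first.
  exact: measurable_cube.
rewrite IH [X in (X * _)%E](_ : _ = @lebesgue_measure R `[c ord0 ord0 - r, c ord0 ord0 + r]%classic)// lebesgue_measure_itv/= lte_fin.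
rewrite exprS EFinM; congr *%E.
have [/eqP|] := eqVneq r 0; last first.
  move=> rn0; rewrite ifT//; last lra.
  by rewrite -EFinD; congr EFin; rewrite mulr2n; ring.
by move/eqP => ->; rewrite addr0 subr0 ltxx mul0rn.
Qed.

Lemma lebesgue_rV_open_gt0 n (O : set 'rV[R]_n) :
  open O -> O !=set0 -> (0 < mu n O)%E.
Proof.
move=> oO [x Ox]; have /nbhs_ballP[e /= e0 xeO] : nbhs x O by exact: open_nbhs_nbhs.
have e2 : 0 < e / 2 by lra.
apply: (@lt_le_trans _ _ (mu n (cube x (e / 2)))); last first.
  apply: le_measure; rewrite ?inE; [exact: measurable_cube|exact: open_measurable_rV|].
  exact: subset_trans (ball_cube e0) xeO.
by rewrite lebesgue_rV_cube ?(ltW e2)// lte_fin exprn_gt0// pmulrn_rgt0.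
Qed.

Lemma measurable_affine n (c : 'I_n -> R) b :
  measurable_fun setT (fun x : 'rV[R]_n => \sum_i c i * x ord0 i - b).
Proof.
apply: measurable_funB => //; apply: measurable_sum => i.
by apply: measurable_funM => //; exact: measurable_coordinate.
Qed.

(** Induction on the dimension. If the first coefficient vanishes, each slice at a fixed first
    coordinate is a hyperplane of lower dimension. Otherwise each slice along the first coordinate
    is a single point, and uniqueness of the product measure allows slicing in that order. *)
Lemma lebesgue_rV_hyperplane n (c : 'I_n -> R) b : (exists i, c i != 0) ->
  mu n [set x : 'rV[R]_n | \sum_i c i * x ord0 i = b] = 0%E.
Proof.
elim: n c b => [c b [[]]//|n IH c b [i ci]].
set A := [set x : 'rV[R]_n.+1 | _].
have mA : measurable A.
  rewrite (_ : A = (fun x : 'rV[R]_n.+1 => \sum_i c i * x ord0 i - b) @^-1` [set 0]).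
    rewrite -[X in measurable X]setTI.
    exact: (measurable_affine c b).
  by apply/seteqP; split => x; rewrite /A/=; lra.
have mA' : measurable (@rV_cons R n @^-1` A).
  by rewrite -[X in measurable X]setTI; exact: measurable_rV_cons.
have AE : @rV_cons R n @^-1` A =
   [set p : measurableTypeR R * 'rV[R]_n |
      c ord0 * p.1 + \sum_j c (lift ord0 j) * p.2 ord0 j = b].
  apply/funext => -[a v]; rewrite /A/= big_ord_recl !mxE unlift_none/=.
  congr (_ + _ = _); apply: eq_bigr => j _.
  by rewrite mxE liftK.
rewrite /= /cons_measure /pushforward.
have [c0|c0] := eqVneq (c ord0) 0.
  rewrite /product_measure1 integral0_eq// => a _ /=.
  rewrite AE [X in mu n X](_ : _ =
    [set v : 'rV[R]_n | \sum_j c (lift ord0 j) * v ord0 j = b]).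
    apply: IH; move: ci; have [j ->|->] := unliftP ord0 i; last by rewrite c0 eqxx.
    by exists j.
  by apply/seteqP; split => v /=; rewrite /xsection/= inE/= c0 mul0r add0r.
rewrite (product_measure_unique (m' := (@lebesgue_measure R \x^ mu n)%E))//; last first.
  by move=> B C mB mC; rewrite /= product_measure2E.
rewrite /= /product_measure2 integral0_eq// => v _ /=.
rewrite AE [X in lebesgue_measure X](_ : _ =
  [set (b - \sum_j c (lift ord0 j) * v ord0 j) / c ord0]).
  exact: lebesgue_measure_set1.
apply/seteqP; split => a /=; rewrite /ysection/= inE/=.
  by move=> <-; field.
by move=> ->; field.
Qed.

End rV_measure.

(** * Bounded measurable functions on a set of finite measure *)

Section bounded_measurable.
Context d (X : measurableType d) (R : realType).
Variable mu : {measure set X -> \bar R}.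
Variable D : set X.

(** Polynomial expressions in the derivatives of splines stay in this class, so integrability
    follows from closure under sums and products. *)
Definition bmeas (f : X -> R) :=
  measurable_fun D f /\ exists C, forall x, D x -> `|f x| <= C.

Lemma bmeas_cst c : bmeas (cst c).
Proof. by split => //; exists `|c|. Qed.

Lemma bmeasD f g : bmeas f -> bmeas g -> bmeas (fun x => f x + g x).
Proof.
move=> [mf [C fC]] [mg [C' gC]]; split; first exact: measurable_funD.
exists (C + C') => x Dx; rewrite (le_trans (ler_normD _ _))// lerD//; [exact: fC|exact: gC].
Qed.

Lemma bmeasM f g : bmeas f -> bmeas g -> bmeas (fun x => f x * g x).
Proof.
move=> [mf [C fC]] [mg [C' gC]]; split; first exact: measurable_funM.
by exists (C * C') => x Dx; rewrite normrM ler_pM//; [exact: fC|exact: gC].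
Qed.

Lemma bmeas_sqr f : bmeas f -> bmeas (fun x => f x ^+ 2).
Proof. by move=> bf; exact: bmeasM. Qed.

Lemma bmeasN f : bmeas f -> bmeas (fun x => - f x).
Proof.
move=> [mf [C fC]]; split; first exact: measurableT_comp.
by exists C => x Dx; rewrite normrN; exact: fC.
Qed.

Lemma bmeasB f g : bmeas f -> bmeas g -> bmeas (fun x => f x - g x).
Proof. by move=> bf bg; apply: bmeasD => //; exact: bmeasN. Qed.

Lemma bmeasZ c f : bmeas f -> bmeas (fun x => c * f x).
Proof. by move=> bf; apply: bmeasM => //; exact: bmeas_cst. Qed.

Lemma bmeas_norm f : bmeas f -> bmeas (fun x => `|f x|).
Proof.
move=> [mf [C fC]]; split; first exact: measurableT_comp.
by exists C => x Dx; rewrite normr_id; exact: fC.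
Qed.

Lemma bmeas_sum (I : Type) (s : seq I) (P : pred I) (F : I -> X -> R) :
  (forall i, bmeas (F i)) -> bmeas (fun x => \sum_(i <- s | P i) F i x).
Proof.
move=> bF; elim: s => [|i s IH].
  rewrite (_ : (fun x => _) = cst 0); first exact: bmeas_cst.
  by apply/funext => x; rewrite big_nil.
rewrite (_ : (fun x => _) = fun x => (if P i then F i x else 0) +
    \sum_(i <- s | P i) F i x); last first.
  by apply/funext => x; rewrite big_cons; case: ifP => //; rewrite add0r.
by apply: bmeasD => //; case: (P i) => //; exact: bmeas_cst.
Qed.

Lemma bmeas_prod (I : Type) (s : seq I) (P : pred I) (F : I -> X -> R) :
  (forall i, bmeas (F i)) -> bmeas (fun x => \prod_(i <- s | P i) F i x).
Proof.
move=> bF; elim: s => [|i s IH].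
  rewrite (_ : (fun x => _) = cst 1); first exact: bmeas_cst.
  by apply/funext => x; rewrite big_nil.
rewrite (_ : (fun x => _) = fun x => (if P i then F i x else 1) *
    \prod_(i <- s | P i) F i x); last first.
  by apply/funext => x; rewrite big_cons; case: ifP => //; rewrite mul1r.
by apply: bmeasM => //; case: (P i) => //; exact: bmeas_cst.
Qed.

Lemma bmeas_det k (A : X -> 'M[R]_k) :
  (forall i j, bmeas (fun x => A x i j)) -> bmeas (fun x => \det (A x)).
Proof.
move=> bA; apply: bmeas_sum => s; apply: bmeasZ.
by apply: bmeas_prod => i; exact: bA.
Qed.

Lemma eq_bmeas f g : {in D, f =1 g} -> bmeas f -> bmeas g.
Proof.
move=> fg [mf [C fC]]; split; first exact: eq_measurable_fun mf.
by exists C => x Dx; rewrite -fg ?inE//; exact: fC.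
Qed.

Hypothesis mD : measurable D.
Hypothesis Doo : (mu D < +oo)%E.

Lemma bmeas_integrable f : bmeas f -> mu.-integrable D (EFin \o f).
Proof.
move=> [mf [C fC]]; apply: measurable_bounded_integrable => //.
exists `|C|; split; first exact: normr_real.
move=> x Cx y Dy; apply: le_trans (ltW Cx).
exact: le_trans (fC _ Dy) (ler_norm _).
Qed.

Lemma bRintegralD f g : bmeas f -> bmeas g ->
  \int[mu]_(x in D) (f x + g x) = \int[mu]_(x in D) f x + \int[mu]_(x in D) g x.
Proof. by move=> bf bg; rewrite RintegralD//; exact: bmeas_integrable. Qed.

Lemma bRintegralB f g : bmeas f -> bmeas g ->
  \int[mu]_(x in D) (f x - g x) = \int[mu]_(x in D) f x - \int[mu]_(x in D) g x.
Proof. by move=> bf bg; rewrite RintegralB//; exact: bmeas_integrable. Qed.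

Lemma bRintegralZ c f : bmeas f ->
  \int[mu]_(x in D) (c * f x) = c * \int[mu]_(x in D) f x.
Proof. by move=> bf; rewrite RintegralZl//; exact: bmeas_integrable. Qed.

Lemma bRintegral_sum (I : Type) (s : seq I) (F : I -> X -> R) :
  (forall i, bmeas (F i)) ->
  \int[mu]_(x in D) (\sum_(i <- s) F i x) = \sum_(i <- s) \int[mu]_(x in D) F i x.
Proof.
move=> bF; elim: s => [|i s IH].
  rewrite big_nil (@eq_Rintegral _ _ _ _ D (cst 0)) ?Rintegral_cst ?mul0r//.
  by move=> x _; rewrite big_nil.
rewrite big_cons -IH -bRintegralD//; last exact: bmeas_sum.
by apply: eq_Rintegral => x _; rewrite big_cons.
Qed.

Lemma le_bRintegral f g : bmeas f -> bmeas g -> (forall x, D x -> f x <= g x) ->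
  \int[mu]_(x in D) f x <= \int[mu]_(x in D) g x.
Proof. by move=> bf bg; apply: le_Rintegral => //; exact: bmeas_integrable. Qed.

Lemma EFin_bRintegral f : bmeas f ->
  (\int[mu]_(x in D) (f x)%:E)%E = (\int[mu]_(x in D) f x)%:E.
Proof.
move=> bf; rewrite /Rintegral fineK//; apply: integrable_fin_num => //.
exact: bmeas_integrable.
Qed.

Lemma bounded_cvg_Rintegral (f_ : nat -> X -> R) (f : X -> R) (C : R) :
  (forall n, measurable_fun D (f_ n)) -> measurable_fun D f ->
  (forall n x, D x -> `|f_ n x| <= C) ->
  (forall x, D x -> f_ ^~ x @ \oo --> f x) ->
  (fun n => \int[mu]_(x in D) f_ n x) @ \oo --> \int[mu]_(x in D) f x.
Proof.
move=> mf_ mf fC ff.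
have bf : bmeas f.
  split => //; exists C => x Dx.
  apply: (@closed_cvg _ _ _ eventually_filter (fun n => `|f_ n x|) [set y | y <= C]).
  - exact: closed_le.
  - by near=> n; exact: fC.
  - by apply: cvg_norm; exact: ff.
have [_ _ h] : [/\ mu.-integrable D (EFin \o f),
    [sequence \int[mu]_(x in D) `|(f_ n x)%:E - (f x)%:E|]_n @ \oo --> 0 &
    [sequence \int[mu]_(x in D) (f_ n x)%:E]_n @ \oo -->
      \int[mu]_(x in D) (f x)%:E]%E.
  apply: (@dominated_convergence _ _ _ mu D mD (fun n x => (f_ n x)%:E)
    (EFin \o f) (cst C%:E)).
  - by move=> n; exact/measurable_EFinP.
  - exact/measurable_EFinP.
  - by apply: aeW => x Dx; apply: cvg_EFin; [near=> n|exact: ff].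
  - exact: (bmeas_integrable (bmeas_cst C)).
  - by apply: aeW => x n Dx; rewrite lee_fin; exact: fC.
rewrite /Rintegral; apply: fine_cvg; rewrite fineK//.
exact: integrable_fin_num (bmeas_integrable bf).
Unshelve. all: by end_near. Qed.

End bounded_measurable.

(** * Directional derivatives, slices, and integration by parts on a cube *)

Section directional_derivative.
Context {R : realType}.

(** Derivability and derivative along a direction only depend on the restriction to a line. The
    first conclusion is an equality of propositions, so that it can be rewritten in both directions
    between a function and its slices. *)
Lemma derive_congr (V V' W : normedModType R) (F : V -> W) (G : V' -> W)
    (x v : V) (y w : V') :
  (forall h : R, G (h *: w + y) = F (h *: v + x)) ->
  derivable G y w = derivable F x v /\ 'D_w G y = 'D_v F x.
Proof.
move=> GF; rewrite /derivable /derive.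
have GF0 : G y = F x by have := GF 0; rewrite !scale0r !add0r.
suff -> : (fun h => h^-1 *: ((G \o shift y) (h *: w) - G y)) =
          (fun h => h^-1 *: ((F \o shift x) (h *: v) - F x)) by [].
by apply/funext => h /=; rewrite GF GF0.
Qed.

Lemma rV_consD n (a a' : R) (v v' : 'rV[R]_n) :
  rV_cons (a, v) + rV_cons (a', v') = rV_cons (a + a', v + v') :> 'rV[R]_n.+1.
Proof.
apply/rowP => i; rewrite !mxE.
by case: (unlift ord0 i) => [j|]; rewrite /= ?mxE.
Qed.

Lemma rV_consZ n k (a : R) (v : 'rV[R]_n) :
  k *: rV_cons (a, v) = rV_cons (k * a, k *: v) :> 'rV[R]_n.+1.
Proof.
apply/rowP => i; rewrite !mxE.
by case: (unlift ord0 i) => [j|]; rewrite /= ?mxE.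
Qed.

Lemma basis_vec_lift n (j : 'I_n) :
  basis_vec R (lift ord0 j) = rV_cons (0 : R, basis_vec R j).
Proof.
apply/rowP => i; rewrite !mxE eqxx/=.
case: (unliftP ord0 i) => [k ->|->]; rewrite ?liftK ?unlift_none/= ?mxE//.
Qed.

Lemma basis_vec0 n : basis_vec R (@ord0 n) = rV_cons (1 : R, 0).
Proof.
apply/rowP => i; rewrite !mxE eqxx/=.
have [k ->|->] := unliftP ord0 i; rewrite ?liftK ?unlift_none/= ?mxE ?eqxx//.
Qed.

Lemma derive_rV_cons_lift n (F : 'rV[R]_n.+1 -> R) (a : R) (v : 'rV[R]_n) j :
  derivable (fun v => F (rV_cons (a, v))) v (basis_vec R j) =
    derivable F (rV_cons (a, v)) (basis_vec R (lift ord0 j)) /\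
  partial j (fun v => F (rV_cons (a, v))) v =
    partial (lift ord0 j) F (rV_cons (a, v)).
Proof.
by apply: derive_congr => h; rewrite basis_vec_lift rV_consZ rV_consD mulr0 add0r.
Qed.

Lemma derive_rV_cons0 n (F : 'rV[R]_n.+1 -> R) (a : R) (v : 'rV[R]_n) :
  derivable (fun a : R => F (rV_cons (a, v))) a 1 =
    derivable F (rV_cons (a, v)) (basis_vec R ord0) /\
  'D_1 (fun a : R => F (rV_cons (a, v))) a = partial ord0 F (rV_cons (a, v)).
Proof.
by apply: derive_congr => h; rewrite basis_vec0 rV_consZ rV_consD scaler0 add0r.
Qed.

Lemma continuous_rV (X : topologicalType) n (f : X -> 'rV[R]_n) x :
  (forall i, {for x, continuous (fun y => f y ord0 i)}) -> {for x, continuous f}.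
Proof.
move=> fc; apply/cvgrPdist_le => e e0.
have : \forall y \near x, forall i, `|f x ord0 i - f y ord0 i| <= e.
  apply: filter_forall => i.
  by have /cvgrPdist_le := fc i; apply.
apply: filterS => y h; apply: normr_rV_le => [|i]; first exact: ltW.
by rewrite !mxE; exact: h.
Qed.

Lemma rV_cons_continuousr n (a : R) :
  continuous (fun v : 'rV[R]_n => rV_cons (a, v)).
Proof.
move=> v; apply: continuous_rV => i; case: (unliftP ord0 i) => [k ->|->].
  rewrite (_ : (fun y => _) = (fun y : 'rV[R]_n => y ord0 k)).
    exact: coord_continuous.
  by apply/funext => y; rewrite mxE liftK.
rewrite (_ : (fun y => _) = cst a); first exact: cst_continuous.
by apply/funext => y; rewrite mxE unlift_none.
Qed.

Lemma rV_cons_continuousl n (v : 'rV[R]_n) :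
  continuous (fun a : R => rV_cons (a, v)).
Proof.
move=> a; apply: continuous_rV => i; case: (unliftP ord0 i) => [k ->|->].
  rewrite (_ : (fun y => _) = cst (v ord0 k)); first exact: cst_continuous.
  by apply/funext => y; rewrite mxE liftK.
rewrite (_ : (fun y => _) = id); first exact: cvg_id.
by apply/funext => y; rewrite mxE unlift_none.
Qed.

Local Notation mu n := (lebesgue_rV R n).

Lemma cube0_rV_cons n (b : R) (a : R) (v : 'rV[R]_n) :
  cube 0 b (rV_cons (a, v)) <-> `[- b, b]%classic a /\ cube 0 b v.
Proof.
have := cube_rV_cons (0 : 'rV[R]_n.+1) b => /(congr1 (fun S => S (a, v))) /= ->.
rewrite mxE add0r add0r (_ : \row_j _ = 0 :> 'rV[R]_n)//.
by apply/rowP => i; rewrite !mxE.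
Qed.

Lemma compact_cube0 n (b : R) : compact (cube (0 : 'rV[R]_n) b).
Proof.
rewrite (_ : cube _ _ = [set v : 'rV[R]_n | forall i, `[- b, b]%classic (v ord0 i)]).
  by apply: (@rV_compact R n (fun _ => `[- b, b]%classic)) => i; exact: segment_compact.
by apply/seteqP; split => x /= h i; have := h i; rewrite in_itv/= mxE subr0 ler_norml.
Qed.

Lemma bmeas_continuous_cube n (b : R) (F : 'rV[R]_n -> R) :
  continuous F -> bmeas (cube 0 b) F.
Proof.
move=> cF; split.
  apply: measurable_funTS; apply: open_continuous_measurable_rV; first exact: openT.
  by move=> x _; exact: cF.
have [cn0|/set0P cn0] := eqVneq (cube (0 : 'rV[R]_n) b) set0.
  by exists 0 => x; rewrite cn0.
have cc := @compact_cube0 n b.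
have cNF : continuous (fun x => `|F x|) by move=> x; apply: (@continuous_comp _ _ _ F (fun y => `|y|)); [exact: cF|exact: norm_continuous].
have [c _ hc] := @EVT_max_rV R n _ _ cn0 cc (continuous_subspaceT cNF).
by exists `|F c| => x cx; apply: hc; rewrite inE.
Qed.

(** Coordinates are sliced off until the [i]-th one comes first. It is then integrated innermost, by
    the fundamental theorem of calculus, between two points where [F] vanishes. *)
Lemma integral_cube_partial n (i : 'I_n) (b : R) (F : 'rV[R]_n -> R) : 0 < b ->
  (forall x, derivable F x (basis_vec R i)) -> continuous (partial i F) ->
  (forall x : 'rV[R]_n, `|x ord0 i| = b -> F x = 0) ->
  (\int[mu n]_(x in cube 0 b) (partial i F x)%:E = 0)%E.
Proof.
move=> b0; elim: n i F => [[]//|n IH i F dF cF Fb].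
have mC := @measurable_cube R n.+1 0 b.
have Coo : (mu n.+1 (cube 0 b) < +oo)%E by rewrite lebesgue_rV_cube ?ltry// ltW.
have iF : (mu n.+1).-integrable setT ((EFin \o partial i F) \_ (cube 0 b)).
  apply/(integrable_mkcond _ mC).
  by apply: bmeas_integrable => //; exact: bmeas_continuous_cube.
rewrite integral_mkcond.
have cubeE (a : R) (v : 'rV[R]_n) :
    (rV_cons (a, v) \in cube 0 b) = (a \in `[- b, b]) && (v \in cube 0 b).
  apply/idP/andP; rewrite !inE.
    by move=> /cube0_rV_cons[].
  by move=> h; apply/cube0_rV_cons.
move: dF cF Fb iF; case: (unliftP ord0 i) => [j ->|->] dF cF Fb iF.
  rewrite integral_lebesgue_rVS// integral0_eq// => a _.
  have [aI|aI] := boolP (a \in `[- b, b]); last first.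
    by rewrite integral0_eq// => v _; rewrite /patch cubeE (negbTE aI).
  rewrite -[RHS](IH j (fun v => F (rV_cons (a, v)))).
  - rewrite [RHS]integral_mkcond; apply: eq_integral => v _.
    rewrite /patch cubeE aI/=; case: ifP => // _.
    by rewrite (derive_rV_cons_lift F a v j).2.
  - by move=> v; rewrite (derive_rV_cons_lift F a v j).1.
  - rewrite (_ : partial j _ = (partial (lift ord0 j) F) \o (fun v => rV_cons (a, v))).
      move=> v; apply: continuous_comp; last exact: cF.
      exact: rV_cons_continuousr.
    by apply/funext => v; rewrite (derive_rV_cons_lift F a v j).2.
  - by move=> v vj; apply: Fb; rewrite mxE liftK.
rewrite integral_lebesgue_rVS_swap// integral0_eq// => v _.
have [vI|vI] := boolP (v \in cube 0 b); last first.
  by rewrite integral0_eq// => a _; rewrite /patch cubeE (negbTE vI) andbF.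
rewrite (_ : (fun a => _) = (fun a => (partial ord0 F (rV_cons (a, v)))%:E) \_ `[- b, b]); last first.
  by apply/funext => a; rewrite /patch cubeE vI andbT mem_setE.
rewrite -integral_mkcond.
have dG (a : R) : derivable (fun a : R => F (rV_cons (a, v))) a 1.
  by rewrite (derive_rV_cons0 F a v).1.
have cG (a : R) : {for a, continuous (fun a : R => F (rV_cons (a, v)))}.
  by apply: differentiable_continuous; exact/derivable1_diffP.
rewrite (@continuous_FTC2 _ _ (fun a : R => F (rV_cons (a, v))) (- b) b).
- by rewrite !Fb ?subee// mxE unlift_none/= ?normrN gtr0_norm.
- by lra.
- apply: continuous_subspaceT => a.
  apply: (@continuous_comp _ _ _ (fun a : R => rV_cons (a, v))); last exact: cF.
  exact: rV_cons_continuousl.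
- split; first by move=> a _; exact: dG.
  + exact/cvg_at_right_filter/cG.
  + exact/cvg_at_left_filter/cG.
- by move=> a _; rewrite derive1E (derive_rV_cons0 F a v).2.
Qed.

End directional_derivative.

(** * Smooth functions *)

Section flat_function.
Context {R : realType}.

(** The classical flat function [exp (- 1 / t)], times [t^-k]: carrying all [k] makes the family
    closed under differentiation. *)
Definition flat (k : nat) (t : R) : R :=
  if 0 < t then t^-1 ^+ k * expR (- t^-1) else 0.

Lemma flat_le0 k t : t <= 0 -> flat k t = 0.
Proof. by move=> t0; rewrite /flat ltNge t0. Qed.

Lemma flat_gt0 k t : 0 < t -> 0 < flat k t.
Proof. by move=> t0; rewrite /flat t0 mulr_gt0// ?expR_gt0// exprn_gt0// invr_gt0. Qed.

Lemma flat_ge0 k t : 0 <= flat k t.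
Proof. by have [/(flat_le0 k) ->//|/(flat_gt0 k)/ltW] := leP t 0. Qed.

Lemma flatS k t : t * flat k.+1 t = flat k t.
Proof.
have [t0|t0] := leP t 0; first by rewrite !flat_le0// mulr0.
by rewrite /flat t0 exprS !mulrA mulfV ?mul1r// gt_eqF.
Qed.

(** With [y = 1 / t] and [m = k + 1], the inequality [(y / m)^m <= exp y] gives
    [y^k exp (- y) <= m^m / y]. *)
Lemma flat_bound k t : `|flat k t| <= (k.+1%:R ^+ k.+1) * `|t|.
Proof.
rewrite ger0_norm ?flat_ge0//.
have [t0|t0] := leP t 0; first by rewrite flat_le0// mulr_ge0// exprn_ge0.
rewrite gtr0_norm// /flat t0.
have y0 : 0 < t^-1 by rewrite invr_gt0.
set y := t^-1 in y0 *; have -> : t = y^-1 by rewrite invrK.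
set m := k.+1.
have m0 : 0 < m%:R :> R by rewrite ltr0n.
have h : (y / m%:R) ^+ m <= expR y.
  have -> : expR y = expR (y / m%:R) ^+ m.
    by rewrite -expRM_natl; congr expR; field; rewrite lt0r_neq0.
  rewrite lerXn2r ?nnegrE ?expR_ge0 ?divr_ge0 ?ltW//.
  by have := expR_ge1Dx (y / m%:R); lra.
rewrite expRN ler_pdivrMr ?expR_gt0//.
rewrite -mulrA mulrC -[X in _ <= X]mulrA.
rewrite mulrC.
apply: le_trans (_ : m%:R ^+ m * (y^-1 * (y / m%:R) ^+ m) <= _).
  rewrite expr_div_n le_eqVlt; apply/orP; left; apply/eqP.
  have -> : y ^+ k = y ^+ m / y by rewrite exprS; field; rewrite gt_eqF.
  by field; rewrite (gt_eqF y0) expf_neq0// gt_eqF.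
rewrite [X in _ <= X](_ : _ = m%:R ^+ m * (y^-1 * expR y)); last by ring.
by rewrite ler_pM2l ?exprn_gt0// ler_pM2l ?invr_gt0.
Qed.

Lemma is_derive_flat k (t : R) : is_derive t 1 (flat k) (flat k.+2 t - k%:R * flat k.+1 t).
Proof.
have [t0|t0|->] := ltgtP t 0.
- rewrite !flat_le0 ?ltW// mulr0 subr0.
  apply: (@near_eq_is_derive _ _ _ (cst 0)).
  near=> s; rewrite flat_le0//; apply: ltW; near: s.
  exact: lt_nbhsl.
- apply: (@near_eq_is_derive R R R (fun s : R => s^-1 ^+ k * expR (- s^-1))).
    near=> s; rewrite /flat ifT//; near: s; exact: lt_nbhsr.
  have tn0 : t != 0 by rewrite gt_eqF.
  have dV : is_derive t 1 (fun s : R => s^-1) (- t ^- 2).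
    apply: DeriveDef; first exact: (@derivableV _ _ id t 1 tn0 (@derivable_id _ _ t 1)).
    rewrite (@deriveV _ _ id t 1 tn0 (@derivable_id _ _ t 1)) derive_id.
    by rewrite /GRing.scale/= mulr1.
  have dE : is_derive t 1 (fun s : R => expR (- s^-1)) (expR (- t^-1) * (t ^- 2)).
    have := @is_derive1_comp _ expR (fun s => - s^-1) t _ _
      (is_derive_expR (- t^-1)) (is_deriveN dV).
    by rewrite opprK.
  have [d1 d2] := is_deriveM (is_deriveX k dV) dE.
  rewrite (_ : (fun s => _) = ((fun s : R => s^-1) ^+ k *
      (fun s : R => expR (- s^-1)) : R -> R)); last first.
    by apply/funext => s /=; rewrite fctE exprfctE.
  apply: (DeriveDef d1); rewrite d2 exprfctE /flat t0 /GRing.scale/=.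
  case: k d1 d2 => [|k] _ _ /=.
    by rewrite expr0 !mul0r mulr0 addr0 subr0 mul1r exprVn mulrC.
  by rewrite !exprS; field.
- rewrite !flat_le0// mulr0 subr0.
  suff h : (fun h => h^-1 *: ((flat k \o shift 0) (h *: (1 : R)) - flat k 0)) @ 0^' --> (0 : R).
    by apply: DeriveDef; [exact: cvgP h|exact: cvg_lim h].
  apply/cvgrPdist_le => e e0.
  (* At the origin the difference quotient [flat k h / h] is [flat k.+1 h], which [flat_bound]
     bounds by [C * |h|]. *)
  pose C : R := k.+2%:R ^+ k.+2.
  have C0 : 0 < C by rewrite exprn_gt0.
  exists (e / C) => /=; first exact: divr_gt0.
  move=> h /=; rewrite sub0r normrN => he h0.
  rewrite sub0r normrN (flat_le0 _ (lexx 0)) subr0 /GRing.scale/= mulr1 addr0.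
  rewrite -flatS mulKf//; apply: le_trans (flat_bound k.+1 h) _.
  by rewrite -ler_pdivlMl// mulrC ltW.
Unshelve. all: by end_near. Qed.

End flat_function.

Section smooth_class.
Context {R : realType} {n : nat}.
Local Notation U := 'rV[R]_n.

(* A syntactic stand-in for smoothness: derivatives of all orders, and their
   symmetry, are obtained by induction on the expression. *)
Inductive sm : (U -> R) -> Prop :=
| sm_cst c : sm (fun _ => c)
| sm_coord i : sm (fun x => x ord0 i)
| sm_add f g : sm f -> sm g -> sm (fun x => f x + g x)
| sm_mul f g : sm f -> sm g -> sm (fun x => f x * g x)
| sm_flat k f : sm f -> sm (fun x => flat k (f x))
| sm_inv f : sm f -> (forall x, f x != 0) -> sm (fun x => (f x)^-1).

(** The restriction [l] of [f] to the line through [x] of direction [v] reduces this to the chain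
    rule in one variable. *)
Lemma is_derive_comp_rV (g : R -> R) (f : U -> R) (x v : U) (dg df : R) :
  is_derive (f x) 1 g dg -> is_derive x v f df ->
  is_derive x v (fun y => g (f y)) (dg * df).
Proof.
move=> dgE [fd fE].
pose l (h : R) := f (h *: v + x).
have lE (h : R) : l (h *: 1 + 0) = f (h *: v + x) by rewrite /l /GRing.scale/= mulr1 addr0.
have [l1 l2] := derive_congr lE.
have dl : is_derive (0 : R) 1 l df by apply: DeriveDef; rewrite ?l1 ?l2.
have l0 : l 0 = f x by rewrite /l scale0r add0r.
have dg' : is_derive (l 0) 1 g dg by rewrite l0.
have [h1 h2] := @is_derive1_comp _ g l 0 _ _ dg' dl.
have gE (h : R) : (g \o l) (h *: 1 + 0) = (fun y => g (f y)) (h *: v + x) by rewrite /= lE.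
have [g1 g2] := @derive_congr R U R R (fun y => g (f y)) (g \o l) x v 0 1 gE.
by apply: DeriveDef; rewrite -?g1 -?g2// h2.
Qed.

Lemma is_derive_coord (i : 'I_n) (x v : U) :
  is_derive x v (fun y : U => y ord0 i) (v ord0 i).
Proof.
suff h : (fun h => h^-1 *: (((fun y : U => y ord0 i) \o shift x) (h *: v) - x ord0 i))
    @ 0^' --> v ord0 i.
  by apply: DeriveDef; [exact: cvgP h|exact: cvg_lim h].
apply: cvg_near_cst; exists 1 => //= h _ h0.
by rewrite !mxE /GRing.scale/= addrK mulKf.
Qed.

Lemma sm_derivable f : sm f -> forall x v, derivable f x v.
Proof.
elim=> {f} [c|i|f g _ df _ dg|f g _ df _ dg|k f _ df|f _ df f0] x v.
- exact: derivable_cst.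
- by have [] := is_derive_coord i x v.
- exact: derivableD.
- exact: derivableM.
- by have [] := is_derive_comp_rV (is_derive_flat k (f x)) (derivableP (df x v)).
- exact: derivableV.
Qed.

Lemma partial_cst c i : partial i (fun _ : U => c) = fun=> 0.
Proof. by apply/funext => x; exact: derive_cst. Qed.

Lemma partial_coord i j :
  partial i (fun x : U => x ord0 j) = fun=> (i == j)%:R.
Proof.
apply/funext => x; have [_] := is_derive_coord j x (basis_vec R i).
by rewrite /partial => ->; rewrite mxE eqxx eq_sym.
Qed.

Lemma partialD (f g : U -> R) i (x : U) : derivable f x (basis_vec R i) ->
  derivable g x (basis_vec R i) ->
  partial i (fun y => f y + g y) x = partial i f x + partial i g x.
Proof. exact: deriveD. Qed.

Lemma partialM (f g : U -> R) i (x : U) : derivable f x (basis_vec R i) ->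
  derivable g x (basis_vec R i) ->
  partial i (fun y => f y * g y) x = partial i f x * g x + f x * partial i g x.
Proof.
move=> df dg; rewrite /partial (deriveM df dg) addrC /GRing.scale/=.
by rewrite [g x * _]mulrC.
Qed.

Lemma partial_smD f g i : sm f -> sm g ->
  partial i (fun y => f y + g y) = fun x => partial i f x + partial i g x.
Proof.
by move=> sf sg; apply/funext => x; apply: partialD; exact: sm_derivable.
Qed.

Lemma partial_smM f g i : sm f -> sm g ->
  partial i (fun y => f y * g y) = fun x => partial i f x * g x + f x * partial i g x.
Proof.
by move=> sf sg; apply/funext => x; apply: partialM; exact: sm_derivable.
Qed.

Lemma partial_flat k f i : sm f -> partial i (fun y => flat k (f y)) =
  fun x => (flat k.+2 (f x) + - k%:R * flat k.+1 (f x)) * partial i f x.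
Proof.
move=> sf; apply/funext => x; rewrite /partial.
have [_ ->] := is_derive_comp_rV (is_derive_flat k (f x))
  (DeriveDef (@sm_derivable f sf x (basis_vec R i)) erefl).
by rewrite mulNr.
Qed.

Lemma partial_inv f i : sm f -> (forall x, f x != 0) ->
  partial i (fun y => (f y)^-1) =
  fun x => - 1 * ((f x)^-1 * (f x)^-1 * partial i f x).
Proof.
move=> sf f0; apply/funext => x; rewrite /partial deriveV//; last exact: sm_derivable.
by rewrite /GRing.scale/= -exprVn expr2 mulN1r mulNr.
Qed.

Lemma sm_partial f i : sm f -> sm (partial i f).
Proof.
elim=> {f} [c|j|f g sf pf sg pg|f g sf pf sg pg|k f sf pf|f sf pf f0].
- by rewrite partial_cst; exact: sm_cst.
- by rewrite partial_coord; exact: sm_cst.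
- by rewrite partial_smD//; exact: sm_add.
- by rewrite partial_smM//; apply: sm_add; exact: sm_mul.
- rewrite partial_flat//; apply: sm_mul => //; apply: sm_add; first exact: sm_flat.
  by apply: sm_mul; [exact: sm_cst|exact: sm_flat].
- rewrite partial_inv//; apply: sm_mul; first exact: sm_cst.
  by apply: sm_mul => //; apply: sm_mul; exact: sm_inv.
Qed.

Lemma partialC f i j : sm f -> partial i (partial j f) = partial j (partial i f).
Proof.
elim=> {f} [c|k|f g sf pf sg pg|f g sf pf sg pg|k f sf pf|f sf pf f0].
- by rewrite !partial_cst.
- by rewrite !partial_coord !partial_cst.
- rewrite (partial_smD j sf sg) (partial_smD i sf sg).
  rewrite (partial_smD i (sm_partial j sf) (sm_partial j sg)).
  by rewrite (partial_smD j (sm_partial i sf) (sm_partial i sg)) pf pg.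
- have spf l := sm_partial l sf; have spg l := sm_partial l sg.
  have sfg l := sm_mul sf (spg l); have sgf l := sm_mul (spf l) sg.
  rewrite (partial_smM j sf sg) (partial_smM i sf sg).
  rewrite (partial_smD i (sgf j) (sfg j)) (partial_smD j (sgf i) (sfg i)).
  rewrite (partial_smM i (spf j) sg) (partial_smM i sf (spg j)).
  rewrite (partial_smM j (spf i) sg) (partial_smM j sf (spg i)).
  by apply/funext => x; rewrite pf pg addrACA.
- have sp l := sm_partial l sf.
  have s2 m : sm (fun x => flat m (f x)) by exact: sm_flat.
  have s3 : sm (fun x => - k%:R * flat k.+1 (f x)) := sm_mul (sm_cst _) (s2 k.+1).
  have so := sm_add (s2 k.+2) s3.
  have dso l : partial l (fun x => flat k.+2 (f x) + - k%:R * flat k.+1 (f x)) =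
      fun x => partial l (fun x => flat k.+2 (f x)) x +
        (0 * flat k.+1 (f x) + - k%:R * partial l (fun x => flat k.+1 (f x)) x).
    by rewrite (partial_smD l (s2 _) s3) (partial_smM l (sm_cst _) (s2 _)) partial_cst.
  rewrite (partial_flat k j sf) (partial_flat k i sf).
  rewrite (partial_smM i so (sp j)) (partial_smM j so (sp i)) !dso.
  rewrite !(partial_flat _ _ sf) pf.
  by apply/funext => x; ring.
- have sp l := sm_partial l sf.
  have sv := sm_inv sf f0; have sv2 := sm_mul sv sv; have sp2 l := sm_mul sv2 (sp l).
  rewrite (partial_inv j sf f0) (partial_inv i sf f0).
  rewrite (partial_smM i (sm_cst _) (sp2 j)) (partial_smM j (sm_cst _) (sp2 i)).
  rewrite (partial_smM i sv2 (sp j)) (partial_smM j sv2 (sp i)).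
  rewrite !(partial_smM _ sv sv) !(partial_inv _ sf f0) !partial_cst pf.
  by apply/funext => x; ring.
Qed.

Lemma sm_continuous f : sm f -> continuous f.
Proof.
elim=> {f} [c|j|f g sf pf sg pg|f g sf pf sg pg|k f sf pf|f sf pf f0] x.
- exact: cst_continuous.
- exact: coord_continuous.
- by apply: continuousD; [exact: pf|exact: pg].
- by apply: continuousM; [exact: pf|exact: pg].
- apply: (@continuous_comp _ _ _ f (flat k)); first exact: pf.
  apply: differentiable_continuous; apply/derivable1_diffP.
  by have [] := is_derive_flat k (f x).
- by apply: continuousV => //; exact: pf.
Qed.

Lemma sm_smooth f : sm f -> smooth f.
Proof.
move=> sf s; have {sf} : sm (foldr (@partial R n) f s) by elim: s => //= i s IH; exact: sm_partial.
by move=> sp; split; [exact: sm_continuous|move=> i x; exact: sm_derivable].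
Qed.

Lemma sm_sum (I : Type) (s : seq I) (F : I -> U -> R) :
  (forall i, sm (F i)) -> sm (fun x => \sum_(i <- s) F i x).
Proof.
move=> bF; elim: s => [|i s IH].
  rewrite (_ : (fun x => _) = fun=> 0); first exact: sm_cst.
  by apply/funext => x; rewrite big_nil.
rewrite (_ : (fun x => _) = fun x => F i x + \sum_(i <- s) F i x).
  exact: sm_add.
by apply/funext => x; rewrite big_cons.
Qed.

Lemma sm_prod (I : Type) (s : seq I) (F : I -> U -> R) :
  (forall i, sm (F i)) -> sm (fun x => \prod_(i <- s) F i x).
Proof.
move=> bF; elim: s => [|i s IH].
  rewrite (_ : (fun x => _) = fun=> 1); first exact: sm_cst.
  by apply/funext => x; rewrite big_nil.
rewrite (_ : (fun x => _) = fun x => F i x * \prod_(i <- s) F i x).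
  exact: sm_mul.
by apply/funext => x; rewrite big_cons.
Qed.

Lemma sm_opp f : sm f -> sm (fun x => - f x).
Proof.
move=> sf; rewrite (_ : (fun x => _) = fun x => -1 * f x).
  by apply: sm_mul => //; exact: sm_cst.
by apply/funext => x; rewrite mulN1r.
Qed.

Lemma sm_sub f g : sm f -> sm g -> sm (fun x => f x - g x).
Proof. by move=> sf sg; apply: sm_add => //; exact: sm_opp. Qed.

Lemma sm_exp f k : sm f -> sm (fun x => f x ^+ k).
Proof.
move=> sf; elim: k => [|k IH].
  rewrite (_ : (fun x => _) = fun=> 1); first exact: sm_cst.
  by apply/funext => x; rewrite expr0.
rewrite (_ : (fun x => _) = fun x => f x * f x ^+ k); first exact: sm_mul.
by apply/funext => x; rewrite exprS.
Qed.

Lemma partial_cst_sub (c : R) (g : U -> R) i x : sm g ->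
  partial i (fun x => c - g x) x = - partial i g x.
Proof.
by move=> sg; rewrite /partial deriveB ?derive_cst ?sub0r//; exact: sm_derivable.
Qed.

Lemma partial_sm_sum (I : Type) (s : seq I) (F : I -> U -> R) i x :
  (forall k, sm (F k)) ->
  partial i (fun x => \sum_(k <- s) F k x) x = \sum_(k <- s) partial i (F k) x.
Proof.
move=> sF; elim: s => [|k s IH].
  rewrite (_ : (fun x => _) = fun=> 0) ?partial_cst ?big_nil//.
  by apply/funext => y; rewrite big_nil.
rewrite big_cons -IH (_ : (fun x => _) = fun x => F k x + \sum_(k <- s) F k x).
  by rewrite (partial_smD i (sF k) (sm_sum s sF)).
by apply/funext => y; rewrite big_cons.
Qed.

End smooth_class.

(** * Bernstein polynomials *)

Section binomial_expectation.
Context {R : realType}.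

(* Expectation of [phi] under the binomial law of parameters [N] and [t]: the
   Bernstein polynomial of [phi] at [t]. *)
Fixpoint bexp (N : nat) (t : R) (phi : nat -> R) : R :=
  if N is N'.+1 then t * bexp N' t (fun k => phi k.+1) + (1 - t) * bexp N' t phi
  else phi 0.

Lemma eq_bexp N t phi psi : phi =1 psi -> bexp N t phi = bexp N t psi.
Proof. by move=> h; congr bexp; exact/funext. Qed.

Lemma bexp_cst N t c : bexp N t (fun=> c) = c.
Proof. by elim: N => //= N ->; ring. Qed.

Lemma bexpD N t phi psi :
  bexp N t (fun k => phi k + psi k) = bexp N t phi + bexp N t psi.
Proof. by elim: N phi psi => //= N IH phi psi; rewrite !IH; ring. Qed.

Lemma bexpZ N t c phi : bexp N t (fun k => c * phi k) = c * bexp N t phi.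
Proof. by elim: N phi => //= N IH phi; rewrite !IH; ring. Qed.

Lemma bexpB N t phi psi :
  bexp N t (fun k => phi k - psi k) = bexp N t phi - bexp N t psi.
Proof. by elim: N phi psi => //= N IH phi psi; rewrite !IH; ring. Qed.

Lemma le_bexp N t phi psi : 0 <= t <= 1 -> (forall k, phi k <= psi k) ->
  bexp N t phi <= bexp N t psi.
Proof.
move=> /andP[t0 t1]; elim: N phi psi => //= N IH phi psi h.
rewrite lerD// ler_wpM2l ?subr_ge0//; exact: IH.
Qed.

Lemma ler_norm_bexp N t phi psi : 0 <= t <= 1 ->
  (forall k, `|phi k| <= psi k) -> `|bexp N t phi| <= bexp N t psi.
Proof.
move=> t01 h; rewrite ler_norml; apply/andP; split.
  rewrite -mulN1r -bexpZ; apply: le_bexp => // k.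
  by rewrite mulN1r; have := h k; rewrite ler_norml => /andP[].
by apply: le_bexp => // k; have := h k; rewrite ler_norml => /andP[].
Qed.

Lemma bexp0 N phi : bexp N 0 phi = phi 0.
Proof. by elim: N phi => //= N IH phi; rewrite !IH; ring. Qed.

Lemma bexp1 N phi : bexp N 1 phi = phi N.
Proof. by elim: N phi => //= N IH phi; rewrite !IH; ring. Qed.

Lemma bexp_nat N t : bexp N t (fun k => k%:R) = N%:R * t.
Proof.
elim: N => [|N IH] /=; first by rewrite mul0r.
rewrite (eq_bexp _ _ (psi := fun k => k%:R + 1)); last by move=> k; rewrite natr1.
by rewrite bexpD bexp_cst IH -natr1; ring.
Qed.

Lemma bexp_sqr N t : bexp N t (fun k => k%:R ^+ 2) = N%:R * t * (1 - t) + (N%:R * t) ^+ 2.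
Proof.
elim: N => [|N IH] /=; first by rewrite !mul0r expr0n add0r.
rewrite (eq_bexp _ _ (psi := fun k => k%:R ^+ 2 + (2 * k%:R + 1))); last first.
  by move=> k; rewrite -natr1; ring.
by rewrite !bexpD bexpZ bexp_cst bexp_nat IH -natr1; ring.
Qed.

(** The second moment is taken about [M t], not about the mean [N t], because a derivative has
    degree [M - 1] on a grid of [M] steps. It equals [N t (1 - t) + (M - N)^2 t^2]: the first term
    is at most [N / 4] and the squared bias at most [1]. *)
Lemma bexp_variance N M (t : R) : 0 <= t <= 1 -> (N <= M <= N.+1)%N ->
  bexp N t (fun k => (k%:R - M%:R * t) ^+ 2) <= M%:R / 4 + 1.
Proof.
move=> /andP[t0 t1] /andP[NM MN].
rewrite (eq_bexp _ _ (psi := fun k => k%:R ^+ 2 +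
  ((- 2 * (M%:R * t)) * k%:R + (M%:R * t) ^+ 2))); last by move=> k; ring.
rewrite !bexpD bexpZ bexp_cst bexp_nat bexp_sqr.
have : M%:R = N%:R :> R \/ M%:R = N%:R + 1 :> R.
  have [MN'|MN'] := eqVneq M N; first by left; rewrite MN'.
  right; rewrite natr1; congr _%:R; apply/eqP.
  by rewrite eqn_leq MN ltn_neqAle eq_sym MN'.
have N0 : 0 <= N%:R :> R by rewrite ler0n.
have : N%:R * (t * (1 - t)) <= N%:R * (1 / 4) :> R by apply: ler_wpM2l => //; have := sqr_ge0 (t - 2^-1); nra.
by move=> h [->|->]; nra.
Qed.

End binomial_expectation.

Section bexp_smooth.
Context {R : realType} {n : nat}.
Local Notation U := 'rV[R]_n.

Lemma sm_bexp N (g : U -> R) (c : nat -> U -> R) : sm g -> (forall k, sm (c k)) ->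
  sm (fun x => bexp N (g x) (fun k => c k x)).
Proof.
move=> sg; elim: N c => [|N IH] c sc /=; first exact: sc.
apply: sm_add; apply: sm_mul => //.
- exact: (IH (fun k => c k.+1)).
- exact: (sm_sub (sm_cst 1) sg).
- exact: IH.
Qed.

(** The classical derivative of a Bernstein polynomial, by forward differences and one degree less.
    The coefficients also depend on [x], since they carry the remaining coordinates; this is the
    second summand. *)
Lemma partial_bexp N (g : U -> R) (c : nat -> U -> R) i x :
  sm g -> (forall k, sm (c k)) ->
  partial i (fun x => bexp N (g x) (fun k => c k x)) x =
  partial i g x * (N%:R * bexp N.-1 (g x) (fun k => c k.+1 x - c k x)) +
  bexp N (g x) (fun k => partial i (c k) x).
Proof.
move=> sg; elim: N c => [|N IH] c sc /=; first by rewrite mul0r mulr0 add0r.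
have s1 := sm_bexp N sg (fun k => sc k.+1).
have s2 := sm_bexp N sg sc.
have sg1 := sm_sub (sm_cst 1) sg.
rewrite (partial_smD i (sm_mul sg s1) (sm_mul sg1 s2)).
rewrite (partial_smM i sg s1) (partial_smM i sg1 s2).
rewrite (partial_smD i (sm_cst 1) (sm_opp sg)) partial_cst.
rewrite (_ : partial i (fun x => - g x) x = - partial i g x); last first.
  by rewrite /partial deriveN//; exact: sm_derivable.
rewrite (IH c sc) (IH (fun k => c k.+1) (fun k => sc k.+1)) bexpB.
case: N {IH s1 s2} => [|N] /=; first by rewrite !mul0r !mulr0; ring.
rewrite !bexpB -(natr1 N.+1).
move: (partial i g x) (g x) (N.+1%:R) => p q r.
ring.
Qed.

End bexp_smooth.

Section bernstein.
Context {R : realType}.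
Variables (b : R) (M : nat).
Hypotheses (b_gt0 : 0 < b) (M_gt0 : (0 < M)%N).
Let M0 : 0 < M%:R :> R. Proof. by rewrite ltr0n. Qed.

Definition bstep : R := 2 * b / M%:R.
Definition bnode (k : nat) : R := - b + bstep * k%:R.
Definition bpos (s : R) : R := (s + b) / (2 * b).
Definition rV_tail n (x : 'rV[R]_n.+1) : 'rV[R]_n := \row_j x ord0 (lift ord0 j).

Lemma bstep_gt0 : 0 < bstep.
Proof. by rewrite /bstep divr_gt0// mulr_gt0. Qed.

(* The degrees [N i] may differ from the number [M] of steps of the grid of
   nodes: a derivative has one degree less but the same nodes. *)
Fixpoint bern n : ('I_n -> nat) -> ('rV[R]_n -> R) -> 'rV[R]_n -> R :=
  match n with
  | 0 => fun _ f x => f x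
  | n'.+1 => fun N f x => bexp (N ord0) (bpos (x ord0 ord0)) (fun k =>
      bern (fun j => N (lift ord0 j)) (fun v => f (rV_cons (bnode k, v)))
        (rV_tail x))
  end.

Lemma bern_cst n N c (x : 'rV[R]_n) : bern N (fun=> c) x = c.
Proof.
elim: n N x => [//|n IH] N x /=.
by under eq_bexp do rewrite IH; rewrite bexp_cst.
Qed.

Lemma bernB n N f g (x : 'rV[R]_n) :
  bern N (fun y => f y - g y) x = bern N f x - bern N g x.
Proof.
elim: n N f g x => [//|n IH] N f g x /=.
by rewrite -bexpB; apply: eq_bexp => k; rewrite IH.
Qed.

Lemma sm_comp_tail n (f : 'rV[R]_n -> R) : sm f -> sm (fun x => f (rV_tail x)).
Proof.
elim=> {f} [c|j|f g _ pf _ pg|f g _ pf _ pg|k f _ pf|f _ pf f0].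
- exact: sm_cst.
- rewrite (_ : (fun x => _) = fun x : 'rV[R]_n.+1 => x ord0 (lift ord0 j)).
    exact: sm_coord.
  by apply/funext => x; rewrite mxE.
- exact: sm_add.
- exact: sm_mul.
- exact: sm_flat.
- exact: sm_inv.
Qed.

Lemma sm_bpos n i : sm (fun x : 'rV[R]_n => bpos (x ord0 i)).
Proof.
apply: sm_mul (sm_cst _); apply: sm_add (sm_cst _); exact: sm_coord.
Qed.

Lemma sm_bern n N f : sm (@bern n N f).
Proof.
elim: n N f => [|n IH] N f /=.
  rewrite (_ : f = fun=> f 0); first exact: sm_cst.
  by apply/funext => x; congr f; apply/rowP; case.
exact: (sm_bexp _ (sm_bpos _) (fun k => sm_comp_tail (IH _ _))).
Qed.

Lemma bpos_itv s : `|s| <= b -> 0 <= bpos s <= 1.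
Proof.
rewrite ler_norml => /andP[? ?]; rewrite /bpos; apply/andP; split.
  by apply: divr_ge0; lra.
by rewrite ler_pdivrMr ?mulr_gt0// mul1r; lra.
Qed.

Lemma cube_tail n (x : 'rV[R]_n.+1) : cube 0 b x -> cube 0 b (rV_tail x).
Proof. by move=> h j; have := h (lift ord0 j); rewrite !mxE. Qed.

(** A quadratic majorant of [|f - c|] passes to the expectation, where each coordinate contributes
    at most [K] times the variance. Degrees [M] and [M - 1] are both allowed, so that the same
    estimate serves for values and for first derivatives. *)
Lemma bern_approx n N (f : 'rV[R]_n -> R) (x : 'rV[R]_n) (c e K : R) :
  (forall i, (N i <= M <= (N i).+1)%N) -> cube 0 b x -> 0 <= K ->
  (forall y : 'rV[R]_n, `|f y - c| <= e + K * \sum_i (y ord0 i - x ord0 i) ^+ 2) ->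
  `|bern N f x - c| <= e + K * n%:R * (bstep ^+ 2 * (M%:R / 4 + 1)).
Proof.
move=> + + K0; elim: n N f x e => [|n IH] N f x e NM cx h /=.
  by rewrite mulr0 mul0r; have := h x; rewrite big_ord0 mulr0.
rewrite -(bexp_cst (N ord0) (bpos (x ord0 ord0)) c) -bexpB.
have xb : `|x ord0 ord0| <= b by have := cx ord0; rewrite mxE subr0.
have t01 := bpos_itv xb.
set t := bpos _ in t01 *.
have xt : x ord0 ord0 = - b + bstep * (M%:R * t).
  by rewrite /t /bpos /bstep; field; rewrite !gt_eqF.
have nodeE k : (bnode k - x ord0 ord0) ^+ 2 = bstep ^+ 2 * (k%:R - M%:R * t) ^+ 2.
  by rewrite xt /bnode; ring.
set V := bstep ^+ 2 * (M%:R / 4 + 1).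
apply: le_trans (_ : bexp (N ord0) t (fun k => (e + K * n%:R * V) +
    (K * bstep ^+ 2) * (k%:R - M%:R * t) ^+ 2) <= _).
  apply: ler_norm_bexp => // k.
  apply: le_trans (IH _ _ (rV_tail x) (e + K * (bnode k - x ord0 ord0) ^+ 2) _ _ _) _.
  - by move=> j; exact: NM.
  - exact: cube_tail.
  - move=> v; apply: le_trans (h _) _.
    rewrite big_ord_recl mxE unlift_none/= mulrDr addrA lerD2l.
    rewrite ler_wpM2l// le_eqVlt; apply/orP; left; apply/eqP.
    by apply: eq_bigr => j _; rewrite !mxE liftK.
  - by rewrite nodeE -/V; lra.
rewrite bexpD bexp_cst bexpZ -natr1.
have := @bexp_variance R (N ord0) M t t01 (NM ord0).
have KS : 0 <= K * bstep ^+ 2 by rewrite mulr_ge0// sqr_ge0.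
move=> /(ler_wpM2l KS); rewrite /V; lra.
Qed.

Definition bdecr n (N : 'I_n -> nat) i := fun j => (N j - (j == i))%N.

Lemma partial_tail_lift n (f : 'rV[R]_n -> R) j x :
  partial (lift ord0 j) (fun x => f (rV_tail x)) x = partial j f (rV_tail x).
Proof.
have E (h : R) : (fun x => f (rV_tail x)) (h *: basis_vec R (lift ord0 j) + x) =
    f (h *: basis_vec R j + rV_tail x).
  congr f; apply/rowP => k; rewrite !mxE eqxx/=.
  by rewrite (inj_eq lift_inj).
by have [] := @derive_congr R 'rV[R]_n 'rV[R]_n.+1 R f (fun x => f (rV_tail x)) (rV_tail x) _ x _ E.
Qed.

Lemma partial_tail0 n (f : 'rV[R]_n -> R) x :
  partial ord0 (fun x => f (rV_tail x)) x = 0.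
Proof.
have E (h : R) : (fun x => f (rV_tail x)) (h *: basis_vec R ord0 + x) =
    f (h *: 0 + rV_tail x).
  by congr f; apply/rowP => k; rewrite !mxE eqxx/=.
have [_] := @derive_congr R 'rV[R]_n 'rV[R]_n.+1 R f (fun x => f (rV_tail x)) (rV_tail x) _ x _ E.
by rewrite derive0.
Qed.

Lemma partial_bpos n i j (x : 'rV[R]_n) :
  partial i (fun x => bpos (x ord0 j)) x = (i == j)%:R / (2 * b).
Proof.
rewrite (partial_smM i (sm_add (sm_coord j) (sm_cst b)) (sm_cst _)).
rewrite (partial_smD i (sm_coord j) (sm_cst b)) !partial_cst partial_coord.
by rewrite mulr0 !addr0.
Qed.

(** For [N i = M] the factor [N i / (2 b)] is the inverse of the grid step, so the derivative is an
    average of difference quotients of [f]. *)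
Lemma partial_bern n N f i (x : 'rV[R]_n) :
  partial i (bern N f) x = (N i)%:R / (2 * b) *
    bern (bdecr N i) (fun y => f (y + bstep *: basis_vec R i) - f y) x.
Proof.
elim: n N f i x => [_ _ []//|n IH] N f i x /=.
rewrite (partial_bexp _ _ x (sm_bpos _) (fun k => sm_comp_tail (sm_bern _ _))).
rewrite partial_bpos; case: (unliftP ord0 i) => [j ->|->].
  rewrite eq_sym eq_liftF mul0r mul0r add0r -bexpZ /bdecr eq_liftF subn0.
  apply: eq_bexp => k; rewrite partial_tail_lift IH.
  congr (_ * _).
  rewrite (_ : (fun k => N (lift ord0 k) - _)%N = bdecr (fun j => N (lift ord0 j)) j); last first.
    by apply/funext => l; rewrite (inj_eq lift_inj).
  congr (bern _ _ _); apply/funext => v; congr (f _ - _).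
  by rewrite basis_vec_lift rV_consZ rV_consD mulr0 addr0.
rewrite eqxx mul1r [X in _ + X](_ : _ = 0); last first.
  by under eq_bexp do rewrite partial_tail0; rewrite bexp_cst.
rewrite addr0 mulrA [(2 * b)^-1 * _]mulrC; congr (_ * _).
rewrite /bdecr eqxx subn1; apply: eq_bexp => k.
rewrite -bernB (_ : (fun j => N (lift ord0 j) - _)%N = (fun j => N (lift ord0 j))); last first.
  by apply/funext => l; rewrite eq_sym eq_liftF subn0.
congr (bern _ _ _); apply/funext => v; congr (f _ - _).
rewrite basis_vec0 rV_consZ rV_consD scaler0 addr0 mulr1.
by congr (rV_cons (_, _)); rewrite /bnode -natr1; ring.
Qed.

(** At either end of the interval the binomial law is a point mass, on the node [- b] or on the node
    [b]. Hence on a face only the values of [f] on that face enter. *)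
Lemma bern_face n f (x : 'rV[R]_n) i :
  (forall y : 'rV[R]_n, `|y ord0 i| = b -> f y = 0) -> `|x ord0 i| = b ->
  bern (fun=> M) f x = 0.
Proof.
elim: n f x i => [_ _ []//|n IH] f x i /=.
case: (unliftP ord0 i) => [j ->|->] f0 xb.
  rewrite -[RHS](bexp_cst M (bpos (x ord0 ord0)) 0).
  apply: eq_bexp => k; apply: (IH _ _ j); last by rewrite mxE.
  by move=> y yb; apply: f0; rewrite mxE liftK.
have fb s : `|s| = b -> bern (fun=> M) (fun v => f (rV_cons (s, v))) (rV_tail x) = 0.
  move=> sb; rewrite -[RHS](bern_cst (fun=> M) 0 (rV_tail x)).
  by congr bern; apply/funext => v; apply: f0; rewrite mxE unlift_none.
have : x ord0 ord0 = b \/ x ord0 ord0 = - b.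
  by move: xb => /eqP; rewrite eqr_norml => /andP[/orP[/eqP|/eqP]]; auto.
case=> ->.
  rewrite (_ : bpos b = 1) ?bexp1; last by rewrite /bpos; field; rewrite gt_eqF.
  apply: fb; rewrite (_ : bnode M = b) ?gtr0_norm//.
  by rewrite /bnode /bstep; field; rewrite gt_eqF.
rewrite (_ : bpos (- b) = 0) ?bexp0; last by rewrite /bpos addNr mul0r.
by apply: fb; rewrite /bnode mulr0 addr0 normrN gtr0_norm.
Qed.

End bernstein.

Section mean_value.
Context {R : realType} {n : nat}.
Local Notation U := 'rV[R]_n.

Lemma derive_line (f : U -> R) (y v : U) (s : R) :
  derivable (fun t : R => f (y + t *: v)) s 1 = derivable f (y + s *: v) v /\
  'D_1 (fun t : R => f (y + t *: v)) s = 'D_v f (y + s *: v).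
Proof.
apply: (@derive_congr R U R R f (fun t : R => f (y + t *: v))) => h.
by rewrite scalerDl /GRing.scale/= mulr1 addrCA.
Qed.

Lemma mvt_line (f : U -> R) (y v : U) (t : R) : 0 < t ->
  (forall s, 0 <= s <= t -> derivable f (y + s *: v) v) ->
  exists2 s, 0 <= s <= t & f (y + t *: v) - f y = t * 'D_v f (y + s *: v).
Proof.
move=> t0 df; pose g (s : R) := f (y + s *: v).
have dg s : 0 <= s <= t -> derivable g s 1.
  by move=> st; rewrite (derive_line f y v s).1; exact: df.
have [||s] := @MVT R g (fun s => 'D_v f (y + s *: v)) 0 t t0.
- move=> s; rewrite in_itv/= => /andP[s0 st].
  have st' : 0 <= s <= t by rewrite !ltW.
  by apply: DeriveDef; [exact: dg|exact: (derive_line f y v s).2].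
- apply: derivable_within_continuous => s; rewrite in_itv/=; exact: dg.
- rewrite in_itv/= => /andP[s0 st]; rewrite /g subr0 scale0r addr0 => E.
  by exists s; [rewrite !ltW|rewrite E mulrC].
Qed.

Lemma norm_basis_vec i : `|basis_vec R i : U| <= 1.
Proof.
apply: normr_rV_le => // j; rewrite mxE eqxx/=.
by case: (j == i); rewrite ?normr1 ?normr0.
Qed.

Lemma sqr_norm_le (x : U) : `|x| ^+ 2 <= \sum_i x ord0 i ^+ 2.
Proof.
have [x0|x0] := eqVneq `|x| 0.
  by rewrite x0 expr0n; apply: sumr_ge0 => i _; exact: sqr_ge0.
have [[i j]] := mx_norm_neq0 x0.
rewrite [mx_norm x](_ : _ = `|x|)// => ->; rewrite ord1/=.
rewrite real_normK ?num_real// (bigD1 j)//= lerDl.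
by apply: sumr_ge0 => k _; exact: sqr_ge0.
Qed.

Definition lipschitz_rV (L : R) (f : U -> R) :=
  forall x y, `|f x - f y| <= L * `|x - y|.

End mean_value.

(** * Convergence of Bernstein polynomials of Lipschitz functions and of their gradients *)

Section bernstein_convergence.
Context {R : realType} {n : nat}.
Local Notation U := 'rV[R]_n.
Variable b : R.
Hypothesis b_gt0 : 0 < b.

(** The left side is [b^2 / M + 4 b^2 / M^2], whence the constant [5]. *)
Lemma bstep_variance M : (0 < M)%N ->
  (bstep b M) ^+ 2 * (M%:R / 4 + 1) <= 5 * b ^+ 2 / M%:R.
Proof.
move=> M0; have M0' : 0 < M%:R :> R by rewrite ltr0n.
have M1 : 1 <= M%:R :> R by rewrite ler1n.
rewrite /bstep (_ : _ * _ = b ^+ 2 / M%:R + 4 * b ^+ 2 / M%:R * M%:R^-1); last first.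
  by field; rewrite gt_eqF.
have bM : 0 <= 4 * b ^+ 2 / M%:R by rewrite divr_ge0// mulr_ge0// sqr_ge0.
have : 4 * b ^+ 2 / M%:R * M%:R^-1 <= 4 * b ^+ 2 / M%:R * 1.
  by rewrite ler_wpM2l// invf_le1.
rewrite mulr1 => h; apply: le_trans (_ : b ^+ 2 / M%:R + 4 * b ^+ 2 / M%:R <= _).
  by rewrite lerD2l.
by rewrite le_eqVlt; apply/orP; left; apply/eqP; field; rewrite gt_eqF.
Qed.

Lemma bstep_variance_small (K e : R) : 0 <= K -> 0 < e ->
  \forall M \near \oo, K * n%:R * ((bstep b M.+1) ^+ 2 * (M.+1%:R / 4 + 1)) <= e.
Proof.
move=> K0 e0.
have P : 0 <= K * n%:R * (5 * b ^+ 2).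
  by apply: mulr_ge0; [exact: mulr_ge0|apply: mulr_ge0 => //; exact: sqr_ge0].
have e1 : 0 < e / (1 + K * n%:R * (5 * b ^+ 2)) by apply: divr_gt0 => //; lra.
have := near_infty_natSinv_lt (PosNum e1); apply: filterS => M /= hM.
apply: le_trans (_ : K * n%:R * (5 * b ^+ 2 / M.+1%:R) <= _).
  by rewrite ler_wpM2l ?mulr_ge0//; exact: bstep_variance.
move: hM; rewrite ltr_pdivlMr; last by lra.
have : 0 <= M.+1%:R^-1 :> R by rewrite invr_ge0.
rewrite mulrA; set a := M.+1%:R^-1; set c := K * n%:R * (5 * b ^+ 2); nra.
Qed.

(** [bern_approx] with [c = 0] and [K = 0], applied to the forward difference, which is at most [L]
    times the step. *)
Lemma bern_grad_bound M (L : R) f i x : (0 < M)%N -> 0 <= L ->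
  lipschitz_rV L f -> cube (0 : U) b x -> `|partial i (bern b M (fun=> M) f) x| <= L.
Proof.
move=> M0 L0 Lf cx; rewrite partial_bern//.
have M0' : 0 < M%:R :> R by rewrite ltr0n.
have d0 := bstep_gt0 b_gt0 M0.
have := @bern_approx R b M b_gt0 M0 n (bdecr (fun=> M) i)
  (fun y => f (y + bstep b M *: basis_vec R i) - f y) x 0 (L * bstep b M) 0.
rewrite !mul0r addr0 subr0 => h.
rewrite normrM ger0_norm; last by rewrite divr_ge0// mulr_ge0// ltW.
rewrite mulrC -ler_pdivlMr; last by rewrite divr_gt0// mulr_gt0.
apply: le_trans (h _ _ _ _) _ => //.
- move=> j; rewrite /bdecr; case: (j == i); last by rewrite subn0 leqnn leqnSn.
  by rewrite subn1 leq_pred/= prednK.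
- move=> y; rewrite subr0 mul0r addr0; apply: le_trans (Lf _ _) _.
  rewrite ler_wpM2l// addrAC subrr add0r normrZ gtr0_norm//.
  by rewrite ler_piMr ?(ltW d0)// norm_basis_vec.
- by rewrite /bstep invfM invrK mulrA [_ * b]mulrC ; rewrite le_eqVlt; apply/orP; left; apply/eqP; field; rewrite !gt_eqF.
Qed.

Lemma bern_uniform (L : R) f e : 0 <= L -> lipschitz_rV L f -> 0 < e ->
  \forall M \near \oo, forall x, cube (0 : U) b x ->
    `|bern b M.+1 (fun=> M.+1) f x - f x| <= e.
Proof.
move=> L0 Lf e0.
have e2 : 0 < e / 2 by lra.
(* Young's inequality [L s <= e / 2 + L^2 s^2 / (2 e)] turns the Lipschitz bound into a quadratic
   majorant. *)
have K0 : 0 <= L ^+ 2 / (2 * e) by rewrite divr_ge0 ?sqr_ge0// mulr_ge0// ltW.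
have := bstep_variance_small K0 e2; apply: filterS => M hM x cx.
apply: le_trans (@bern_approx R b M.+1 b_gt0 isT n _ f x (f x) (e / 2) (L ^+ 2 / (2 * e)) _ cx K0 _) _.
- by move=> j; rewrite leqnn leqnSn.
- move=> y; apply: le_trans (Lf _ _) _.
  apply: le_trans (_ : e / 2 + L ^+ 2 / (2 * e) * `|y - x| ^+ 2 <= _).
    have := sqr_ge0 (e - L * `|y - x|); set s := `|y - x| => h.
    rewrite -subr_ge0 (_ : _ - _ = (e - L * s) ^+ 2 / (2 * e)); last first.
      by field; rewrite gt_eqF.
    by rewrite divr_ge0// mulr_ge0// ltW.
  rewrite lerD2l ler_wpM2l//; apply: le_trans (sqr_norm_le _) _.
  by apply: ler_sum => i _; rewrite !mxE.
- by lra.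
Qed.

(** The forward difference is compared with [d * c]. Within [r / 2] of [x], the mean value theorem
    and the continuity of the derivative give an error [d * e / 2]. Farther away, the crude bound
    [d * (L + |c|)] lies below the quadratic term with coefficient [(L + |c|) / (r / 2)^2]. *)
Lemma bern_grad_cvg (L : R) f i x : 0 <= L -> lipschitz_rV L f -> cube (0 : U) b x ->
  (\forall y \near x, derivable f y (basis_vec R i)) ->
  {for x, continuous (partial i f)} ->
  (fun M => partial i (bern b M.+1 (fun=> M.+1) f) x) @ \oo --> partial i f x.
Proof.
move=> L0 Lf cx df cf; apply/cvgrPdist_le => e e0.
set c := partial i f x.
have e2 : 0 < e / 2 by lra.
have : \forall y \near x, derivable f y (basis_vec R i) /\ `|c - partial i f y| <= e / 2.
  apply: filterI => //.
  by have /cvgrPdist_le := cf; apply.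
move=> /nbhs_ballP[r /= r0 xr].
have r2 : 0 < r / 2 by lra.
have K0 : 0 <= (L + `|c|) / (r / 2) ^+ 2 by rewrite divr_ge0 ?sqr_ge0// addr_ge0.
have e4 : 0 < e / 4 by lra.
have Mr : \forall M \near \oo, bstep b M.+1 < r / 2.
  have br : 0 < r / 2 / (2 * b) by rewrite divr_gt0// mulr_gt0.
  have := near_infty_natSinv_lt (PosNum br); apply: filterS => M /=.
  by rewrite ltr_pdivlMr ?mulr_gt0// /bstep mulrC.
have := bstep_variance_small K0 e2.
move=> h0; near=> M.
have hM : (L + `|c|) / (r / 2) ^+ 2 * n%:R *
    (bstep b M.+1 ^+ 2 * (M.+1%:R / 4 + 1)) <= e / 2 by near: M.
have dr : bstep b M.+1 < r / 2 by near: M.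
have M0' : 0 < M.+1%:R :> R by [].
have d0 : 0 < bstep b M.+1 by exact: bstep_gt0.
rewrite partial_bern//.
set d := bstep b M.+1 in hM dr d0 *.
rewrite (_ : _ / (2 * b) = d^-1); last by rewrite /d /bstep invf_div.
rewrite distrC -[c](mulKf (lt0r_neq0 d0)) -mulrBr normrM.
rewrite (gtr0_norm (_ : 0 < d^-1)) ?invr_gt0// mulrC ler_pdivrMr//.
apply: le_trans (@bern_approx R b M.+1 b_gt0 isT n _ _ x (d * c) (d * (e / 2))
  (d * ((L + `|c|) / (r / 2) ^+ 2)) _ cx _ _) _.
- move=> j; rewrite /bdecr; case: (j == i); last by rewrite subn0 leqnn leqnSn.
  by rewrite subn1 leqnSn leqnn.
- by rewrite mulr_ge0// ltW.
- move=> y; rewrite -(mulrA d) -mulrDr.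
  set S := \sum_i _.
  have S0 : 0 <= S by apply: sumr_ge0 => j _; exact: sqr_ge0.
  have [yx|yx] := ltP `|y - x| (r / 2).
    have yb s : 0 <= s <= d -> ball x r (y + s *: basis_vec R i).
      move=> /andP[s0 sd]; rewrite -ball_normE /ball_/= distrC -addrA [_ - x]addrC addrA.
      apply: le_lt_trans (ler_normD _ _) _; rewrite normrZ (ger0_norm s0).
      have : s * `|basis_vec R i : U| <= d * 1 by rewrite ler_pM// norm_basis_vec.
      lra.
    have [s sd ->] := @mvt_line R n f y (basis_vec R i) d d0 (fun s sd => (xr _ (yb s sd)).1).
    rewrite -mulrBr normrM gtr0_norm// ler_pM2l// distrC.
    have [_] := xr _ (yb s sd); rewrite /partial => /le_trans; apply.
    by rewrite lerDl !mulr_ge0 ?invr_ge0 ?sqr_ge0// addr_ge0.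
  apply: le_trans (ler_normB _ _) _.
  have h1 : `|f (y + d *: basis_vec R i) - f y| <= L * d.
    apply: le_trans (Lf _ _) _; rewrite ler_wpM2l// addrAC subrr add0r normrZ gtr0_norm//.
    by rewrite ler_piMr ?(ltW d0)// norm_basis_vec.
  rewrite normrM (gtr0_norm d0).
  apply: le_trans (_ : d * (L + `|c|) <= _); first by lra.
  rewrite ler_pM2l//.
  have : 1 <= ((r / 2) ^+ 2)^-1 * S.
    rewrite mulrC ler_pdivlMr ?exprn_gt0// mul1r.
    apply: le_trans (_ : `|y - x| ^+ 2 <= _); first by rewrite lerXn2r ?nnegrE// ltW.
    apply: le_trans (sqr_norm_le _) _.
    by apply: ler_sum => k _; rewrite !mxE.
  have LC : 0 <= L + `|c| by rewrite addr_ge0.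
  move=> /(ler_wpM2l LC); lra.
- rewrite -/d; clearbody d; move: hM; set V := d ^+ 2 * _; move=> hM.
  rewrite (_ : _ + _ = (e / 2 + (L + `|c|) / (r / 2) ^+ 2 * n%:R * V) * d); last by ring.
  by rewrite ler_pM2r//; lra.
Unshelve. all: by end_near. Qed.

End bernstein_convergence.

(** * Jacobian determinants *)

Section null_lagrangian.
Context {R : realType} {n : nat}.
Local Notation U := 'rV[R]_n.
Local Notation mu := (lebesgue_rV R n).

Lemma partial_sm_prod (I : eqType) (s : seq I) (F : I -> U -> R) j x :
  uniq s -> (forall k, sm (F k)) ->
  partial j (fun x => \prod_(k <- s) F k x) x =
  \sum_(l <- s) partial j (F l) x * \prod_(k <- s | k != l) F k x.
Proof.
move=> + sF; elim: s => [_|a s IH /= /andP[aNs us]].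
  rewrite big_nil (_ : (fun x => _) = fun=> 1) ?partial_cst//.
  by apply/funext => y; rewrite big_nil.
rewrite (_ : (fun x => _) = fun x => F a x * \prod_(k <- s) F k x); last first.
  by apply/funext => y; rewrite big_cons.
rewrite (partial_smM j (sF a) (sm_prod s sF)) IH// big_cons; congr (_ + _).
  rewrite big_cons eqxx/= big_seq [in RHS]big_seq_cond; congr (_ * _).
  apply: eq_bigl => k; case: (boolP (k \in s)) => //= ks.
  by apply/esym; apply: contraNneq aNs => <-.
rewrite mulr_sumr; apply: eq_big_seq => l ls.
rewrite big_cons ifT; first by rewrite mulrCA.
by apply: contraNneq aNs => ->.
Qed.

Definition jacobian (F : 'I_n -> U -> R) (x : U) : 'M[R]_n :=
  \matrix_(k, j) partial j (F k) x.

(* The Jacobian determinant is a divergence: the second order terms cancel in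
   pairs under [tperm i l]. *)
Lemma det_jacobianE (F : 'I_n -> U -> R) i x : (forall k, sm (F k)) ->
  \det (jacobian F x) = \sum_(s : 'S_n) (-1) ^+ s *
    partial (s i) (fun x => F i x *
      \prod_(k <- [seq k <- index_enum 'I_n | k != i]) partial (s k) (F k) x) x.
Proof.
move=> sF.
have sp (s : 'S_n) k : sm (partial (s k) (F k)) by exact: sm_partial.
pose T l (s : 'S_n) := partial (s i) (partial (s l) (F l)) x *
  \prod_(k <- [seq k <- index_enum 'I_n | k != i] | k != l) partial (s k) (F k) x.
have T0 l : l != i -> \sum_(s : 'S_n) (-1) ^+ s * T l s = 0.
  move=> li; set S := \sum_s _.
  suff : S = - S by lra.
  rewrite {1}/S (reindex_inj (mulgI (tperm i l)))/= /S -sumrN.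
  apply: eq_bigr => s _; rewrite odd_permM odd_tperm eq_sym li/= signrN mulNr; congr (- (_ * _)).
  rewrite /T !permM tpermL tpermR (partialC _ _ (sF l)); congr (_ * _).
  rewrite !big_filter_cond; apply: eq_bigr => k /andP[ki kl].
  by rewrite permM tpermD// eq_sym.
transitivity (\sum_(s : 'S_n) ((-1) ^+ s * (\prod_k partial (s k) (F k) x) +
    F i x * \sum_(l | l != i) (-1) ^+ s * T l s)).
  rewrite big_split/= -mulr_sumr exchange_big/=.
  rewrite [X in _ + _ * X]big1 ?mulr0 ?addr0; last by move=> l li; exact: T0.
  apply: eq_bigr => s _; congr (_ * _); apply: eq_bigr => k _.
  by rewrite mxE.
apply: eq_bigr => s _; rewrite (partial_smM (s i) (sF i) (sm_prod _ (sp s))).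
rewrite (partial_sm_prod (s i) x _ (sp s)); last first.
  by rewrite filter_uniq// index_enum_uniq.
rewrite mulrDr; congr (_ + _).
  by rewrite (bigD1 i)//= big_filter.
rewrite mulrCA; congr (_ * _).
by rewrite big_filter mulr_sumr.
Qed.

Lemma bmeas_sm_cube b (f : U -> R) : sm f -> bmeas (cube 0 b) f.
Proof. by move=> sf; apply: bmeas_continuous_cube; exact: sm_continuous. Qed.

Lemma cube_lty b : 0 <= b -> (mu (cube 0 b) < +oo)%E.
Proof. by move=> b0; rewrite lebesgue_rV_cube// ltry. Qed.

Lemma Rintegral_cube_partial b (f : U -> R) i : 0 < b -> sm f ->
  (forall x : U, `|x ord0 i| = b -> f x = 0) ->
  \int[mu]_(x in cube 0 b) partial i f x = 0.
Proof.
move=> b0 sf f0; rewrite /Rintegral integral_cube_partial//.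
- by move=> x; exact: sm_derivable.
- by apply: sm_continuous; exact: sm_partial.
Qed.

Lemma integral_cube_det b (F : 'I_n -> U -> R) i : 0 < b -> (forall k, sm (F k)) ->
  (forall (x : U) j, `|x ord0 j| = b -> F i x = 0) ->
  \int[mu]_(x in cube 0 b) \det (jacobian F x) = 0.
Proof.
move=> b0 sF F0.
have mC := @measurable_cube R n 0 b; have Coo := cube_lty (ltW b0).
pose G (s : 'S_n) (x : U) := F i x *
  \prod_(k <- [seq k <- index_enum 'I_n | k != i]) partial (s k) (F k) x.
have sG s : sm (G s).
  by apply: sm_mul => //; apply: (sm_prod _ (F := fun k => partial (s k) (F k))) => k; exact: sm_partial.
have bG (s : 'S_n) : bmeas (cube 0 b) (partial (s i) (G s)).
  by apply: bmeas_sm_cube; exact: sm_partial.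
rewrite (@eq_Rintegral _ _ _ _ _ (fun x => \sum_(s : 'S_n) (-1) ^+ s * partial (s i) (G s) x)).
  rewrite bRintegral_sum//; last by move=> s; exact: bmeasZ.
  rewrite big1// => s _; rewrite bRintegralZ// Rintegral_cube_partial ?mulr0//.
  by move=> x xb; rewrite /G (F0 x (s i))// mul0r.
by move=> x _; rewrite (det_jacobianE i x sF).
Qed.

Lemma cvg_det (A_ : nat -> 'M[R]_n) (A : 'M[R]_n) :
  (forall i j, (fun m => A_ m i j) @ \oo --> A i j) ->
  (fun m => \det (A_ m)) @ \oo --> \det A.
Proof.
move=> h; rewrite /determinant.
apply: (@cvg_big _ _ +%R 0 xpredT add_continuous) => s _.
apply: cvgM; first exact: cvg_cst.
apply: (@cvg_big R _ *%R 1 xpredT (@mul_continuous R)) => i _.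
exact: h.
Qed.

Lemma norm_det_le (A : 'M[R]_n) (C : R) : (forall i j, `|A i j| <= C) ->
  `|\det A| <= \sum_(s : 'S_n) C ^+ n.
Proof.
move=> h; apply: le_trans (ler_norm_sum _ _ _) _; apply: ler_sum => s _.
rewrite normrM normrX normrN1 expr1n mul1r normr_prod.
rewrite -[in X in _ <= X](card_ord n) -prodr_const.
by apply: ler_prod => i _; rewrite normr_ge0 h.
Qed.

(** Derivability around [x] but continuity of the derivatives at [x] only: these are the hypotheses
    of [bern_grad_cvg]. *)
Definition C1_near (f : U -> R) (x : U) := forall i,
  (\forall y \near x, derivable f y (basis_vec R i)) /\
  {for x, continuous (partial i f)}.

(** * Passage to Lipschitz functions that are regular off a null set *)

Section lipschitz.
Variables (b L : R) (S : set U).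
Hypotheses (b_gt0 : 0 < b) (L_ge0 : 0 <= L).
Hypotheses (mS : measurable S) (S_cube : S `<=` cube 0 b).
Hypothesis S_null : mu (cube 0 b `\` S) = 0%E.

Let mC := @measurable_cube R n 0 b.
Let Coo := cube_lty (ltW b_gt0).
Let mN : measurable (cube 0 b `\` S). Proof. exact: measurableD. Qed.

Lemma cube_setD_null : cube 0 b `\` (cube 0 b `\` S) = S.
Proof. by rewrite setDD; apply/setIidPr. Qed.

Lemma S_lty : (mu S < +oo)%E.
Proof. exact: (le_lt_trans (le_measure mu (mem_set mS) (mem_set mC) S_cube) Coo). Qed.

Lemma lipschitz_bern_grad_cvg (f : U -> R) i x : lipschitz_rV L f -> S x ->
  C1_near f x ->
  (fun M => partial i (bern b M.+1 (fun=> M.+1) f) x) @ \oo --> partial i f x.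
Proof.
move=> Lf Sx Cf; apply: (@bern_grad_cvg R n b b_gt0 L f i x L_ge0 Lf (S_cube Sx)).
  exact: (Cf i).1.
exact: (Cf i).2.
Qed.

Lemma bmeas_partial_lipschitz (f : U -> R) i : lipschitz_rV L f ->
  (forall x, S x -> C1_near f x) -> bmeas S (partial i f).
Proof.
move=> Lf Cf.
have cv x : S x -> (fun M => partial i (bern b M.+1 (fun=> M.+1) f) x) @ \oo --> partial i f x.
  by move=> Sx; exact: lipschitz_bern_grad_cvg Lf Sx (Cf x Sx).
split.
  apply: (measurable_fun_cvg (h := fun M x => partial i (bern b M.+1 (fun=> M.+1) f) x)) => //.
  move=> M; apply: (measurable_funS mC) => //.
  by have [] := bmeas_sm_cube b (sm_partial i (sm_bern b M.+1 (fun=> M.+1) f)).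
exists L => x Sx.
apply: (@closed_cvg _ _ _ eventually_filter
  (fun M => `|partial i (bern b M.+1 (fun=> M.+1) f) x|) [set y | y <= L]).
- exact: closed_le.
- by near=> M; apply: bern_grad_bound => //; exact: S_cube.
- by apply: cvg_norm; exact: cv.
Unshelve. all: by end_near. Qed.

(** Bernstein polynomials inherit the zero values on the faces and the bound [L] on the derivative,
    and their derivatives converge on [S]; dominated convergence concludes. *)
Lemma integral_partial_lipschitz (f : U -> R) i : lipschitz_rV L f ->
  (forall x : U, `|x ord0 i| = b -> f x = 0) ->
  (forall x, S x -> C1_near f x) ->
  \int[mu]_(x in S) partial i f x = 0.
Proof.
move=> Lf f0 Cf; pose B M := bern b M.+1 (fun=> M.+1) f.
have sB M : sm (B M) by exact: sm_bern.
have : (fun M => \int[mu]_(x in S) partial i (B M) x) @ \oo --> \int[mu]_(x in S) partial i f x.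
  apply: (@bounded_cvg_Rintegral _ _ _ mu S mS S_lty _ _ L).
  - move=> M; apply: (measurable_funS mC) => //.
    by have [] := bmeas_sm_cube b (sm_partial i (sB M)).
  - by have [] := bmeas_partial_lipschitz i Lf Cf.
  - by move=> M x Sx; apply: bern_grad_bound => //; exact: S_cube.
  - by move=> x Sx; exact: lipschitz_bern_grad_cvg Lf Sx (Cf x Sx).
rewrite (_ : (fun M => _) = cst 0).
  by move/cvg_lim => <-//; exact: lim_cst.
apply/funext => M; rewrite -cube_setD_null -(@Rintegral_setD_null _ _ _ mu)//.
apply: Rintegral_cube_partial => // x xb.
exact: (bern_face b_gt0 (isT : (0 < M.+1)%N) f0 xb).
Qed.

(** [S1] stands for the domain off the facets and [S] also contains the exterior. There the [f k]
    with [k != i] are arbitrary Lipschitz extensions, whose gradients are not under control, but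
    [f i] has zero gradient. *)
Lemma integral_det_lipschitz (S1 : set U) (f : 'I_n -> U -> R) i :
  (forall k, lipschitz_rV L (f k)) ->
  (forall (x : U) j, `|x ord0 j| = b -> f i x = 0) ->
  (forall x, S x -> C1_near (f i) x) ->
  (forall k x, S1 x -> C1_near (f k) x) ->
  (forall x j, S x -> ~ S1 x -> partial j (f i) x = 0) ->
  \int[mu]_(x in S `&` S1) \det (jacobian f x) = 0.
Proof.
move=> Lf f0 Cfi Cf fi0; pose B M k := bern b M.+1 (fun=> M.+1) (f k).
have sB M k : sm (B M k) by exact: sm_bern.
have bB M : bmeas (cube 0 b) (fun x => \det (jacobian (B M) x)).
  apply: bmeas_det => k j; rewrite (_ : (fun x => _) = partial j (B M k)).
    by apply: bmeas_sm_cube; exact: sm_partial.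
  by apply/funext => x; rewrite mxE.
have cv x : S x -> (fun M => \det (jacobian (B M) x)) @ \oo -->
    ((fun x => \det (jacobian f x)) \_ S1) x.
  move=> Sx; rewrite /patch; case: ifPn => [|S1x].
    move=> /set_mem S1x; apply: cvg_det => k j.
    rewrite mxE (_ : (fun m => _) = fun M => partial j (B M k) x); last first.
      by apply/funext => M; rewrite mxE.
    exact: lipschitz_bern_grad_cvg (Lf k) Sx (Cf k x S1x).
  (* Off [S1] the [i]-th row of the approximating Jacobians tends to zero while the other rows stay
     bounded by [L], so the determinants tend to zero. *)
  have nS1 : ~ S1 x by move=> /mem_set h; move/negP: S1x.
  have c1 : (fun M => \sum_(s : 'S_n) `|partial (s i) (B M i) x| * L ^+ n.-1) @ \oo --> (0 : R).
    rewrite [X in _ --> X](_ : _ = \sum_(s : 'S_n) (0 : R)); last by rewrite big1.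
    apply: (@cvg_big _ _ +%R 0 xpredT add_continuous) => s _.
    rewrite [X in _ --> X](_ : _ = `|0 : R| * L ^+ n.-1); last by rewrite normr0 mul0r.
    apply: cvgM; last exact: cvg_cst.
    apply: cvg_norm; rewrite -[X in _ --> X](fi0 x (s i) Sx nS1).
    exact: lipschitz_bern_grad_cvg (Lf i) Sx (Cfi x Sx).
  apply/norm_cvg0P; apply: (squeeze_cvgr _ (@cvg_cst _ 0 _ _ _) c1).
  near=> M; rewrite normr_ge0/= /determinant.
  apply: le_trans (ler_norm_sum _ _ _) _; apply: ler_sum => s _.
  rewrite normrM normrX normrN1 expr1n mul1r normr_prod (bigD1 i)//= mxE.
  rewrite ler_wpM2l// -[in X in _ <= X](_ : #|[pred k : 'I_n | k != i]| = n.-1); last first.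
    by rewrite cardC1 card_ord.
  rewrite -prodr_const.
  apply: ler_prod => k _; rewrite normr_ge0 mxE/=.
  by apply: bern_grad_bound => //; exact: S_cube.
have : (fun M => \int[mu]_(x in S) \det (jacobian (B M) x)) @ \oo -->
    \int[mu]_(x in S) ((fun x => \det (jacobian f x)) \_ S1) x.
  have mB M : measurable_fun S (fun x => \det (jacobian (B M) x)).
    by apply: (measurable_funS mC) => //; exact: (bB M).1.
  apply: (@bounded_cvg_Rintegral _ _ _ mu S mS S_lty _ _ (\sum_(s : 'S_n) L ^+ n)) => //.
  - exact: measurable_fun_cvg mB cv.
  - move=> M x Sx; apply: norm_det_le => k j; rewrite mxE.
    by apply: bern_grad_bound => //; exact: S_cube.
rewrite -Rintegral_mkcondr (_ : (fun M => _) = cst 0).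
  by move/cvg_lim => <-//; exact: lim_cst.
apply/funext => M; rewrite -cube_setD_null -(@Rintegral_setD_null _ _ _ mu)//.
apply: (@integral_cube_det b (B M) i) => // x j xb.
exact: (bern_face b_gt0 (isT : (0 < M.+1)%N) (fun y => f0 y j) xb).
Unshelve. all: by end_near. Qed.

End lipschitz.

End null_lagrangian.

(** * Lipschitz functions and simplices *)

Section lipschitz_functions.
Context {R : realType} {n : nat}.
Local Notation U := 'rV[R]_n.

Definition lipschitz_in (D : set U) (L : R) (f : U -> R) :=
  forall x y, D x -> D y -> `|f x - f y| <= L * `|x - y|.

Lemma lipschitz_inW (D : set U) L L' f : L <= L' ->
  lipschitz_in D L f -> lipschitz_in D L' f.
Proof.
by move=> LL Lf x y Dx Dy; apply: le_trans (Lf x y Dx Dy) _; rewrite ler_wpM2r.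
Qed.

Lemma lipschitz_rVW L L' (f : U -> R) : L <= L' -> lipschitz_rV L f -> lipschitz_rV L' f.
Proof. by move=> LL Lf x y; apply: le_trans (Lf x y) _; rewrite ler_wpM2r. Qed.

Lemma lipschitz_continuous L (f : U -> R) : 0 <= L -> lipschitz_rV L f -> continuous f.
Proof.
move=> L0 Lf x; apply/(@cvgrPdist_le _ _ _ (nbhs x) (nbhs_filter x)) => e e0.
have L1 : 0 < L + 1 by rewrite ltr_wpDl.
apply: filterS (nbhsx_ballx x _ (divr_gt0 e0 L1)) => y.
rewrite -ball_normE /ball_/= ltr_pdivlMr// => xy; apply: le_trans (Lf x y) _.
by apply: le_trans (ltW xy); rewrite mulrC ler_wpM2l// lerDl.
Qed.

(** The supremum of the downward cones of slope [L] with apex on the graph. It extends the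
    derivatives of a spline, which are Lipschitz on the domain, to the whole space. *)
Lemma mcshane (D : set U) L f : 0 <= L -> D !=set0 -> lipschitz_in D L f ->
  exists2 F, lipschitz_rV L F & forall x, D x -> F x = f x.
Proof.
move=> L0 [y0 Dy0] Lf.
pose E x := [set f y - L * `|x - y| | y in D].
have E0 x : E x !=set0 by exists (f y0 - L * `|x - y0|); exists y0.
have Eub x : ubound (E x) (f y0 + L * `|x - y0|).
  move=> _ [y Dy <-]; have := Lf y y0 Dy Dy0; rewrite ler_norml => /andP[_].
  have := ler_distD x y y0; rewrite distrC [`|y - x|]distrC => /(ler_wpM2l L0).
  by rewrite mulrDr [`|y0 - y|]distrC; lra.
have Es x : has_sup (E x) by split => //; exists (f y0 + L * `|x - y0|).
have ELe x y : sup (E x) <= sup (E y) + L * `|x - y|.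
  apply: ge_sup => // _ [z Dz <-].
  have : f z - L * `|y - z| <= sup (E y) by apply: ub_le_sup; [exact: (Es y).2|exists z].
  have := ler_distD x y z => /(ler_wpM2l L0); rewrite mulrDr [`|y - x|]distrC; lra.
exists (fun x => sup (E x)).
  move=> x y; rewrite ler_distl; apply/andP; split.
    by have := ELe y x; rewrite distrC; lra.
  exact: ELe.
move=> x Dx; apply/eqP; rewrite eq_le; apply/andP; split.
  apply: ge_sup => // _ [y Dy <-].
  by have := Lf y x Dy Dx; rewrite [`|y - x|]distrC ler_norml => /andP[_]; lra.
by apply: ub_le_sup; [exact: (Es x).2|exists x => //; rewrite subrr normr0 mulr0 subr0].
Qed.

(** In [f x * (g x - g y) + g y * (f x - f y)] the size of [f] only matters at [x], which may be
    taken in [D] because [g] vanishes elsewhere. So [f] may be a Lipschitz extension that is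
    unbounded off [D]. *)
Lemma lipschitz_rVM (D : set U) (f g : U -> R) (L1 L2 C1 C2 : R) :
  0 <= L1 -> 0 <= L2 -> 0 <= C1 -> 0 <= C2 ->
  lipschitz_rV L1 f -> lipschitz_rV L2 g ->
  (forall x, D x -> `|f x| <= C1) -> (forall x, `|g x| <= C2) ->
  (forall x, ~ D x -> g x = 0) ->
  lipschitz_rV (C1 * L2 + C2 * L1) (fun x => f x * g x).
Proof.
move=> L10 L20 C10 C20 Lf Lg fC gC g0.
have main x y : D x -> `|f x * g x - f y * g y| <= (C1 * L2 + C2 * L1) * `|x - y|.
  move=> Dx.
  rewrite (_ : _ - _ = f x * (g x - g y) + g y * (f x - f y)); last by ring.
  apply: le_trans (ler_normD _ _) _; rewrite mulrDl !normrM -!mulrA.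
  by apply: lerD; apply: ler_pM => //; first [exact: fC|exact: Lg|exact: Lf].
move=> x y; have [Dx|nDx] := pselect (D x); first exact: main.
have [Dy|nDy] := pselect (D y); first by rewrite distrC [`|x - y|]distrC; exact: main.
by rewrite !g0// !mulr0 subrr normr0 mulr_ge0// addr_ge0// mulr_ge0.
Qed.

Lemma sm_bounded_cube (f : U -> R) b : sm f -> exists2 C, 0 <= C & forall x, cube 0 b x -> `|f x| <= C.
Proof.
move=> sf; have [_ [C fC]] := bmeas_sm_cube b sf.
exists `|C| => // x cx; apply: le_trans (fC x cx) (ler_norm _).
Qed.

(** Two points of the cube are joined by [n] segments parallel to the axes; the mean value theorem
    bounds the increment on each of them. *)
Lemma sm_lipschitz_cube (f : U -> R) b : sm f ->
  exists2 L, 0 <= L & lipschitz_in (cube 0 b) L f.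
Proof.
move=> sf.
have [C C0 fC] : exists2 C, 0 <= C & forall i x, cube 0 b x -> `|partial i f x| <= C.
  have h i : {C : R | 0 <= C /\ forall x, cube 0 b x -> `|partial i f x| <= C}.
    by apply: cid; have [C ? ?] := sm_bounded_cube b (sm_partial i sf); exists C.
  exists (\sum_i sval (h i)).
    by apply: sumr_ge0 => i _; exact: (svalP (h i)).1.
  move=> i x cx; apply: le_trans ((svalP (h i)).2 x cx) _.
  by rewrite (bigD1 i)//= lerDl sumr_ge0// => j _; exact: (svalP (h j)).1.
have step x i t : 0 < t -> cube 0 b x -> cube 0 b (x + t *: basis_vec R i) ->
    `|f (x + t *: basis_vec R i) - f x| <= C * t.
  move=> t0 cx cy.
  have [s /andP[s0 st] ->] := @mvt_line R n f x (basis_vec R i) t t0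
    (fun s _ => @sm_derivable _ _ f sf _ _).
  rewrite normrM gtr0_norm// mulrC ler_pM2r//; apply: fC => j.
  have := cx j; have := cy j; rewrite !mxE eqxx/= !subr0.
  case: (j == i); rewrite ?mulr1 ?mulr0 ?addr0//.
  by rewrite !ler_norml; lra.
have step' x y i : cube 0 b x -> cube 0 b y -> y = x + (y ord0 i - x ord0 i) *: basis_vec R i ->
    `|f y - f x| <= C * `|y ord0 i - x ord0 i|.
  move=> cx cy yx; set t := y ord0 i - x ord0 i in yx *.
  have [t0|t0|t0] := ltgtP t 0.
  - rewrite distrC (ltr0_norm t0).
    have xy : x = y + (- t) *: basis_vec R i by rewrite {1}yx scaleNr addrK.
    by rewrite {1}xy; apply: step; rewrite ?oppr_gt0// -xy.
  - by rewrite (gtr0_norm t0) {1}yx; apply: step; rewrite // -yx.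
  - by rewrite t0 normr0 mulr0 yx t0 scale0r addr0 subrr normr0.
exists (C * n%:R); first by rewrite mulr_ge0.
move=> x y cx cy; rewrite distrC.
(* The vertices of the path: the first [k] coordinates are those of [y], the others those of [x]. *)
pose z (k : nat) : U := \row_j (if (j < k)%N then y ord0 j else x ord0 j).
have cz k : cube 0 b (z k).
  by move=> j; rewrite !mxE subr0; case: ifP => _; [have := cy j|have := cx j]; rewrite mxE subr0.
have z0 : z 0%N = x by apply/rowP => j; rewrite mxE.
have zn : z n = y by apply/rowP => j; rewrite mxE ltn_ord.
rewrite -{1}zn -{1}z0 -(telescope_sumr (fun k => f (z k)))//.
rewrite big_mkord; apply: le_trans (ler_norm_sum _ _ _) _.
apply: le_trans (_ : \sum_(i < n) C * `|x - y| <= _); last first.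
  by rewrite sumr_const card_ord -mulr_natr le_eqVlt; apply/orP; left; apply/eqP; ring.
apply: ler_sum => i _.
have zi : z i.+1 ord0 i - z i ord0 i = y ord0 i - x ord0 i by rewrite !mxE ltnSn ltnn.
apply: le_trans (step' (z i) (z i.+1) i (cz _) (cz _) _) _.
  apply/rowP => j; rewrite zi !mxE eqxx/= ltnS leq_eqVlt.
  have [->|ji] := eqVneq j i; first by rewrite eqxx ltnn/= mulr1 addrCA subrr addr0.
  by rewrite mulr0 addr0 (inj_eq val_inj) (negbTE ji).
rewrite zi ler_wpM2l//.
by have := normr_coord (y - x) i; rewrite !mxE [`|y - x|]distrC.
Qed.

End lipschitz_functions.

(** * Barycentric coordinates and facet hyperplanes *)

Section barycentric.
Context {R : realType} {n' : nat}.
Local Notation n := n'.+1.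
Local Notation U := 'rV[R]_n.
Local Notation mu := (lebesgue_rV R n).

Definition simplex_mx (A : 'M[R]_(n.+1, n)) : 'M[R]_(n.+1) :=
  row_mx (const_mx 1 : 'cV[R]_n.+1) A.

(** The solution [t] of [t [1 | A] = [1 | x]]: the column of ones encodes [sum t = 1], the other
    columns [t A = x]. *)
Definition bary (A : 'M[R]_(n.+1, n)) (x : U) : 'rV[R]_n.+1 :=
  (row_mx (const_mx 1 : 'cV[R]_1) x : 'rV[R]_(1 + n)) *m invmx (simplex_mx A).

Definition bary_coef (A : 'M[R]_(n.+1, n)) (i : 'I_n.+1) (j : 'I_n) : R :=
  invmx (simplex_mx A) (rshift 1 j) i.

Lemma mul_simplex_mx m (t : 'M[R]_(m, n.+1)) A :
  t *m simplex_mx A = row_mx (t *m (const_mx 1 : 'cV[R]_n.+1)) (t *m A).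
Proof. exact: (@mul_mx_row _ m n.+1 1 n t (const_mx 1) A). Qed.

Lemma row_simplex_mx k A :
  row k (simplex_mx A) = row_mx (const_mx 1 : 'cV[R]_1) (row k A).
Proof.
rewrite (_ : (const_mx 1 : 'cV[R]_1) = row k (const_mx 1 : 'cV[R]_n.+1)).
  exact: (@row_row_mx _ _ 1 n).
by apply/rowP => j; rewrite !mxE.
Qed.

Lemma baryE A x i : bary A x ord0 i =
  invmx (simplex_mx A) ord0 i + \sum_j bary_coef A i j * x ord0 j.
Proof.
rewrite /bary mxE (@big_split_ord _ _ _ 1 n) big_ord1/=; congr (_ + _).
  by rewrite (@row_mxEl _ 1 1 n) mxE mul1r; congr (invmx _ _ _); apply/val_inj.
by apply: eq_bigr => j _; rewrite (@row_mxEr _ 1 1 n) mulrC.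
Qed.

Lemma simplexP A x : affinely_independent A ->
  simplex A x <-> forall i, 0 <= bary A x ord0 i.
Proof.
rewrite /affinely_independent -[row_mx _ _]/(simplex_mx A) row_free_unit => uA.
split=> [[t [t0 _ t1 ->]] i|h].
  rewrite (_ : bary _ _ = t)//.
  rewrite /bary (_ : (row_mx _ _ : 'rV_(1 + n)) = t *m simplex_mx A) ?mulmxK//.
  rewrite mul_simplex_mx; congr row_mx.
  apply/rowP => j; rewrite !mxE -[LHS]t1; apply: eq_bigr => k _.
  by rewrite mxE mulr1.
exists (bary A x).
have E : bary A x *m simplex_mx A = row_mx (const_mx 1 : 'cV[R]_1) x.
  by rewrite /bary mulmxKV.
have [E1 E2] : bary A x *m const_mx 1 = (const_mx 1 : 'cV[R]_1) /\ bary A x *m A = x.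
  by move: E; rewrite mul_simplex_mx => E; exact: (@eq_row_mx _ 1 1 n _ _ _ _ E).
split => //; first by move=> i; rewrite inE.
move: E1 => /matrixP /(_ ord0 ord0); rewrite !mxE => <-.
by apply: eq_bigr => k _; rewrite [X in _ * X]mxE mulr1.
Qed.

(** Otherwise the [i]-th barycentric coordinate would be constant, although it is [1] at vertex [i]
    and [0] at any other vertex. Hence its zero set is a genuine hyperplane, and negligible. *)
Lemma bary_coef_neq0 A i : affinely_independent A -> exists j, bary_coef A i j != 0.
Proof.
rewrite /affinely_independent -[row_mx _ _]/(simplex_mx A) row_free_unit => uA.
apply/existsP; apply: contraT; rewrite negb_exists => /forallP h.
have c x : bary A x ord0 i = invmx (simplex_mx A) ord0 i.
  rewrite baryE big1 ?addr0// => j _.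
  by have := h j; rewrite negbK => /eqP ->; rewrite mul0r.
have v k : bary A (row k A) ord0 i = (k == i)%:R.
  rewrite /bary (_ : (row_mx _ _ : 'rV_(1 + n)) = row k (simplex_mx A)).
    by rewrite -row_mul mulmxV// !mxE.
  by rewrite row_simplex_mx.
have /eqP := v i; rewrite eqxx c => /eqP h1.
have [k ki] : exists k : 'I_n.+1, k != i.
  by exists (lift i ord0); rewrite eq_sym neq_lift.
have := v k; rewrite c h1 (negbTE ki) => /eqP.
by rewrite oner_eq0.
Qed.

Lemma bary_continuous A i : continuous (fun x => bary A x ord0 i).
Proof.
rewrite (_ : (fun x => _) = fun x : U => invmx (simplex_mx A) ord0 i +
   \sum_j bary_coef A i j * x ord0 j); last by apply/funext => x; rewrite baryE.
apply: sm_continuous; apply: sm_add; first exact: sm_cst.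
by apply: sm_sum => j; apply: sm_mul; [exact: sm_cst|exact: sm_coord].
Qed.

Lemma bary_line A x y t i : bary A (x + t *: (y - x)) ord0 i =
  (1 - t) * bary A x ord0 i + t * bary A y ord0 i.
Proof.
rewrite !baryE !mulrDr.
rewrite (_ : \sum_j bary_coef A i j * (x + t *: (y - x)) ord0 j =
  (1 - t) * (\sum_j bary_coef A i j * x ord0 j) +
  t * (\sum_j bary_coef A i j * y ord0 j)); first by ring.
rewrite !mulr_sumr -big_split/=; apply: eq_bigr => j _.
by rewrite !mxE; ring.
Qed.

Definition bary_pos A : set U := [set x | forall i, 0 < bary A x ord0 i].

Lemma open_bary_pos A : open (bary_pos A).
Proof.
rewrite openE => x h.
have H i : nbhs (x : U) [set y : U | 0 < bary A y ord0 i].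
  exact: (@bary_continuous A i x [set z | 0 < z] (lt_nbhsr (h i))).
exact: (@filter_forall _ _ (fun i => [set y : U | 0 < bary A y ord0 i]) (nbhs (x : U)) _ H).
Qed.

Lemma bary_center A : affinely_independent A -> exists c, bary_pos A c.
Proof.
rewrite /affinely_independent -[row_mx _ _]/(simplex_mx A) row_free_unit => uA.
pose t : 'rV[R]_n.+1 := const_mx (n.+1%:R^-1).
exists (t *m A) => i.
rewrite /bary (_ : (row_mx _ _ : 'rV_(1 + n)) = t *m simplex_mx A).
  by rewrite mulmxK// mxE invr_gt0.
rewrite mul_simplex_mx; congr row_mx.
apply/rowP => j; rewrite !mxE (eq_bigr (fun=> n.+1%:R^-1)); last first.
  by move=> k _; rewrite !mxE mulr1.
by rewrite sumr_const card_ord -[RHS]mulr_natr mulVf// pnatr_eq0.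
Qed.

Lemma closed_simplex (A : 'M[R]_(n.+1, n)) : affinely_independent A -> closed (simplex A).
Proof.
move=> iA; rewrite (_ : simplex A = \bigcap_(i in [set: 'I_n.+1]) [set x | 0 <= bary A x ord0 i]).
  apply: closed_bigI => i _.
  apply: (@closed_comp _ _ (fun x : U => bary A x ord0 i) [set y | 0 <= y]).
    by move=> x _; exact: bary_continuous.
  exact: closed_ge.
apply/seteqP; split => x /=.
  by move=> /(simplexP _ iA) h i _; exact: h.
by move=> h; apply/(simplexP _ iA) => i; exact: h.
Qed.

(* Whole hyperplanes rather than the facets they carry: still negligible, and
   off them every point of the mesh is interior to its simplex. *)
Definition facets (T : seq 'M[R]_(n.+1, n)) : set U :=
  \big[setU/set0]_(A <- T) \big[setU/set0]_(i < n.+1) [set x | bary A x ord0 i = 0].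

Lemma facetsP T x : facets T x <-> exists2 A, A \in T & exists i, bary A x ord0 i = 0.
Proof.
rewrite /facets -bigcup_seq; split=> [[A AT]|[A AT [i Ai]]].
  by rewrite -bigcup_mkord_ord => -[i _ /= Ai]; exists A => //; exists (inord i).
by exists A => //; rewrite -bigcup_mkord_ord; exists i => /=; rewrite ?inord_val.
Qed.

Lemma facets_null T : {in T, forall A, affinely_independent A} ->
  [/\ closed (facets T), measurable (facets T) & mu (facets T) = 0%E].
Proof.
move=> iT; rewrite /facets big_seq.
apply: (big_ind (fun X : set U => [/\ closed X, measurable X & mu X = 0%E])).
- by split; [exact: closed0|exact: measurable0|exact: measure0].
- move=> X Y [cX mX X0] [cY mY Y0]; split; [exact: closedU|exact: measurableU|].
  by apply: null_set_setU.
move=> A AT; apply: (big_ind (fun X : set U => [/\ closed X, measurable X & mu X = 0%E])).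
- by split; [exact: closed0|exact: measurable0|exact: measure0].
- move=> X Y [cX mX X0] [cY mY Y0]; split; [exact: closedU|exact: measurableU|].
  by apply: null_set_setU.
move=> i _.
have cl : closed [set x | bary A x ord0 i = 0].
  apply: (@closed_comp _ _ (fun x : U => bary A x ord0 i) [set y | y = 0]).
    by move=> x _; exact: bary_continuous.
  exact: closed_eq.
split => //.
  rewrite -[X in measurable X]setCK; apply: measurableC.
  by apply: open_measurable_rV; exact: closed_openC.
rewrite (_ : [set x | _] =
    [set x : U | \sum_j bary_coef A i j * x ord0 j = - invmx (simplex_mx A) ord0 i]).
  by apply: lebesgue_rV_hyperplane; apply: bary_coef_neq0; exact: iT.
apply/seteqP; split => x /=; rewrite baryE; last by move=> ->; rewrite subrr.
by move/eqP; rewrite addrC addr_eq0 => /eqP.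
Qed.

End barycentric.

(** * Lipschitz bounds across a finite closed cover of a segment *)

Section segment_cover.
Context {R : realType}.

(** Induction on the number of sets. A set containing [a] is used up to the last time [t] at which
    it is met, however often it is left in between; it can be discarded afterwards. *)
Lemma lipschitz_closed_cover (I : choiceType) (s : seq I) (C : I -> set R) (g : R -> R)
    (L : R) : 0 <= L -> (forall i, i \in s -> closed (C i)) ->
  (forall i u v, i \in s -> C i u -> C i v -> `|g u - g v| <= L * `|u - v|) ->
  forall a, a <= 1 -> (forall u, a <= u <= 1 -> exists2 i, i \in s & C i u) ->
  `|g 1 - g a| <= L * (1 - a).
Proof.
move=> L0; have [k] := ubnP (size s); elim: k s => // k IH s ks cC gC a a1 cov.
have [i si Cia] := cov a ltac:(by rewrite lexx a1).
pose E := C i `&` [set u | a <= u <= 1].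
have E0 : E !=set0 by exists a; split => //=; rewrite lexx a1.
have Eub : has_sup E by split => //; exists 1 => u [_ /= /andP[]].
have cE : closed E.
  apply: closedI; first exact: cC.
  by rewrite -set_itvcc; exact: itv_closed.
have Et : E (sup E).
  by have := closure_sup E0 Eub.2; rewrite -((closure_id E).1 cE).
set t := sup E in Et.
have [Cit /= /andP[at1 t1]] := Et.
have ga : `|g t - g a| <= L * (t - a).
  by apply: le_trans (gC i _ _ si Cit Cia) _; rewrite ger0_norm ?subr_ge0.
have [<-//|tn1] := eqVneq t 1.
have t1' : t < 1 by rewrite lt_neqAle tn1.
pose s' := [seq j <- s | j != i].
have cov' u : t < u <= 1 -> exists2 j, j \in s' & C j u.
  move=> /andP[tu u1]; have [|j sj Cju] := cov u.
    by rewrite u1 (le_trans at1)// ltW.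
  exists j => //; rewrite mem_filter sj andbT.
  have at' := le_trans at1 (ltW tu).
  apply: contraTneq tu => ji; rewrite -leNgt.
  apply: ub_le_sup; first by case: Eub.
  by split; [rewrite -ji|rewrite /= u1 at'].
(* The remaining sets cover all times after [t]; their finite union is closed, so it contains [t]
   too and the induction can start there. *)
have covt : exists2 j, j \in s' & C j t.
  have cK : closed (\bigcup_(j in [set` s']) C j).
    apply: closed_bigcup; first exact: finite_seq.
    by move=> j /=; rewrite mem_filter => /andP[_ /cC].
  suff [j sj Cjt] : (\bigcup_(j in [set` s']) C j) t by exists j.
  rewrite ((closure_id _).1 cK).
  move=> B /nbhs_ballP[e /= e0 teB].
  pose u := Num.min (t + e / 2) 1.
  have tu : t < u <= 1 by rewrite /u lt_min ge_min lexx orbT andbT; apply/andP; split; lra.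
  have [j sj Cju] := cov' u tu.
  exists u; split; first by exists j.
  apply: teB; rewrite /ball/= ltr_distl; move/andP: tu => [tu _].
  have : u <= t + e / 2 by rewrite /u ge_min lexx.
  by move=> ?; apply/andP; split; lra.
apply: le_trans (_ : L * (1 - t) + L * (t - a) <= _); last by lra.
rewrite -(subrKA (g t)); apply: le_trans (ler_normD _ _) _; apply: lerD => //.
apply: (IH s').
- rewrite size_filter; apply: (leq_trans _ (ks : (size s <= k)%N)).
  rewrite -(count_predC (pred1 i) s) -[X in (X < _)%N]add0n ltn_add2r.
  by rewrite -has_count has_pred1.
- by move=> j; rewrite mem_filter => /andP[_ /cC].
- by move=> j u v; rewrite mem_filter => /andP[_ sj]; exact: gC.
- by [].
- move=> u /andP[]; rewrite le_eqVlt => /predU1P[<- _|tu u1]; first exact: covt.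
  by apply: cov'; rewrite tu.
Qed.

End segment_cover.

(** * Piecewise smooth functions on a triangulated convex domain *)

Section domain.
Context {R : realType} {n' : nat}.
Local Notation n := n'.+1.
Local Notation U := 'rV[R]_n.
Local Notation mu := (lebesgue_rV R n).

(** Plain convexity, written as a walk along the segment from [x] to [y]. *)
Definition star_convex (D : set U) :=
  forall x y (t : R), D x -> D y -> 0 <= t <= 1 -> D (x + t *: (y - x)).

(** The strict bound [b] on the closure keeps the domain away from the faces of the cube of
    half-side [b], so that functions extended by zero vanish there. *)
Record meshed (Omega : set U) (T : seq 'M[R]_(n.+1, n)) (b : R) : Prop := {
  mesh_open : open Omega;
  mesh_neq0 : Omega !=set0;
  mesh_convex : star_convex Omega;
  mesh_bound : forall x, closure Omega x -> forall i, `|x ord0 i| < b;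
  mesh_independent : {in T, forall A, affinely_independent A};
  mesh_cover : closure Omega = \bigcup_(A in [set` T]) simplex A }.

Lemma near_partial (f g : U -> R) i (x : U) : (\forall y \near x, f y = g y) ->
  \forall y \near x, partial i f y = partial i g y.
Proof.
move=> fg; have : nbhs x [set y | f y = g y]° by exact: nbhs_interior.
by apply: filterS => y; exact: near_eq_derive.
Qed.

Lemma line_continuous (x v : U) : continuous (fun t : R => x + t *: v).
Proof.
move=> t; apply: (@continuousD _ _ _ (fun=> x) (fun t : R => t *: v)).
  exact: cst_continuous.
exact: scalel_continuous.
Qed.

Lemma sm_C1_near (f : U -> R) x : sm f -> C1_near f x.
Proof.
move=> sf i; split; first by near=> y; exact: sm_derivable.
by apply: sm_continuous; exact: sm_partial.
Unshelve. all: by end_near. Qed.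

Lemma near_eq_continuous (f g : U -> R) (x : U) : (\forall y \near x, f y = g y) ->
  {for x, continuous f} -> {for x, continuous g}.
Proof.
move=> fg fc; rewrite /prop_for /continuous_at -(nbhs_singleton fg).
exact: (cvg_trans (near_eq_cvg fg) fc).
Qed.

Lemma near_C1_near (f g : U -> R) (x : U) : (\forall y \near x, f y = g y) ->
  C1_near f x -> C1_near g x.
Proof.
move=> fg Cf i; split.
  have : nbhs x [set y | f y = g y]° by exact: nbhs_interior.
  move: (Cf i).1; apply: filterS2 => y dfy fgy.
  exact: near_eq_derivable fgy dfy.
apply: near_eq_continuous (Cf i).2.
exact: near_partial.
Qed.

Variables (Omega : set U) (T : seq 'M[R]_(n.+1, n)) (b : R).
Hypothesis dom : meshed Omega T b.
Let Oo := mesh_open dom.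
Let O0 := mesh_neq0 dom.
Let Oc := mesh_convex dom.
Let Ob := mesh_bound dom.
Let Ti := mesh_independent dom.
Let Tc := mesh_cover dom.

Local Notation Z := (facets T).
Local Notation Omega' := (Omega `\` Z).

Lemma mesh_bound_gt0 : 0 < b.
Proof.
have [x Ox] := O0; have := Ob (subset_closure Ox) ord0.
exact: le_lt_trans.
Qed.

Lemma closure_ball (D : set U) x (e : R) : closure D x -> 0 < e ->
  exists2 y, D y & `|x - y| < e.
Proof.
move=> Dx e0; have [y [Dy]] := Dx _ (nbhsx_ballx x e e0).
by rewrite -ball_normE /ball_/= => xy; exists y.
Qed.

(** The point [x] is replaced by a nearby [y] of the domain and [c] is shifted to compensate, within
    a ball contained in the domain. *)
Lemma closure_segment x c (t : R) : closure Omega x -> Omega c -> 0 < t <= 1 ->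
  Omega (x + t *: (c - x)).
Proof.
move=> cx Oc' /andP[t0 t1].
have [r /= r0 cr] : nbhs_ball c Omega by apply/nbhs_ballP; exact: open_nbhs_nbhs.
have tr : 0 < t * r by exact: mulr_gt0.
have [y Oy xy] := closure_ball cx tr.
(* Chosen so that the segment from [y] to [c1] passes through the same point at the same parameter
   [t]. *)
pose c1 : U := c + ((1 - t) / t) *: (x - y).
have Oc1 : Omega c1.
  apply: cr; rewrite -ball_normE /ball_/= /c1 opprD addrA subrr add0r normrN normrZ.
  rewrite (ger0_norm (_ : 0 <= (1 - t) / t)); last first.
    by rewrite divr_ge0 ?(ltW t0)// subr_ge0.
  rewrite mulrAC ltr_pdivrMr// [r * t]mulrC.
  apply: le_lt_trans xy; rewrite ler_piMl//; lra.
rewrite (_ : x + _ = y + t *: (c1 - y)); first by apply: Oc => //; rewrite (ltW t0) t1.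
apply/rowP => i; rewrite !mxE; field.
by rewrite gt_eqF.
Qed.

Lemma closure_star_convex : star_convex (closure Omega).
Proof.
move=> x y t cx cy /andP[]; rewrite le_eqVlt => /predU1P[<- _|t0 t1].
  by rewrite scale0r addr0.
have [c Oc'] := O0.
move=> B /nbhs_ballP[e /= e0 eB].
have [y1 Oy1 yy1] := closure_ball cy e0.
exists (x + t *: (y1 - x)); split; first by apply: closure_segment => //; rewrite t0.
apply: eB; rewrite -ball_normE /ball_/=.
rewrite (_ : _ - _ = t *: (y - y1)); last by apply/rowP => i; rewrite !mxE; ring.
rewrite normrZ gtr0_norm//; apply: le_lt_trans yy1.
by rewrite ler_piMl.
Qed.

(** If the pushed point were in the closure, [x] would lie on the segment from it to [c], hence in
    the domain by [closure_segment]. *)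
Lemma closure_exterior x c (s : R) : Omega c -> ~ Omega x -> 0 < s ->
  ~ closure Omega (x + s *: (x - c)).
Proof.
move=> Oc' nOx s0 cz; apply: nOx.
have s1 : 0 < 1 + s by lra.
rewrite (_ : x = (x + s *: (x - c)) + (s / (1 + s)) *: (c - (x + s *: (x - c)))).
  apply: closure_segment => //; rewrite divr_gt0//= ler_pdivrMr//; lra.
by apply/rowP => i; rewrite !mxE; field; rewrite gt_eqF.
Qed.

Lemma bary_pos_simplex A : A \in T -> bary_pos A `<=` simplex A.
Proof. by move=> AT x h; apply/(simplexP _ (Ti AT)) => i; rewrite ltW. Qed.

Lemma simplex_closure A : A \in T -> simplex A `<=` closure Omega.
Proof. by move=> AT x Ax; rewrite Tc; exists A. Qed.

Lemma simplex_nfacets A x : A \in T -> simplex A x -> ~ Z x -> bary_pos A x.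
Proof.
move=> AT /(simplexP _ (Ti AT)) h nZ i; rewrite lt_neqAle h andbT eq_sym.
by apply/eqP => h0; apply: nZ; apply/facetsP; exists A => //; exists i.
Qed.

(** Were [x] outside the domain, pushing it slightly away from a point of the domain would leave it
    in the element, hence in the closure, against [closure_exterior]. *)
Lemma bary_pos_Omega A : A \in T -> bary_pos A `<=` Omega.
Proof.
move=> AT x Ax; have [c Oc'] := O0.
apply: contrapT => nOx.
have [e /= e0 eA] : nbhs_ball x (bary_pos A).
  by apply/nbhs_ballP; apply: open_nbhs_nbhs; split => //; exact: open_bary_pos.
pose s := e / 2 / (1 + `|x - c|).
have n1 : 0 < 1 + `|x - c| by rewrite ltr_pwDl.
have s0 : 0 < s by rewrite /s !divr_gt0.
apply: (closure_exterior Oc' nOx s0); apply: (simplex_closure AT).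
apply: (bary_pos_simplex AT); apply: eA.
rewrite -ball_normE /ball_/= opprD addrA subrr add0r normrN normrZ gtr0_norm//.
rewrite /s mulrAC ltr_pdivrMr//.
have := normr_ge0 (x - c); nra.
Qed.

Lemma closure_nfacets x : closure Omega x -> ~ Z x -> Omega' x.
Proof.
move=> cx nZ; split=> //; move: cx; rewrite Tc => -[A AT Ax].
exact: (bary_pos_Omega AT (simplex_nfacets AT Ax nZ)).
Qed.

Let facetsN := facets_null Ti.

Lemma open_Omega' : open Omega'.
Proof. by rewrite setDE; apply: openI => //; apply: closed_openC; case: facetsN. Qed.

Lemma measurable_Omega' : measurable Omega'.
Proof. exact: open_measurable_rV open_Omega'. Qed.

Lemma Omega_cube : Omega `<=` cube 0 b.
Proof. by move=> x Ox i; rewrite mxE subr0 ltW// Ob//; exact: subset_closure. Qed.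

Lemma Omega_lty : (mu Omega < +oo)%E.
Proof.
apply: le_lt_trans (cube_lty (ltW mesh_bound_gt0)).
exact: (le_measure mu (mem_set (open_measurable_rV Oo)) (mem_set (measurable_cube 0 b)) Omega_cube).
Qed.

Lemma Omega'_lty : (mu Omega' < +oo)%E.
Proof.
apply: le_lt_trans Omega_lty.
exact: (le_measure mu (mem_set measurable_Omega') (mem_set (open_measurable_rV Oo)) (@subDsetl _ _ _)).
Qed.

Lemma Rintegral_Omega' (f : U -> R) :
  \int[mu]_(x in Omega) f x = \int[mu]_(x in Omega') f x.
Proof. by have [_ mZ Z0] := facetsN; exact: Rintegral_setD_null. Qed.

Lemma integral_Omega' (f : U -> \bar R) :
  (\int[mu]_(x in Omega) f x = \int[mu]_(x in Omega') f x)%E.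
Proof. by have [_ mZ Z0] := facetsN; exact: integral_setD_null. Qed.

(* Piecewise smoothness, up to the boundary of each simplex. *)
Definition pw (D : set U) (v : U -> R) := exists P : 'M[R]_(n.+1, n) -> U -> R,
  forall A, A \in T -> sm (P A) /\ forall x, D x -> simplex A x -> v x = P A x.

Lemma pwW (D D' : set U) v : D' `<=` D -> pw D v -> pw D' v.
Proof.
move=> DD [P hP]; exists P => A AT; have [sP vP] := hP A AT.
by split=> // x /DD; exact: vP.
Qed.

Lemma pw_sm D f : sm f -> pw D f.
Proof. by move=> sf; exists (fun=> f). Qed.

Lemma pwM D f g : pw D f -> pw D g -> pw D (fun x => f x * g x).
Proof.
move=> [P hP] [Q hQ]; exists (fun A x => P A x * Q A x) => A AT.
have [sP fP] := hP A AT; have [sQ gQ] := hQ A AT; split; first exact: sm_mul.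
by move=> x Dx Ax; rewrite fP// gQ.
Qed.

Lemma eq_pw D f g : (forall x, D x -> f x = g x) -> pw D f -> pw D g.
Proof.
move=> fg [P hP]; exists P => A AT; have [sP fP] := hP A AT.
by split=> // x Dx Ax; rewrite -fg// fP.
Qed.

Lemma seq_bound (P : 'M[R]_(n.+1, n) -> R -> Prop) :
  (forall A C C', C <= C' -> P A C -> P A C') ->
  (forall A, A \in T -> exists C, P A C) ->
  exists2 C, 0 <= C & forall A, A \in T -> P A C.
Proof.
move=> Pm; elim: (T) => [|A s IH] h; first by exists 0.
have [|C C0 hC] := IH; first by move=> B Bs; apply: h; rewrite inE Bs orbT.
have [C' hC'] := h A (mem_head _ _).
exists (Num.max C C'); first by rewrite le_max C0.
move=> B; rewrite inE => /predU1P[->|Bs]; first by apply: Pm hC'; rewrite le_max lexx orbT.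
by apply: Pm (hC B Bs); rewrite le_max lexx.
Qed.

Lemma simplex_cube A : A \in T -> simplex A `<=` cube 0 b.
Proof.
by move=> AT x /(simplex_closure AT) cx i; rewrite mxE subr0 ltW// Ob.
Qed.

Lemma pw_bounded D v : D `<=` closure Omega -> pw D v ->
  exists2 C, 0 <= C & forall x, D x -> `|v x| <= C.
Proof.
move=> Dc [P hP].
have [C C0 hC] : exists2 C, 0 <= C & forall A, A \in T ->
    forall x, simplex A x -> `|P A x| <= C.
  apply: seq_bound => [A C C' CC h x Ax|A AT]; first exact: le_trans (h x Ax) CC.
  have [C C0 hC] := sm_bounded_cube b (hP A AT).1.
  by exists C => x Ax; apply: hC; exact: (simplex_cube AT Ax).
exists C => // x Dx; have := Dc _ Dx; rewrite Tc => -[A AT Ax].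
by rewrite (hP A AT).2//; exact: hC.
Qed.

(** Along a segment the preimages of the simplices form a finite closed cover, and [v] is Lipschitz
    on each of them, even if the segment runs inside faces or meets a simplex in unexpected
    order. *)
Lemma pw_lipschitz D v : D `<=` closure Omega -> star_convex D -> pw D v ->
  exists2 L, 0 <= L & lipschitz_in D L v.
Proof.
move=> Dc Dconv [P hP].
have [L L0 hL] : exists2 L, 0 <= L & forall A, A \in T ->
    lipschitz_in (cube 0 b) L (P A).
  apply: seq_bound => [A C C' CC|A AT]; first exact: lipschitz_inW.
  by have [L L0 hL] := sm_lipschitz_cube b (hP A AT).1; exists L.
exists L => // x y Dx Dy.
pose l (t : R) : U := x + t *: (y - x).
have l1 : l 1 = y by rewrite /l scale1r addrCA subrr addr0.
have l0 : l 0 = x by rewrite /l scale0r addr0.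
have lc : continuous l by exact: line_continuous.
pose C A := l @^-1` simplex A `&` [set t | 0 <= t <= 1].
suff : `|v (l 1) - v (l 0)| <= L * `|x - y| * (1 - 0).
  by rewrite l1 l0 subr0 mulr1 distrC.
apply: (@lipschitz_closed_cover R _ T C (v \o l)) => //.
- by rewrite mulr_ge0.
- move=> A AT; apply: closedI.
    by apply: closed_comp => [t _|]; [exact: lc|exact: (closed_simplex (Ti AT))].
  by rewrite -set_itvcc; exact: itv_closed.
- move=> A s t AT [As s01] [At t01].
  have Ds : D (l s) by exact: Dconv.
  have Dt : D (l t) by exact: Dconv.
  rewrite /= !(hP A AT).2//.
  apply: le_trans (hL A AT _ _ (simplex_cube AT As) (simplex_cube AT At)) _.
  rewrite (_ : l s - l t = (s - t) *: (y - x)); last first.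
    by apply/rowP => i; rewrite !mxE; ring.
  by rewrite normrZ [`|y - x|]distrC -mulrA [`|x - y| * _]mulrC.
- move=> t t01; have := Dc _ (Dconv x y t Dx Dy t01); rewrite Tc => -[A AT At].
  by exists A.
Qed.

Lemma pw_local v x : pw Omega' v -> Omega' x -> exists2 p, sm p & \forall y \near x, v y = p y.
Proof.
move=> [P hP] Ox; have := subset_closure Ox.1; rewrite Tc => -[A AT Ax].
exists (P A); first exact: (hP A AT).1.
have bx := simplex_nfacets AT Ax Ox.2.
have : nbhs x (bary_pos A `&` Omega').
  by apply: open_nbhs_nbhs; split => //; apply: openI; [exact: open_bary_pos|exact: open_Omega'].
apply: filterS => y [Ay Oy]; apply: (hP A AT).2 => //.
exact: bary_pos_simplex.
Qed.

Lemma pw_C1_near v x : pw Omega' v -> Omega' x -> C1_near v x.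
Proof.
move=> pv Ox; have [p sp vp] := pw_local pv Ox.
apply: near_C1_near (sm_C1_near x sp).
by apply: filterS vp => y.
Qed.

Lemma pw_derivable v x i : pw Omega' v -> Omega' x -> derivable v x (basis_vec R i).
Proof. by move=> pv Ox; have := (pw_C1_near pv Ox i).1; exact: nbhs_singleton. Qed.

Lemma pw_continuous v x : pw Omega' v -> Omega' x -> {for x, continuous v}.
Proof.
move=> pv Ox; have [p sp vp] := pw_local pv Ox.
apply: (@near_eq_continuous p v x); last exact: sm_continuous.
by apply: filterS vp => y.
Qed.

Lemma pw_partial v i : pw Omega' v -> pw Omega' (partial i v).
Proof.
move=> [P hP]; exists (fun A => partial i (P A)) => A AT; split.
  by apply: sm_partial; exact: (hP A AT).1.
move=> x Ox Ax.
have bx := simplex_nfacets AT Ax Ox.2.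
apply: near_eq_derive.
have : nbhs x (bary_pos A `&` Omega').
  by apply: open_nbhs_nbhs; split => //; apply: openI; [exact: open_bary_pos|exact: open_Omega'].
apply: filterS => y [Ay Oy]; apply: (hP A AT).2 => //.
exact: bary_pos_simplex.
Qed.

Lemma pw_partialC v i j x : pw Omega' v -> Omega' x ->
  partial i (partial j v) x = partial j (partial i v) x.
Proof.
move=> pv Ox; have [p sp vp] := pw_local pv Ox.
rewrite (nbhs_singleton (near_partial i (near_partial j vp))).
by rewrite (nbhs_singleton (near_partial j (near_partial i vp))) (partialC i j sp).
Qed.

Lemma pw_bmeas v : pw Omega' v -> bmeas Omega' v.
Proof.
move=> pv; split.
  apply: open_continuous_measurable_rV; first exact: open_Omega'.
  by move=> x /set_mem Ox; exact: pw_continuous.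
have [|C _ hC] := pw_bounded _ pv; last by exists C.
by move=> x [Ox _]; exact: subset_closure.
Qed.

(** On a face, the derivative is reached along a segment towards the interior of [A]: there [v]
    locally coincides with its smooth piece, and both derivatives are continuous at the end point.
    This is where the [C^1] property of splines makes their gradients Lipschitz on the domain. *)
Lemma pw_partial_Omega v i : pw Omega v -> C1_on Omega v -> pw Omega (partial i v).
Proof.
move=> [P hP] Cv; exists (fun A => partial i (P A)) => A AT; split.
  by apply: sm_partial; exact: (hP A AT).1.
move=> x Ox Ax.
have sP := (hP A AT).1.
have [c Ac] := bary_center (Ti AT).
pose l (t : R) : U := x + t *: (c - x).
have l0 : l 0 = x by rewrite /l scale0r addr0.
have lc : continuous l by exact: line_continuous.
have h1 : (fun t => partial i v (l t)) @ 0^'+ --> partial i v x.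
  apply: cvg_at_right_filter; rewrite -[in X in _ --> X]l0.
  apply: (@continuous_comp _ _ _ l (partial i v)); first exact: lc.
  by rewrite l0; exact: (Cv x Ox i).2.
have h2 : (fun t => partial i (P A) (l t)) @ 0^'+ --> partial i (P A) x.
  apply: cvg_at_right_filter; rewrite -[in X in _ --> X]l0.
  apply: (@continuous_comp _ _ _ l (partial i (P A))); first exact: lc.
  by apply: sm_continuous; exact: sm_partial.
suff h3 : (fun t => partial i v (l t)) @ 0^'+ --> partial i (P A) x.
  exact: (cvg_unique _ h1 h3).
apply: cvg_trans h2; apply: near_eq_cvg; near=> t.
have t0 : 0 < t by near: t; exact: nbhs_right_gt.
have t1 : t <= 1 by near: t; apply: nbhs_right_le; exact: ltr01.
have Al : bary_pos A (l t).
  move=> k; rewrite bary_line ltr_wpDl//.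
    by rewrite mulr_ge0 ?subr_ge0//; move/(simplexP _ (Ti AT)): Ax; exact.
  by rewrite mulr_gt0.
apply: near_eq_derive.
have : nbhs (l t) (bary_pos A).
  by apply: open_nbhs_nbhs; split => //; exact: open_bary_pos.
apply: filterS => y Ay; apply/esym; apply: (hP A AT).2.
  exact: (bary_pos_Omega AT).
exact: bary_pos_simplex.
Unshelve. all: by end_near. Qed.

Definition zext (w : U -> R) : U -> R := fun x => if x \in Omega then w x else 0.

Lemma zextE w x : Omega x -> zext w x = w x.
Proof. by move=> Ox; rewrite /zext mem_set. Qed.

Lemma zext0 w x : ~ Omega x -> zext w x = 0.
Proof. by move=> Ox; rewrite /zext memNset. Qed.

Lemma boundary_Omega x : boundary Omega x <-> closure Omega x /\ ~ Omega x.
Proof. by rewrite /boundary ((interior_id _).1 Oo). Qed.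

(** The point at the supremum of the parameters staying in the domain is a limit of points of the
    domain and, by openness, not one of them. *)
Lemma segment_boundary x y : Omega x -> ~ Omega y ->
  exists2 z, boundary Omega z & `|x - z| <= `|x - y|.
Proof.
move=> Ox nOy.
pose l (t : R) : U := x + t *: (y - x).
have lc : continuous l by exact: line_continuous.
pose E := [set t : R | 0 <= t <= 1 /\ Omega (l t)].
have E0 : E 0 by split; [rewrite lexx ler01|rewrite /l scale0r addr0].
have Eub : has_sup E by split; [exists 0|exists 1 => t [/andP[]]].
pose s := sup E.
have s0 : 0 <= s by apply: ub_le_sup => //; exact: Eub.2.
have s1 : s <= 1 by apply: ge_sup; [exists 0|move=> t [/andP[]]].
exists (l s).
  apply/boundary_Omega; split.
    move=> B lB.
    have cs : closure E s by apply: closure_sup; [exists 0|exact: Eub.2].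
    have [t [[_ Ot] Bt]] := cs _ (lc s B lB).
    by exists (l t).
  move=> Os.
  have sn1 : s < 1.
    rewrite lt_neqAle s1 andbT; apply/eqP => s1'; apply: nOy.
    by move: Os; rewrite /l s1' scale1r addrCA subrr addr0.
  have : nbhs s (l @^-1` Omega) by apply: lc; exact: open_nbhs_nbhs.
  move=> /nbhs_ballP[e /= e0 eO].
  pose t := Num.min (s + e / 2) 1.
  have st : s < t by rewrite /t lt_min sn1 andbT; lra.
  have : E t.
    split; first by rewrite (le_trans s0 (ltW st))/= /t ge_min lexx orbT.
    apply: eO; rewrite /ball/= distrC ger0_norm ?subr_ge0 ?ltW//.
    have : t <= s + e / 2 by rewrite /t ge_min lexx.
    lra.
  by move=> /(ub_le_sup Eub.2); rewrite leNgt st.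
rewrite /l opprD addrA subrr add0r normrN normrZ ger0_norm// [`|y - x|]distrC.
by rewrite ler_piMl.
Qed.

(** Between a point inside and a point outside, the segment meets the boundary at a nearer point
    where [w] vanishes; the constant is not enlarged. *)
Lemma zext_lipschitz w L : 0 <= L -> lipschitz_in (closure Omega) L w ->
  (forall x, boundary Omega x -> w x = 0) -> lipschitz_rV L (zext w).
Proof.
move=> L0 Lw w0.
have main x y : Omega x -> `|zext w x - zext w y| <= L * `|x - y|.
  move=> Ox; have [Oy|nOy] := pselect (Omega y).
    by rewrite !zextE//; apply: Lw; exact: subset_closure.
  rewrite zextE// zext0// subr0.
  have [z bz xz] := segment_boundary Ox nOy.
  have := Lw x z (subset_closure Ox) ((boundary_Omega z).1 bz).1.
  by rewrite (w0 _ bz) subr0 => /le_trans; apply; rewrite ler_wpM2l.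
move=> x y; have [Ox|nOx] := pselect (Omega x); first exact: main.
have [Oy|nOy] := pselect (Omega y); first by rewrite distrC [`|x - y|]distrC; exact: main.
by rewrite !zext0// subrr normr0 mulr_ge0.
Qed.

(** A subset of full measure of the cube. Outside the closure of the domain, functions extended by
    zero vanish in a whole neighbourhood. *)
Let S := Omega' `|` (cube 0 b `\` closure Omega).

Let mS : measurable S.
Proof.
apply: measurableU; first exact: measurable_Omega'.
apply: measurableD; first exact: measurable_cube.
rewrite -[X in measurable X]setCK; apply: measurableC.
by apply: open_measurable_rV; apply: closed_openC; exact: closed_closure.
Qed.

Let S_cube : S `<=` cube 0 b.
Proof. by move=> x [[/Omega_cube]|[]]. Qed.

Let S_null : mu (cube 0 b `\` S) = 0%E.
Proof.
have [_ mZ Z0] := facetsN.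
apply: (@subset_measure0 _ _ _ mu _ Z) => //.
  by apply: measurableD => //; exact: measurable_cube.
move=> x [cx nS]; apply: contrapT => nZ; apply: nS.
have [xc|xc] := pselect (closure Omega x); last by right.
by left; exact: closure_nfacets.
Qed.

Let near_exterior (f : U -> R) x : (forall x, ~ Omega x -> f x = 0) ->
  ~ closure Omega x -> \forall y \near x, (fun=> 0) y = f y.
Proof.
move=> f0 nx.
have : nbhs x (~` closure Omega).
  by apply: open_nbhs_nbhs; split => //; apply: closed_openC; exact: closed_closure.
by apply: filterS => y ny; rewrite f0// => Oy; apply: ny; exact: subset_closure.
Qed.

Let f_face (f : U -> R) : (forall x, ~ Omega x -> f x = 0) ->
  forall (x : U) i, `|x ord0 i| = b -> f x = 0.
Proof.
move=> f0 x i xb; apply: f0 => Ox.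
by have := Ob (subset_closure Ox) i; rewrite xb ltxx.
Qed.

Let S_Omega' : S `&` Omega' = Omega'.
Proof. by apply/setIidPr; exact: subsetUl. Qed.

Lemma integral_partial_eq0 (f : U -> R) i L : 0 <= L -> lipschitz_rV L f ->
  (forall x, ~ Omega x -> f x = 0) -> pw Omega' f ->
  \int[mu]_(x in Omega') partial i f x = 0.
Proof.
move=> L0 Lf f0 pf.
rewrite -[RHS](@integral_partial_lipschitz R n b L S mesh_bound_gt0 L0 mS S_cube S_null f i Lf).
- rewrite -[in LHS]S_Omega' Rintegral_mkcondr; apply: eq_Rintegral => x.
  move=> /set_mem[Ox|[_ nx]]; rewrite /patch; first by rewrite mem_set.
  case: ifPn => // _.
  rewrite -(nbhs_singleton (near_partial i (near_exterior f0 nx))).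
  by rewrite partial_cst.
- by move=> x; exact: f_face.
- move=> x [Ox|[_ nx]]; first exact: pw_C1_near.
  by apply: near_C1_near (near_exterior f0 nx) _; apply: sm_C1_near; exact: sm_cst.
Qed.

Lemma integral_det_eq0 (f : 'I_n -> U -> R) i L : 0 <= L ->
  (forall k, lipschitz_rV L (f k)) ->
  (forall x, ~ Omega x -> f i x = 0) -> (forall k, pw Omega' (f k)) ->
  \int[mu]_(x in Omega') \det (jacobian f x) = 0.
Proof.
move=> L0 Lf f0 pf; rewrite -[in LHS]S_Omega'.
apply: (@integral_det_lipschitz R n b L S mesh_bound_gt0 L0 mS S_cube S_null Omega' f i Lf).
- by move=> x j; exact: f_face.
- move=> x [Ox|[_ nx]]; first exact: pw_C1_near.
  by apply: near_C1_near (near_exterior f0 nx) _; apply: sm_C1_near; exact: sm_cst.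
- by move=> k x Ox; exact: pw_C1_near.
- move=> x j [//|[_ nx]] _.
  rewrite -(nbhs_singleton (near_partial j (near_exterior f0 nx))).
  by rewrite partial_cst.
Qed.

End domain.

(** * Cofactors and symmetric matrices *)

Section matrices.
Context {R : realType}.

Definition cof_sum n (A E : 'M[R]_n) := \sum_i \sum_j cofactor A i j * E i j.

(** Entries indexed by natural numbers make the explicit minors of small matrices compute, so that
    [ring] applies. *)
Lemma mx_nat n (A : 'M[R]_n.+1) : exists a : nat -> nat -> R, A = \matrix_(i, j) a i j.
Proof.
exists (fun i j => A (inord i) (inord j)).
by apply/matrixP => i j; rewrite mxE !inord_val.
Qed.

Lemma det_mx2 (A : 'M[R]_2) : \det A =
  A ord0 ord0 * A (lift ord0 ord0) (lift ord0 ord0) -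
  A ord0 (lift ord0 ord0) * A (lift ord0 ord0) ord0.
Proof.
have [a ->] := mx_nat A.
rewrite (expand_det_row _ ord0) !big_ord_recl big_ord0 /cofactor !det_mx11 !mxE /=.
by rewrite /bump/=; ring.
Qed.

Lemma det_nat3 (a : nat -> nat -> R) :
  \det (\matrix_(i < 3, j < 3) a i j) =
    a 0%N 0%N * (a 1%N 1%N * a 2%N 2%N - a 1%N 2%N * a 2%N 1%N)
  - a 0%N 1%N * (a 1%N 0%N * a 2%N 2%N - a 1%N 2%N * a 2%N 0%N)
  + a 0%N 2%N * (a 1%N 0%N * a 2%N 1%N - a 1%N 1%N * a 2%N 0%N).
Proof.
rewrite (expand_det_row _ ord0) !big_ord_recl big_ord0 /cofactor !det_mx2 !mxE /= /bump /=.
ring.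
Qed.

Lemma cof_sum_nat3 (a e : nat -> nat -> R) :
  cof_sum (\matrix_(i < 3, j < 3) a i j) (\matrix_(i < 3, j < 3) e i j) =
    e 0%N 0%N * (a 1%N 1%N * a 2%N 2%N - a 1%N 2%N * a 2%N 1%N)
  - e 0%N 1%N * (a 1%N 0%N * a 2%N 2%N - a 1%N 2%N * a 2%N 0%N)
  + e 0%N 2%N * (a 1%N 0%N * a 2%N 1%N - a 1%N 1%N * a 2%N 0%N)
  - e 1%N 0%N * (a 0%N 1%N * a 2%N 2%N - a 0%N 2%N * a 2%N 1%N)
  + e 1%N 1%N * (a 0%N 0%N * a 2%N 2%N - a 0%N 2%N * a 2%N 0%N)
  - e 1%N 2%N * (a 0%N 0%N * a 2%N 1%N - a 0%N 1%N * a 2%N 0%N)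
  + e 2%N 0%N * (a 0%N 1%N * a 1%N 2%N - a 0%N 2%N * a 1%N 1%N)
  - e 2%N 1%N * (a 0%N 0%N * a 1%N 2%N - a 0%N 2%N * a 1%N 0%N)
  + e 2%N 2%N * (a 0%N 0%N * a 1%N 1%N - a 0%N 1%N * a 1%N 0%N).
Proof.
rewrite /cof_sum !big_ord_recl !big_ord0 /cofactor !det_mx2 !mxE /= /bump /=.
ring.
Qed.

(* [cof_sum] is the derivative of the determinant, which is a polynomial of
   degree at most 3 along a line: Simpson's rule is exact. *)
Lemma det_simpson n (A E : 'M[R]_n) : n = 2%N \/ n = 3%N ->
  \det (A + E) - \det A = 6^-1 *
    (cof_sum A E + 4 * cof_sum (A + 2^-1 *: E) E + cof_sum (A + E) E).
Proof.
have h k (a e : nat -> nat -> R) c : \matrix_(i < k, j < k) a i j + c *: \matrix_(i, j) e i j =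
    \matrix_(i, j) (a i j + c * e i j).
  by apply/matrixP => i j; rewrite !mxE.
have h1 k (a e : nat -> nat -> R) : \matrix_(i < k, j < k) a i j + \matrix_(i, j) e i j =
    \matrix_(i, j) (a i j + e i j).
  by apply/matrixP => i j; rewrite !mxE.
move=> [n2|n3]; subst n; have [a ->] := mx_nat A; have [e ->] := mx_nat E.
  rewrite !h1 !h /cof_sum.
  rewrite !big_ord_recl !big_ord0 /cofactor !det_mx11 !det_mx2 !mxE /= /bump /=.
  by field.
rewrite !h1 !h (det_nat3 (fun i j => a i j + e i j)) (det_nat3 a) (cof_sum_nat3 a e).
rewrite (cof_sum_nat3 (fun i j => a i j + 2^-1 * e i j)).
rewrite (cof_sum_nat3 (fun i j => a i j + e i j)).
by field.
Qed.

Lemma cof_sum_diag n (A : 'M[R]_n) : cof_sum A A = n%:R * \det A.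
Proof.
rewrite /cof_sum (eq_bigr (fun=> \det A)); last first.
  by move=> i _; rewrite (expand_det_row A i); apply: eq_bigr => j _; rewrite mulrC.
by rewrite sumr_const card_ord mulr_natl.
Qed.

Lemma cofmx_sym n (A : 'M[R]_n) : A^T = A -> (cofmx A)^T = cofmx A.
Proof.
move=> AT; apply/matrixP => i j; rewrite !mxE -[in RHS]AT cofactor_tr.
by rewrite /cofactor addnC.
Qed.

Local Notation U n := 'rV[R]_n.

Lemma dotvC n (x y : U n) : dotv x y = dotv y x.
Proof. by apply: eq_bigr => i _; rewrite mulrC. Qed.

Lemma dotvDl n (x y z : U n) : dotv (x + y) z = dotv x z + dotv y z.
Proof. by rewrite -big_split/=; apply: eq_bigr => i _; rewrite mxE mulrDl. Qed.

Lemma dotvZl n c (x y : U n) : dotv (c *: x) y = c * dotv x y.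
Proof. by rewrite mulr_sumr; apply: eq_bigr => i _; rewrite mxE mulrA. Qed.

Lemma dotvDr n (x y z : U n) : dotv z (x + y) = dotv z x + dotv z y.
Proof. by rewrite dotvC dotvDl !(dotvC z). Qed.

Lemma dotvZr n c (x y : U n) : dotv y (c *: x) = c * dotv y x.
Proof. by rewrite dotvC dotvZl dotvC. Qed.

Lemma dotvv_ge0 n (x : U n) : 0 <= dotv x x.
Proof. by apply: sumr_ge0 => i _; rewrite -expr2 sqr_ge0. Qed.

Lemma dotv_ge_coord n (x : U n) i : x ord0 i ^+ 2 <= dotv x x.
Proof.
rewrite /dotv (bigD1 i)//= -expr2 lerDl sumr_ge0// => j _.
by rewrite -expr2 sqr_ge0.
Qed.

Lemma dotvv_eq0 n (x : U n) : dotv x x = 0 -> x = 0.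
Proof.
move=> x0; apply/rowP => i; rewrite mxE.
have := psumr_eq0P _ x0 => /(_ _)/(_ i isT)/eqP; rewrite mulf_eq0 orbb => h.
by apply/eqP/h => j _; rewrite -expr2 sqr_ge0.
Qed.

Lemma dotv_mulmx n (x y : U n) (C : 'M[R]_n) : dotv (x *m C) y = dotv x (y *m C^T).
Proof.
rewrite /dotv.
under eq_bigr => i _ do rewrite mxE mulr_suml.
rewrite exchange_big/=; apply: eq_bigr => j _.
rewrite [in RHS]mxE mulr_sumr; apply: eq_bigr => i _.
by rewrite mxE; ring.
Qed.

Lemma sm_dotv n m (P Q : 'M[R]_(n, m)) : sm (fun x : U n => dotv (x *m P) (x *m Q)).
Proof.
apply: sm_sum => i; apply: sm_mul.
  rewrite (_ : (fun x => _) = fun x : U n => \sum_k x ord0 k * P k i).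
    by apply: sm_sum => k; apply: sm_mul; [exact: sm_coord|exact: sm_cst].
  by apply/funext => x; rewrite mxE.
rewrite (_ : (fun x => _) = fun x : U n => \sum_k x ord0 k * Q k i).
  by apply: sm_sum => k; apply: sm_mul; [exact: sm_coord|exact: sm_cst].
by apply/funext => x; rewrite mxE.
Qed.

(** The Rayleigh quotient attains its maximum [l] on the unit sphere at some [c]. If the residual
    [y = c C - l c] were nonzero, moving [c] slightly along [y] would increase the quotient. *)
Lemma sym_max_eigenvalue n (C : 'M[R]_n.+1) : C^T = C ->
  exists2 l, eigenvalue C l & forall x : U n.+1, dotv (x *m C) x <= l * dotv x x.
Proof.
move=> Cs.
pose S := [set x : U n.+1 | dotv x x = 1].
have sq : continuous (fun x : U n.+1 => dotv x x).
  apply: sm_continuous; have := sm_dotv (1%:M : 'M[R]_n.+1) 1%:M.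
  by congr sm; apply/funext => x; rewrite !mulmx1.
have sC : continuous (fun x : U n.+1 => dotv (x *m C) x).
  apply: sm_continuous; have := sm_dotv C 1%:M.
  by congr sm; apply/funext => x; rewrite !mulmx1.
have Sc : compact S.
  apply: bounded_closed_compact.
    exists 1; split; first exact: num_real.
    move=> r r1 x Sx /=; apply: le_trans (ltW r1).
    apply: normr_rV_le => // i.
    have : x ord0 i ^+ 2 <= 1.
      rewrite -Sx /dotv (bigD1 i)//= -expr2 lerDl sumr_ge0// => j _.
      by rewrite -expr2 sqr_ge0.
    by move=> h; rewrite ler_norml; nra.
  rewrite (_ : S = (fun x : U n.+1 => dotv x x) @^-1` [set 1]); last by [].
  by apply: closed_comp => [x _|]; [exact: sq|exact: closed_eq].
have S0 : S !=set0.
  exists (delta_mx ord0 ord0); rewrite /S/= /dotv (bigD1 ord0)//= mxE eqxx mulr1.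
  by rewrite big1 ?addr0// => i i0; rewrite mxE (negbTE i0) mulr0.
have [c /set_mem cS cmax] := EVT_max_rV S0 Sc (continuous_subspaceT sC).
pose l := dotv (c *m C) c.
have le_l x : dotv (x *m C) x <= l * dotv x x.
  have [->|x0] := eqVneq x 0.
    rewrite mul0mx /dotv !big1 ?mulr0// => i _; rewrite mxE mul0r//.
  have d0 : 0 < dotv x x.
    by rewrite lt_neqAle dotvv_ge0 andbT eq_sym; apply: contra x0 => /eqP/dotvv_eq0 ->.
  pose s := Num.sqrt (dotv x x).
  have s0 : 0 < s by rewrite sqrtr_gt0.
  have ss : s ^+ 2 = dotv x x by rewrite sqr_sqrtr// ltW.
  have := cmax (s^-1 *: x); rewrite -/l -scalemxAl !dotvZl !dotvZr => h.
  have : dotv (s^-1 *: x) (s^-1 *: x) = 1.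
    by rewrite dotvZl dotvZr -ss; field; rewrite gt_eqF.
  move=> /mem_set/h; rewrite mulrA -invfM -expr2 ss mulrC ler_pdivrMr//.
exists l => //; apply/eigenvalueP; exists c; last first.
  apply/eqP => c0; move: cS; rewrite /S/= c0 /dotv big1 => [/eqP|i _]; last by rewrite mxE mul0r.
  by rewrite eq_sym oner_eq0.
have [y yE] : exists y, y = c *m C - l *: c by exists (c *m C - l *: c).
have B0 : dotv y y = 0.
  apply/eqP; apply: contraT => yn0.
  have d0 : 0 < dotv y y by rewrite lt_neqAle dotvv_ge0 andbT eq_sym.
  pose K := l * dotv y y - dotv (y *m C) y.
  have K0 : 0 <= K by rewrite subr_ge0.
  have h t : 0 <= t ^+ 2 * K - t * (2 * dotv y y).
    have := le_l (c + t *: y).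
    rewrite mulmxDl -scalemxAl !dotvDl !dotvZl !dotvDr !dotvZr.
    rewrite [dotv (y *m C) c]dotv_mulmx Cs [dotv y (c *m C)]dotvC cS -/l.
    have -> : dotv (c *m C) y = dotv y y + l * dotv c y.
      by rewrite -dotvZl -dotvDl yE subrK.
    rewrite (dotvC y c) /K; set p := dotv c y; set q := dotv y y; set r := dotv (y *m C) y.
    by move=> hh; rewrite -subr_ge0 in hh; move: hh; congr (0 <= _); ring.
  (* At this [t] the term [t^2 K] is smaller than [t (y . y)], so the right side of [h] is
     negative. *)
  move: (h (dotv y y / (K + 1))).
  rewrite leNgt => /negP[].
  have K1 : 0 < K + 1 by rewrite ltr_wpDl.
  rewrite subr_lt0 expr2 -mulrA ltr_pM2l ?divr_gt0//.
  rewrite mulrAC ltr_pdivrMr// ; nra.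
by apply/eqP; rewrite -subr_eq0 -yE; apply/eqP; exact: dotvv_eq0.
Qed.

Lemma sym_eigenvalue_bounds n (C : 'M[R]_n.+1) m M (x : U n.+1) : C^T = C ->
  (forall l, eigenvalue C l -> m <= l <= M) ->
  m * dotv x x <= dotv (x *m C) x <= M * dotv x x.
Proof.
move=> Cs h; have d0 := dotvv_ge0 x.
have [l /h/andP[_ lM] hl] := sym_max_eigenvalue Cs.
have [|k ek hk] := @sym_max_eigenvalue n (- C); first by rewrite linearN/= Cs.
have /h/andP[mk _] : eigenvalue C (- k).
  have /eigenvalueP[v vk v0] := ek; apply/eigenvalueP; exists v => //.
  by rewrite scaleNr -vk mulmxN opprK.
rewrite (le_trans (hl x)) ?ler_wpM2r// andbT.
have := hk x; rewrite mulmxN -scaleN1r dotvZl mulN1r.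
nra.
Qed.

End matrices.

(** * Splines *)

Section splines.
Context {R : realType} {n' : nat}.
Local Notation n := n'.+1.
Local Notation U := 'rV[R]_n.
Local Notation mu := (lebesgue_rV R n).
Variables (Omega : set U) (d : nat) (T : seq 'M[R]_(n.+1, n)) (b : R).
Hypothesis dom : meshed Omega T b.
Local Notation Omega' := (Omega `\` facets T).
Local Notation spline := (spline_space Omega d T).

Lemma poly_le_sm (p : U -> R) : poly_le d p -> sm p.
Proof.
move=> [c pc].
pose s := [seq a : {ffun 'I_n -> 'I_d.+1} <- index_enum _ | (\sum_i a i <= d)%N].
rewrite (_ : p = fun x => \sum_(a <- s) c a * \prod_i x ord0 i ^+ (a i)).
  apply: sm_sum => a; apply: sm_mul; first exact: sm_cst.
  by apply: sm_prod => i; apply: sm_exp; exact: sm_coord.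
by apply/funext => x; rewrite pc big_filter.
Qed.

Lemma spline_C1 v : spline v -> C1_on Omega v.
Proof. by case. Qed.

Lemma spline_pw v : spline v -> pw T (closure Omega) v.
Proof.
move=> [_ vp].
have h A : exists p : U -> R, A \in T -> sm p /\ {in simplex A, v =1 p}.
  have [AT|nAT] := boolP (A \in T); last by exists v.
  by have [p pp pv] := vp A AT; exists p => _; split=> //; exact: poly_le_sm.
have [P hP] := choice h.
exists P => A AT; have [sP vP] := hP A AT; split=> // x _ Ax.
by apply: vP; exact: mem_set.
Qed.

Lemma spline_pw_Omega v : spline v -> pw T Omega v.
Proof. by move=> /spline_pw; apply: pwW; exact: subset_closure. Qed.

Lemma spline_pw' v : spline v -> pw T Omega' v.
Proof. by move=> /spline_pw_Omega; apply: pwW => x []. Qed.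

Lemma spline_partial v i : spline v -> pw T Omega' (partial i v).
Proof. by move=> sv; apply: pw_partial dom _ _ _; exact: spline_pw'. Qed.

Lemma spline_partial2 v i j : spline v -> pw T Omega' (partial i (partial j v)).
Proof. by move=> sv; apply: pw_partial dom _ _ _; exact: spline_partial. Qed.

Lemma poly_leD (p q : U -> R) (c : R) : poly_le d p -> poly_le d q ->
  poly_le d (fun x => p x + c * q x).
Proof.
move=> [a pa] [e qe]; exists (fun k => a k + c * e k) => x.
rewrite pa qe mulr_sumr -big_split/=; apply: eq_bigr => k _.
by rewrite mulrDl mulrA.
Qed.

Lemma derivable_scaled_add (v w : U -> R) (c : R) x u : derivable v x u ->
  derivable w x u -> derivable (fun x => v x + c * w x) x u /\
  'D_u (fun x => v x + c * w x) x = 'D_u v x + c * 'D_u w x.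
Proof.
move=> dv dw; have dc : derivable (c *: w) x u by exact: derivableZ.
by split; [exact: (derivableD dv dc)|rewrite (deriveD dv dc) deriveZ].
Qed.

Lemma C1_onD (v w : U -> R) (c : R) i x : C1_on Omega v -> C1_on Omega w -> Omega x ->
  partial i (fun x => v x + c * w x) x = partial i v x + c * partial i w x.
Proof.
move=> Cv Cw Ox; have [dv _] := Cv x Ox i; have [dw _] := Cw x Ox i.
by have [] := derivable_scaled_add c dv dw.
Qed.

Lemma splineD v w (c : R) : spline v -> spline w -> spline (fun x => v x + c * w x).
Proof.
move=> [Cv vp] [Cw wp]; split.
  move=> x Ox i; have [dv cv] := Cv x Ox i; have [dw cw] := Cw x Ox i.
  split; first by have [] := derivable_scaled_add c dv dw.
  apply: (@near_eq_continuous _ _ (fun x => partial i v x + c * partial i w x)).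
    have : nbhs x Omega by apply: open_nbhs_nbhs; split => //; exact: mesh_open dom.
    by apply: filterS => y Oy; rewrite C1_onD.
  exact: continuousD cv (continuousM (@cst_continuous _ _ c x) cw).
move=> A AT; have [p pp vP] := vp A AT; have [q qq wq] := wp A AT.
exists (fun x => p x + c * q x); first exact: poly_leD.
by move=> x Ax; rewrite vP// wq.
Qed.

Definition spline_vanishing (w : U -> R) :=
  spline w /\ forall x, boundary Omega x -> w x = 0.

Lemma spline_vanishingD v w (c : R) : spline_vanishing v -> spline_vanishing w ->
  spline_vanishing (fun x => v x + c * w x).
Proof.
move=> [sv v0] [sw w0]; split; first exact: splineD.
by move=> x bx; rewrite v0// w0// mulr0 addr0.
Qed.

Lemma near_Omega' x : Omega' x -> \forall y \near x, Omega' y.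
Proof.
by move=> Ox; apply: open_nbhs_nbhs; split => //; exact: open_Omega' dom.
Qed.

Lemma vanishing_ext w : spline_vanishing w -> exists L C : R, [/\ 0 <= L, 0 <= C,
  lipschitz_rV L (zext Omega w) & forall x, `|zext Omega w x| <= C].
Proof.
move=> [/spline_pw pw w0].
have [L L0 hL] := pw_lipschitz dom (@subset_refl _ _) (closure_star_convex dom) pw.
have [C C0 hC] := pw_bounded dom (@subset_refl _ _) pw.
exists L, C; split => //; first exact: zext_lipschitz dom _ _ L0 hL w0.
move=> x; have [Ox|nOx] := pselect (Omega x).
  by rewrite zextE//; apply: hC; exact: subset_closure.
by rewrite zext0// normr0.
Qed.

Lemma zext_pw' w : spline w -> pw T Omega' (zext Omega w).
Proof. by move=> sw; apply: eq_pw (spline_pw' sw) => x [Ox _]; rewrite zextE. Qed.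

(** The derivative is Lipschitz on the convex domain, then extended; the bound [C] is kept on the
    domain only, which is all that [lipschitz_rVM] asks of its first factor. *)
Lemma partial_ext v i : spline v -> exists F (L C : R), [/\ 0 <= L, 0 <= C, lipschitz_rV L F,
  forall x, Omega x -> `|F x| <= C & forall x, Omega x -> F x = partial i v x].
Proof.
move=> sv.
have pv : pw T Omega (partial i v).
  by apply: pw_partial_Omega dom _ _ _ _; [exact: spline_pw_Omega|exact: spline_C1].
have [L L0 hL] := pw_lipschitz dom (@subset_closure _ _) (mesh_convex dom) pv.
have [C C0 hC] := pw_bounded dom (@subset_closure _ _) pv.
have [F LF hF] := mcshane L0 (mesh_neq0 dom) hL.
by exists F, L, C; split => // x Ox; rewrite hF//; exact: hC.
Qed.

Lemma near_partial_Omega' (f g : U -> R) i x : (forall y, Omega' y -> f y = g y) ->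
  Omega' x -> partial i f x = partial i g x.
Proof.
move=> fg /near_Omega' Ox; apply: near_eq_derive.
by apply: filterS Ox => y; exact: fg.
Qed.

Lemma hess_sym v x : spline v -> Omega' x -> (hess v x)^T = hess v x.
Proof.
move=> sv Ox; apply/matrixP => i j; rewrite !mxE.
exact: pw_partialC dom _ _ _ _ (spline_pw' sv) Ox.
Qed.

(* The null Lagrangian [det (D f_1, .., D f_n)] for [f_k] the derivatives of [v], the
   [i]-th one being replaced by [psi] times the [i]-th derivative of [e]. *)
Lemma cof_row_integral v e psi i : spline v -> spline e -> spline_vanishing psi ->
  \int[mu]_(x in Omega') (\sum_j cofactor (hess v x) i j *
    (partial j (partial i e) x * psi x + partial i e x * partial j psi x)) = 0.
Proof.
move=> sv se Wpsi; have [Lp [Cp [Lp0 Cp0 hLp hCp]]] := vanishing_ext Wpsi.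
have [E [Le [Ce [Le0 Ce0 hLe hCe hE]]]] := partial_ext i se.
have h k : exists FL : (U -> R) * R, [/\ 0 <= FL.2, lipschitz_rV FL.2 FL.1 &
    forall x, Omega x -> FL.1 x = partial k v x].
  by have [F [L [C [L0 C0 hL hC hF]]]] := partial_ext k sv; exists (F, L).
have [FL hFL] := choice h.
pose f k : U -> R := if k == i then fun x => E x * zext Omega psi x else (FL k).1.
have Lpsi := lipschitz_rVM Le0 Lp0 Ce0 Cp0 hLe hLp hCe hCp (@zext0 _ _ _ psi).
have Lpsi0 : 0 <= Ce * Lp + Cp * Le by rewrite addr_ge0// mulr_ge0.
pose L := Ce * Lp + Cp * Le + \sum_k (FL k).2.
have FL0 k : 0 <= (FL k).2 by case: (hFL k).
have L0 : 0 <= L by rewrite addr_ge0// sumr_ge0.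
have fL k : lipschitz_rV L (f k).
  rewrite /f; case: ifP => _; first by apply: lipschitz_rVW Lpsi; rewrite lerDl sumr_ge0.
  have [_ hk _] := hFL k; apply: lipschitz_rVW hk.
  by rewrite /L (bigD1 k)//= addrCA lerDl addr_ge0// sumr_ge0.
have fi0 x : ~ Omega x -> f i x = 0 by move=> Ox; rewrite /f eqxx zext0// mulr0.
have fi x : Omega' x -> f i x = partial i e x * psi x.
  by move=> [Ox _]; rewrite /f eqxx zextE// hE.
have fk k x : k != i -> Omega' x -> f k x = partial k v x.
  by move=> /negbTE ki [Ox _]; rewrite /f ki; case: (hFL k) => _ _; exact.
have fpw k : pw T Omega' (f k).
  have [->|ki] := eqVneq k i.
    apply: (@eq_pw _ _ _ _ (fun x => partial i e x * psi x)); first by move=> x Ox; rewrite fi.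
    by apply: pwM; [exact: spline_partial|exact: spline_pw' Wpsi.1].
  apply: (@eq_pw _ _ _ _ (partial k v)); first by move=> x Ox; rewrite fk.
  exact: spline_partial.
rewrite -[RHS](integral_det_eq0 dom L0 fL fi0 fpw).
apply: eq_Rintegral => x /set_mem Ox.
(* The row [i] gives the product rule for [partial i e * psi]; its cofactors only see the other
   rows, which are rows of [hess v] up to the symmetry of second derivatives. *)
rewrite (expand_det_row _ i); apply: eq_bigr => j _; rewrite mulrC mxE; congr (_ * _).
  rewrite (near_partial_Omega' j fi Ox) partialM//.
    by apply: pw_derivable dom _ _ _ _ Ox; exact: spline_partial.
  by apply: pw_derivable dom _ _ _ _ Ox; exact: spline_pw' Wpsi.1.
rewrite /cofactor; congr (_ * \det _); apply/matrixP => k l; rewrite !mxE.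
have fk' y : Omega' y -> f (lift i k) y = partial (lift i k) v y.
  by apply: fk; rewrite eq_sym neq_lift.
rewrite (near_partial_Omega' _ fk' Ox).
exact: pw_partialC dom _ _ _ _ (spline_pw' sv) Ox.
Qed.

Lemma bmeas_spline v : spline v -> bmeas Omega' v.
Proof. by move=> sv; apply: pw_bmeas dom _ _; exact: spline_pw'. Qed.

Lemma bmeas_partial v i : spline v -> bmeas Omega' (partial i v).
Proof. by move=> sv; apply: pw_bmeas dom _ _; exact: spline_partial. Qed.

Lemma bmeas_hess v i j : spline v -> bmeas Omega' (fun x => hess v x i j).
Proof.
move=> sv; apply: eq_bmeas (pw_bmeas dom (spline_partial2 i j sv)).
by move=> x _; rewrite mxE.
Qed.

Lemma bmeas_cofactor v i j : spline v -> bmeas Omega' (fun x => cofactor (hess v x) i j).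
Proof.
move=> sv; apply: bmeasZ; apply: bmeas_det => k l.
apply: eq_bmeas (bmeas_hess (lift i k) (lift j l) sv).
by move=> x _; rewrite !mxE.
Qed.

Lemma bmeas_dotv (F G : U -> U) : (forall i, bmeas Omega' (fun x => F x ord0 i)) ->
  (forall i, bmeas Omega' (fun x => G x ord0 i)) ->
  bmeas Omega' (fun x => dotv (F x) (G x)).
Proof. by move=> bF bG; apply: bmeas_sum => i; exact: bmeasM. Qed.

Lemma bmeas_grad v i : spline v -> bmeas Omega' (fun x => grad v x ord0 i).
Proof.
by move=> sv; apply: eq_bmeas (bmeas_partial i sv) => x _; rewrite mxE.
Qed.

Lemma bmeas_flux v e i : spline v -> spline e ->
  bmeas Omega' (fun x => (grad e x *m (cofmx (hess v x))^T) ord0 i).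
Proof.
move=> sv se; apply: (@eq_bmeas _ _ _ _ (fun x => \sum_j grad e x ord0 j * cofactor (hess v x) i j)).
  by move=> x _; rewrite mxE; apply: eq_bigr => j _; rewrite !mxE.
by apply: bmeas_sum => j; apply: bmeasM; [exact: bmeas_grad|exact: bmeas_cofactor].
Qed.

Lemma bmeas_cof_sum v e : spline v -> spline e ->
  bmeas Omega' (fun x => cof_sum (hess v x) (hess e x)).
Proof.
move=> sv se; apply: bmeas_sum => i; apply: bmeas_sum => j.
by apply: bmeasM; [exact: bmeas_cofactor|exact: bmeas_hess].
Qed.

Let mO := measurable_Omega' dom.
Let Oy := Omega'_lty dom.

(** The sum over [i] of the row identities; the symmetry of both Hessians matches the indices and
    the transposed cofactor matrix. *)
Lemma cof_sum_integral v e psi : spline v -> spline e -> spline_vanishing psi ->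
  \int[mu]_(x in Omega') (cof_sum (hess v x) (hess e x) * psi x) =
  - \int[mu]_(x in Omega') dotv (grad e x *m (cofmx (hess v x))^T) (grad psi x).
Proof.
move=> sv se Wpsi.
have bf i j : bmeas Omega' (fun x => cofactor (hess v x) i j *
    (partial j (partial i e) x * psi x + partial i e x * partial j psi x)).
  apply: bmeasM; first exact: bmeas_cofactor.
  apply: bmeasD; apply: bmeasM; try exact: bmeas_partial.
  - by apply: pw_bmeas dom _ _; exact: spline_partial2.
  - exact: bmeas_spline Wpsi.1.
  - exact: bmeas_partial Wpsi.1.
have : \int[mu]_(x in Omega') (\sum_i \sum_j cofactor (hess v x) i j *
    (partial j (partial i e) x * psi x + partial i e x * partial j psi x)) = 0.
  rewrite bRintegral_sum//; last by move=> i; apply: bmeas_sum.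
  by rewrite big1// => i _; exact: cof_row_integral.
move=> h; apply/eqP; rewrite -addr_eq0 -bRintegralD//.
- rewrite -[X in _ == X]h; apply/eqP; apply: eq_Rintegral => x /set_mem Ox.
  rewrite (cofmx_sym (hess_sym sv Ox)) dotv_mulmx /cof_sum /dotv.
  rewrite mulr_suml -big_split/=; apply: eq_bigr => i _.
  rewrite !mxE mulr_suml mulr_sumr -big_split/=; apply: eq_bigr => j _.
  rewrite !mxE (pw_partialC dom i j (spline_pw' se) Ox).
  move: (cofactor _ _ _) (partial _ _ _) (partial _ _ _) (partial _ _ _) => p q r s.
  by ring.
- by apply: bmeasM; [exact: bmeas_cof_sum|exact: bmeas_spline Wpsi.1].
- apply: bmeas_dotv => i; first exact: bmeas_flux.
  exact: bmeas_grad Wpsi.1.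
Qed.

(* The integral of the first partial derivative of [x_1 w^2] vanishes. *)
Lemma poincare w : spline_vanishing w ->
  \int[mu]_(x in Omega') w x ^+ 2 <= 4 * b ^+ 2 * \int[mu]_(x in Omega') dotv (grad w x) (grad w x).
Proof.
move=> Ww; have [L [C [L0 C0 hL hC]]] := vanishing_ext Ww.
have b0 := ltW (mesh_bound_gt0 dom).
pose z := zext Omega w.
have hx : lipschitz_rV 1 (fun x : U => x ord0 ord0).
  by move=> x y; rewrite mul1r; have := normr_coord (x - y) ord0; rewrite !mxE.
have xb (x : U) : Omega x -> `|x ord0 ord0| <= b.
  by move=> Ox; rewrite ltW// (mesh_bound dom)//; exact: subset_closure.
have z0 x : ~ Omega x -> z x = 0 by exact: zext0.
have h1 := lipschitz_rVM ler01 L0 b0 C0 hx hL xb hC z0.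
have bC (x : U) : `|x ord0 ord0 * z x| <= b * C.
  have [Ox|nOx] := pselect (Omega x); first by rewrite normrM ler_pM// xb.
  by rewrite z0// mulr0 normr0 mulr_ge0.
have bC0 : 0 <= b * C by rewrite mulr_ge0.
have bL0 : 0 <= b * L + C * 1 by rewrite addr_ge0 ?mulr_ge0.
have xz0 (x : U) : ~ Omega x -> x ord0 ord0 * z x = 0 by move=> Ox; rewrite z0// mulr0.
have h2 := lipschitz_rVM L0 bL0 C0 bC0 hL h1 (fun x (_ : Omega x) => hC x) bC xz0.
set L2 := (X in lipschitz_rV X _) in h2.
have L20 : 0 <= L2 by rewrite addr_ge0// mulr_ge0.
have sc : sm (fun x : U => x ord0 ord0) by exact: sm_coord.
have pz : pw T Omega' z by exact: zext_pw' Ww.1.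
have pf : pw T Omega' (fun x => z x * (x ord0 ord0 * z x)).
  by apply: pwM => //; apply: pwM => //; exact: pw_sm.
have I0 := integral_partial_eq0 dom ord0 L20 h2 (fun x nOx => etrans (congr1 (fun t => t * _) (z0 x nOx)) (mul0r _)) pf.
have dz x : Omega' x -> derivable z x (basis_vec R ord0).
  by move=> Ox; exact: pw_derivable dom _ _ _ pz Ox.
have bw := bmeas_spline Ww.1; have bp := bmeas_partial ord0 Ww.1.
have bx : bmeas Omega' (fun x : U => x ord0 ord0).
  by apply: pw_bmeas dom _ _; exact: pw_sm.
have E x : Omega' x -> partial ord0 (fun x => z x * (x ord0 ord0 * z x)) x =
    w x ^+ 2 + 2 * x ord0 ord0 * w x * partial ord0 w x.
  move=> Ox.
  have zw y : Omega' y -> z y = w y by move=> [Oy' _]; exact: zextE.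
  rewrite partialM; [|exact: dz|]; last first.
    by apply: derivableM; [exact: sm_derivable|exact: dz].
  rewrite partialM; [|exact: sm_derivable|exact: dz].
  rewrite partial_coord eqxx (near_partial_Omega' _ zw Ox) zw//.
  by rewrite (_ : true%:R = 1 :> R)//; move: (partial _ _ _) => p; ring.
have bI : bmeas Omega' (fun x => w x ^+ 2 + 2 * x ord0 ord0 * w x * partial ord0 w x).
  apply: bmeasD; first exact: bmeas_sqr.
  by apply: bmeasM => //; apply: bmeasM => //; apply: bmeasM => //; exact: bmeas_cst.
have {}I0 : \int[mu]_(x in Omega') (w x ^+ 2 + 2 * x ord0 ord0 * w x * partial ord0 w x) = 0.
  by rewrite -[RHS]I0; apply: eq_Rintegral => x /set_mem Ox; rewrite E.
have bw2 := bmeas_sqr bw.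
have bg : bmeas Omega' (fun x => dotv (grad w x) (grad w x)).
  by apply: bmeas_dotv => i; exact: bmeas_grad Ww.1.
(* Pointwise this is [(w + 2 x_1 p)^2 >= 0] with [p] the first partial derivative, halved, together
   with [|x_1| <= b] and [p^2 <= |Dw|^2]. *)
have : \int[mu]_(x in Omega') (2^-1 * w x ^+ 2 - 2 * b ^+ 2 * dotv (grad w x) (grad w x)) <=
  \int[mu]_(x in Omega') (w x ^+ 2 + 2 * x ord0 ord0 * w x * partial ord0 w x).
  apply: le_bRintegral => //; first by apply: bmeasB; exact: bmeasZ.
  move=> x [Ox _].
  have : (partial ord0 w x) ^+ 2 <= dotv (grad w x) (grad w x).
    rewrite /dotv (bigD1 ord0)//= !mxE -expr2 lerDl sumr_ge0// => i _.
    by rewrite -expr2 sqr_ge0.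
  have := xb x Ox; rewrite ler_norml.
  move: (dotv _ _) (partial _ _ _) (x ord0 ord0) (w x) => D p t s /andP[t1 t2] pD.
  have tb : t ^+ 2 <= b ^+ 2 by nra.
  have h3 : 0 <= (s + 2 * t * p) ^+ 2 by exact: sqr_ge0.
  have h4 : t ^+ 2 * p ^+ 2 <= b ^+ 2 * p ^+ 2 by rewrite ler_wpM2r// sqr_ge0.
  have h5 : b ^+ 2 * p ^+ 2 <= b ^+ 2 * D by rewrite ler_wpM2l// sqr_ge0.
  have h6 : 0 <= s ^+ 2 + 4 * t * p * s + 4 * (t ^+ 2 * p ^+ 2).
    by move: h3; congr (0 <= _); ring.
  have -> : 2 * b ^+ 2 * D = 2 * (b ^+ 2 * D) by ring.
  have -> : 2 * t * s * p = 2^-1 * (4 * t * p * s) by field.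
  lra.
rewrite I0 bRintegralB//; [|exact: bmeasZ..].
rewrite !bRintegralZ//; lra.
Qed.

End splines.

(** * First order Sobolev norms *)

Section first_order_norms.
Context {R : realType} {n' : nat}.
Local Notation n := n'.+1.
Local Notation U := 'rV[R]_n.
Local Notation mu := (lebesgue_rV R n).

(** The Sobolev norms sum over multi-indices encoded as functions into ['I_2]; those of order one
    are reindexed by the coordinate they single out. *)
Definition unit_index (i : 'I_n) : {ffun 'I_n -> 'I_2} := [ffun j => inord (j == i)].

Lemma unit_indexE i j : unit_index i j = (j == i) :> nat.
Proof. by rewrite ffunE inordK//; case: (_ == _). Qed.

Lemma unit_indexP (a : {ffun 'I_n -> 'I_2}) :
  Defs.order (fun i => nat_of_ord (a i)) == 1%N ->
  unit_index (odflt ord0 [pick i | a i != ord0]) = a.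
Proof.
rewrite /Defs.order => a1.
case: pickP => [i ai|h]; last first.
  by move: a1; rewrite big1// => i _; have := h i; case: eqP => // ->.
have ai1 : a i = 1%N :> nat by move: ai (ltn_ord (a i)); rewrite -val_eqE/=; case: (nat_of_ord (a i)) => [|[]].
move: a1; rewrite (bigD1 i)//= ai1 add1n eqSS sum_nat_eq0 => /forallP a0.
apply/ffunP => j; apply/val_inj => /=; rewrite unit_indexE.
by have [->|ji] := eqVneq j i; [rewrite ai1|have /implyP/(_ ji)/eqP -> := a0 j].
Qed.

Lemma order_unit_index i : Defs.order (fun j => nat_of_ord (unit_index i j)) = 1%N.
Proof.
rewrite /Defs.order (bigD1 i)//= unit_indexE eqxx big1// => j ji.
by rewrite unit_indexE (negbTE ji).
Qed.

Lemma pderiv_unit_index i (f : U -> R) :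
  pderiv (fun j => nat_of_ord (unit_index i j)) f = partial i f.
Proof.
rewrite /pderiv (_ : flatten _ = [:: i])//.
transitivity (flatten [seq if j == i then [:: j] else [::] | j <- enum 'I_n]).
  by congr flatten; apply: eq_map => j; rewrite unit_indexE; case: (_ == _).
have : uniq (enum 'I_n) by exact: enum_uniq.
have : i \in enum 'I_n by rewrite mem_enum.
elim: (enum _) => //= a s IH; rewrite inE => + /andP[aNs us].
have [ai _|ai] := eqVneq a i.
  rewrite ai (_ : flatten _ = [::])//; move: aNs; rewrite ai.
  elim: s {IH us} => //= c s IH; rewrite inE negb_or eq_sym => /andP[/negbTE -> /IH].
  exact.
by move=> /= si; exact: IH.
Qed.

Lemma pderiv_zero (a : {ffun 'I_n -> 'I_2}) (f : U -> R) :
  Defs.order (fun i => nat_of_ord (a i)) = 0%N -> pderiv (fun j => nat_of_ord (a j)) f = f.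
Proof.
move=> /eqP; rewrite /Defs.order sum_nat_eq0 => /forallP a0.
rewrite /pderiv; elim: (enum _) => //= i s IH.
by have /eqP -> := a0 i.
Qed.

Lemma big_multi_indices (P : pred nat) (F : ('I_n -> nat) -> \bar R) :
  (\sum_(a <- [seq a <- multi_indices n 1 | P (Defs.order a)]) F a =
   \sum_(a : {ffun 'I_n -> 'I_2} | P (Defs.order (fun i => nat_of_ord (a i))))
      F (fun i => nat_of_ord (a i)))%E.
Proof. by rewrite big_filter /multi_indices big_image_cond; apply: eq_bigl => a. Qed.

Lemma big_order1 (F : ('I_n -> nat) -> \bar R) :
  (\sum_(a <- [seq a <- multi_indices n 1 | Defs.order a == 1%N]) F a =
   \sum_i F (fun j => nat_of_ord (unit_index i j)))%E.
Proof.
rewrite (big_multi_indices (fun k => k == 1%N)).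
rewrite (reindex_onto unit_index (fun a => odflt ord0 [pick i | a i != ord0])) /=; last first.
  by move=> a; exact: unit_indexP.
apply: eq_bigl => i; rewrite order_unit_index eqxx/=.
case: pickP => [j|/(_ i)]; last by rewrite -val_eqE/= unit_indexE eqxx.
by rewrite -val_eqE/= unit_indexE; case: (j == i).
Qed.

Lemma big_order_le1 (F : ('I_n -> nat) -> \bar R) :
  (\sum_(a <- [seq a <- multi_indices n 1 | (Defs.order a <= 1)%N]) F a =
   F (fun i => nat_of_ord (([ffun=> ord0] : {ffun 'I_n -> 'I_2}) i)) +
   \sum_i F (fun j => nat_of_ord (unit_index i j)))%E.
Proof.
rewrite (big_multi_indices (fun k => k <= 1)%N) (bigD1 [ffun=> ord0]) /=; last first.
  by rewrite /Defs.order big1// => i _; rewrite ffunE.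
congr (_ + _)%E; rewrite -big_order1 (big_multi_indices (fun k => k == 1%N)).
apply: eq_bigl => a; rewrite leq_eqVlt ltnS leqn0 andb_orl.
have -> : (Defs.order (fun i => nat_of_ord (a i)) == 0%N) = (a == [ffun=> ord0]).
  rewrite /Defs.order sum_nat_eq0; apply/forallP/eqP => [h|-> i]; last by rewrite ffunE.
  by apply/ffunP => i; rewrite ffunE; apply/val_inj/eqP; exact: (h i).
rewrite andbN orbF; have [/= a1|//] := boolP (_ == 1%N).
apply/eqP => a0; move: a1; rewrite /Defs.order big1// => i _.
by rewrite a0 ffunE.
Qed.

Variables (Omega : set U) (T : seq 'M[R]_(n.+1, n)) (b : R).
Hypothesis dom : meshed Omega T b.
Local Notation Omega' := (Omega `\` facets T).
Let mO := measurable_Omega' dom.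
Let Oy := Omega'_lty dom.

Lemma Lp_norm_sqr (f : U -> R) : bmeas Omega' f ->
  (Lp_norm 2%:E Omega f `^ 2 = (\int[mu]_(x in Omega') (f x ^+ 2))%:E)%E.
Proof.
move=> bf; rewrite /Lp_norm poweR_Lnorm//.
have bf2 := bmeas_sqr bf.
rewrite -EFin_bRintegral// -(integral_Omega' dom) [RHS]integral_mkcond.
apply: eq_integral => x _; rewrite /= patchE /patch.
case: ifP => _; last by rewrite normr0 powR0.
by rewrite powR_mulrn// -normrX ger0_norm// sqr_ge0.
Qed.

Lemma sum_sqr_partial (f : U -> R) : (forall i, bmeas Omega' (partial i f)) ->
  \sum_i \int[mu]_(x in Omega') (partial i f x ^+ 2) =
  \int[mu]_(x in Omega') dotv (grad f x) (grad f x).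
Proof.
move=> bf; rewrite -bRintegral_sum//; last by move=> i; exact: bmeas_sqr.
by apply: eq_Rintegral => x _; apply: eq_bigr => i _; rewrite !mxE.
Qed.

Lemma H1_seminormE (f : U -> R) : (forall i, bmeas Omega' (partial i f)) ->
  H1_seminorm Omega f =
  (Num.sqrt (\int[mu]_(x in Omega') dotv (grad f x) (grad f x)))%:E.
Proof.
move=> bf; rewrite /H1_seminorm /sob_seminorm /sob_norm_of /= cats0 big_map.
rewrite big_order1 -sum_sqr_partial//.
rewrite (eq_bigr (fun i => (\int[mu]_(x in Omega') (partial i f x ^+ 2))%:E)).
  rewrite sumEFin poweR12_sqrt// lee_fin sumr_ge0// => i _.
  by apply: Rintegral_ge0 => x _; exact: sqr_ge0.
by move=> i _; rewrite /jet pderiv_unit_index Lp_norm_sqr.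
Qed.

Lemma H1_normE (f : U -> R) : bmeas Omega' f -> (forall i, bmeas Omega' (partial i f)) ->
  H1_norm Omega f =
  (Num.sqrt (\int[mu]_(x in Omega') (f x ^+ 2) +
             \int[mu]_(x in Omega') dotv (grad f x) (grad f x)))%:E.
Proof.
move=> bf bp; rewrite /H1_norm /sob_norm /sob_norm_of /= cats0 big_map.
rewrite big_order_le1 -sum_sqr_partial//.
rewrite (eq_bigr (fun i => (\int[mu]_(x in Omega') (partial i f x ^+ 2))%:E)).
  rewrite /jet pderiv_zero; last by rewrite /Defs.order big1// => i _; rewrite ffunE.
  rewrite Lp_norm_sqr// sumEFin -EFinD poweR12_sqrt// lee_fin addr_ge0// ?sumr_ge0//.
    by apply: Rintegral_ge0 => x _; exact: sqr_ge0.
  by move=> i _; apply: Rintegral_ge0 => x _; exact: sqr_ge0.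
by move=> i _; rewrite /jet pderiv_unit_index Lp_norm_sqr.
Qed.

End first_order_norms.

(** * Density of test functions *)

Section smooth_step.
Context {R : realType}.
Implicit Types s t : R.

(** The usual smooth transition from [0] on [t <= 0] to [1] on [t >= 1]. *)
Definition step (t : R) := flat 0 t * (flat 0 t + flat 0 (1 - t))^-1.

Lemma step_den_gt0 t : 0 < flat 0 t + flat 0 (1 - t).
Proof.
have [t0|t0] := ltP 0 t; first by rewrite ltr_pwDl ?flat_gt0 ?flat_ge0.
by rewrite ltr_wpDl ?flat_ge0// flat_gt0//; lra.
Qed.

Lemma step_den_ge t : 0 <= t <= 1 -> expR (- 2) <= flat 0 t + flat 0 (1 - t).
Proof.
have h (s : R) : 2^-1 <= s -> expR (- 2) <= flat 0 s.
  move=> s2; have s0 : 0 < s by apply: lt_le_trans s2; rewrite invr_gt0.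
  rewrite /flat s0 expr0 mul1r ler_expR lerN2 -[2]invrK lef_pV2// posrE invr_gt0//.
move=> t01; have [t2|t2] := leP 2^-1 t.
  by rewrite -[leLHS]addr0 lerD ?h ?flat_ge0.
rewrite -[leLHS]add0r lerD ?flat_ge0// h//.
have : (2^-1 : R) + 2^-1 = 1 by field.
by lra.
Qed.

Lemma step_le0 t : t <= 0 -> step t = 0.
Proof. by move=> t0; rewrite /step flat_le0// mul0r. Qed.

Lemma step_ge1 t : 1 <= t -> step t = 1.
Proof.
move=> t1; rewrite /step (@flat_le0 _ _ (1 - t)) ?subr_le0// addr0 divff// gt_eqF//.
by rewrite flat_gt0//; lra.
Qed.

Lemma step_itv t : 0 <= step t <= 1.
Proof.
have D0 := step_den_gt0 t.
rewrite /step divr_ge0 ?flat_ge0 ?(ltW D0)//= ler_pdivrMr// mul1r.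
by rewrite lerDl flat_ge0.
Qed.

(** The derivative of [step], by the quotient rule and the fact that [flat 2] is the derivative of
    [flat 0]. *)
Definition dstep (t : R) :=
  (flat 2 t * flat 0 (1 - t) + flat 0 t * flat 2 (1 - t)) *
  ((flat 0 t + flat 0 (1 - t))^-1 * (flat 0 t + flat 0 (1 - t))^-1).

(** On [[0, 1]] one has [flat 0 <= 1] and [flat 2 <= 3^3 = 27], so the numerator is at most [54];
    the denominator is at least [exp (- 2)], one of [t] and [1 - t] being at least [1 / 2]. *)
Lemma dstep_bounded : exists2 C : R, 0 <= C & forall t, `|dstep t| <= C.
Proof.
pose e : R := (expR (- 2))^-1.
have e0 : 0 < e by rewrite invr_gt0 expR_gt0.
exists (54 * (e * e)) => [|t]; first by rewrite !mulr_ge0 ?ltW.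
have D0 := step_den_gt0 t.
rewrite ger0_norm; last first.
  by rewrite mulr_ge0 ?addr_ge0 ?mulr_ge0 ?flat_ge0 ?invr_ge0 ?(ltW D0).
have [t0|t0] := ltP t 0.
  by rewrite /dstep !(@flat_le0 _ _ t) ?ltW// !mul0r addr0 mul0r !mulr_gt0.
have [t1|t1] := ltP 1 t.
  rewrite /dstep !(@flat_le0 _ _ (1 - t)) ?subr_le0 ?ltW// !mulr0 addr0 mul0r.
  by rewrite !mulr_gt0.
have b0 s : 0 <= s <= 1 -> flat 0 s <= 1.
  move=> /andP[s0 s1]; apply: le_trans (ler_norm _) _.
  by apply: le_trans (flat_bound 0 s) _; rewrite expr1 mul1r ger0_norm.
have b2 s : 0 <= s <= 1 -> flat 2 s <= 27.
  move=> /andP[s0 s1]; apply: le_trans (ler_norm _) _.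
  apply: le_trans (flat_bound 2 s) _; rewrite ger0_norm// -natrX.
  by rewrite ler_piMr.
have t01 : 0 <= t <= 1 by rewrite t0.
have s01 : 0 <= 1 - t <= 1 by apply/andP; split; lra.
have DE : (flat 0 t + flat 0 (1 - t))^-1 <= e.
  by rewrite lef_pV2 ?posrE ?expR_gt0//; exact: step_den_ge.
apply: ler_pM.
- by rewrite addr_ge0// mulr_ge0 ?flat_ge0.
- by rewrite mulr_ge0// invr_ge0 ltW.
- have := b0 _ t01; have := b0 _ s01; have := b2 _ t01; have := b2 _ s01.
  have := flat_ge0 0 t; have := flat_ge0 0 (1 - t).
  have := flat_ge0 2 t; have := flat_ge0 2 (1 - t).
  move: (flat 0 t) (flat 0 (1 - t)) (flat 2 t) (flat 2 (1 - t)) => p q r s *.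
  have : r * q <= 27 * 1 by apply: ler_pM.
  have : p * s <= 1 * 27 by apply: ler_pM.
  by lra.
- by apply: ler_pM => //; rewrite invr_ge0 ltW.
Qed.

Context {n : nat}.
Local Notation U := 'rV[R]_n.

Lemma sm_step (f : U -> R) : sm f -> sm (fun x => step (f x)).
Proof.
move=> sf; have s1 : sm (fun x => flat 0 (f x)) by exact: sm_flat.
have s2 : sm (fun x => flat 0 (1 - f x)).
  by apply: sm_flat; apply: sm_sub => //; exact: sm_cst.
apply: sm_mul => //; apply: sm_inv; first exact: sm_add.
by move=> x; rewrite gt_eqF// step_den_gt0.
Qed.

Lemma partial_step (f : U -> R) i x : sm f ->
  partial i (fun x => step (f x)) x = dstep (f x) * partial i f x.
Proof.
move=> sf; have s1 : sm (fun x => flat 0 (f x)) by exact: sm_flat.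
have sm1 : sm (fun x => 1 - f x) by apply: sm_sub => //; exact: sm_cst.
have s2 : sm (fun x => flat 0 (1 - f x)) by exact: sm_flat.
have sD := sm_add s1 s2.
have D0 y : flat 0 (f y) + flat 0 (1 - f y) != 0 by rewrite gt_eqF// step_den_gt0.
have p1 := partial_cst_sub 1 i x sf.
rewrite /step (partial_smM i s1 (sm_inv sD D0)) (partial_inv i sD D0) (partial_smD i s1 s2).
rewrite (partial_flat 0 i sf) (partial_flat 0 i sm1) p1 /dstep mulNr !mul0r !oppr0 !addr0.
have := D0 x; move: (flat 0 (f x)) (flat 0 (1 - f x)) (flat 2 (f x)) (flat 2 (1 - f x)) (partial i f x).
by move=> p q r s D pq0; field.
Qed.

(** Polynomials do not have compact support: this factor truncates them away from the cube of
    half-side [b], where it equals [1]. *)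
Definition box_cutoff (b : R) (x : U) : R :=
  \prod_i step (2 - x ord0 i * x ord0 i / b ^+ 2).

Lemma sm_box_cutoff b : sm (box_cutoff b).
Proof.
apply: sm_prod => i; apply: sm_step; apply: sm_sub; first exact: sm_cst.
by apply: sm_mul; [apply: sm_mul; exact: sm_coord|exact: sm_cst].
Qed.

Lemma box_cutoff_eq1 b (x : U) : 0 < b -> (forall i, `|x ord0 i| <= b) -> box_cutoff b x = 1.
Proof.
move=> b0 xb; rewrite /box_cutoff big1// => i _; apply: step_ge1.
suff : x ord0 i * x ord0 i / b ^+ 2 <= 1 by lra.
rewrite ler_pdivrMr ?exprn_gt0// mul1r -expr2 -real_normK ?num_real//.
by rewrite lerXn2r ?nnegrE ?(ltW b0).
Qed.

Lemma box_cutoff_eq0 b (x : U) : 0 < b -> ~ cube 0 (2 * b) x -> box_cutoff b x = 0.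
Proof.
move=> b0 /existsNP[i]; rewrite mxE subr0 => /negP; rewrite -ltNge => bx.
rewrite /box_cutoff (bigD1 i)//= step_le0 ?mul0r//.
suff : 2 <= x ord0 i * x ord0 i / b ^+ 2 by lra.
rewrite ler_pdivlMr ?exprn_gt0// -expr2 -[x ord0 i ^+ 2]real_normK ?num_real//.
by nra.
Qed.

End smooth_step.

(** * Distance to the complement of the domain *)

Section distance_to_complement.
Context {R : realType} {n : nat}.
Local Notation U := 'rV[R]_n.
Variables (Omega : set U) (y0 : U).
Hypothesis Oy0 : ~ Omega y0.

(** The point [y0] outside the domain ensures that the infimum is over a nonempty set. *)
Definition codist (x : U) : R := inf [set `|x - y| | y in ~` Omega].

Let codist0 x : [set `|x - y| | y in ~` Omega] !=set0.
Proof. by exists `|x - y0|; exists y0. Qed.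

Let codist_lb x : has_lbound [set `|x - y| | y in ~` Omega].
Proof. by exists 0 => _ [y _ <-]. Qed.

Lemma codist_le x y : ~ Omega y -> codist x <= `|x - y|.
Proof. by move=> Oy; apply: ge_inf => //; exists y. Qed.

Lemma codist_ge c x : (forall y, ~ Omega y -> c <= `|x - y|) -> c <= codist x.
Proof. by move=> h; apply: lb_le_inf => // _ [y Oy <-]; exact: h. Qed.

Lemma codist_ge0 x : 0 <= codist x.
Proof. exact: codist_ge. Qed.

Lemma codist_lipschitz : lipschitz_rV 1 codist.
Proof.
have h x y : codist x - codist y <= `|x - y|.
  rewrite lerBlDr -lerBlDl; apply: codist_ge => z Oz.
  rewrite lerBlDl; apply: le_trans (codist_le x Oz) _.
  exact: ler_distD.
by move=> x y; rewrite mul1r ler_norml h andbT lerNl opprB distrC h.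
Qed.

Lemma codist_eq0 x : ~ Omega x -> codist x = 0.
Proof.
move=> Ox; apply/eqP; rewrite eq_le codist_ge0 andbT.
by apply: le_trans (codist_le x Ox) _; rewrite subrr normr0.
Qed.

Lemma codist_gt0 x : open Omega -> Omega x -> 0 < codist x.
Proof.
move=> Oo Ox; have [e /= e0 eO] : nbhs_ball x Omega.
  by apply/nbhs_ballP; exact: open_nbhs_nbhs.
apply: lt_le_trans e0 _; apply: codist_ge => y Oy.
by rewrite leNgt; apply/negP => xy; apply: Oy; apply: eO; rewrite -ball_normE.
Qed.

Lemma lipschitz_le_codist L w x : 0 <= L -> lipschitz_rV L w ->
  (forall y, ~ Omega y -> w y = 0) -> `|w x| <= L * codist x.
Proof.
move=> L0 Lw w0; have h y : ~ Omega y -> `|w x| <= L * `|x - y|.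
  by move=> Oy; rewrite -[w x]subr0 -(w0 y Oy).
move: L0; rewrite le_eqVlt => /predU1P[L0|L0].
  by rewrite -L0 mul0r; have := h _ Oy0; rewrite -L0 mul0r.
by rewrite mulrC -ler_pdivrMr//; apply: codist_ge => y /h; rewrite ler_pdivrMr// mulrC.
Qed.

End distance_to_complement.

Section density.
Context {R : realType} {n' : nat}.
Local Notation n := n'.+1.
Local Notation U := 'rV[R]_n.
Local Notation mu := (lebesgue_rV R n).
Variables (Omega : set U) (d : nat) (T : seq 'M[R]_(n.+1, n)) (b : R).
Hypothesis dom : meshed Omega T b.
Local Notation Omega' := (Omega `\` facets T).
Local Notation spline := (spline_space Omega d T).
Local Notation vanishing := (spline_vanishing Omega d T).
Let mO := measurable_Omega' dom.
Let Oy := Omega'_lty dom.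
Let b0 := mesh_bound_gt0 dom.

Lemma mesh_complement : ~ Omega (b *: const_mx 1).
Proof.
move=> Ob; have := mesh_bound dom (subset_closure Ob) ord0.
by rewrite !mxE mulr1 gtr0_norm// ltxx.
Qed.

Local Notation dist := (codist Omega).
Let dist_lip : lipschitz_rV 1 dist := codist_lipschitz mesh_complement.

Let c_gt0 : 0 < 2 * b. Proof. by rewrite mulr_gt0. Qed.

Lemma Omega_cube2 : Omega `<=` cube 0 (2 * b).
Proof.
move=> x /(Omega_cube dom) cx i; apply: le_trans (cx i) _.
by rewrite mulr2n mulrDl mul1r lerDl ltW.
Qed.

Lemma dist_continuous : continuous dist.
Proof. exact: lipschitz_continuous ler01 dist_lip. Qed.

(** The distance is not smooth, so it is replaced by a Bernstein polynomial [q] within [e / 2] of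
    it, whose derivatives are still bounded by [1]. In [step (q / e - 1)], distances below [e / 2]
    give [q <= e], distances above [3 e] give [q >= 2 e], and the chain rule costs a factor
    [1 / e]. *)
Lemma bern_cutoff : exists2 C : R, 0 <= C & forall e : R, 0 < e -> exists chi : U -> R,
  [/\ sm chi, forall x, 0 <= chi x <= 1,
  forall x, cube 0 (2 * b) x -> dist x < e / 2 -> chi x = 0,
  forall x, cube 0 (2 * b) x -> 3 * e < dist x -> chi x = 1 &
  forall i x, cube 0 (2 * b) x -> `|partial i chi x| <= C / e].
Proof.
have [C C0 hC] := @dstep_bounded R; exists C => // e e0.
have e2 : 0 < e / 2 by lra.
have [M _ hM'] := bern_uniform c_gt0 ler01 dist_lip e2.
pose q := bern (2 * b) M.+1 (fun=> M.+1) dist.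
have hM x : cube 0 (2 * b) x -> `|q x - dist x| <= e / 2 := hM' M (leqnn M) x.
have sq : sm q by exact: sm_bern.
have sqe : sm (fun x => q x * e^-1 - 1).
  by apply: sm_sub; [apply: sm_mul => //; exact: sm_cst|exact: sm_cst].
exists (fun x => step (q x * e^-1 - 1)); split.
- exact: sm_step.
- by move=> x; exact: step_itv.
- move=> x /hM; rewrite ler_norml => /andP[h1 h2] dx; apply: step_le0.
  by rewrite subr_le0 ler_pdivrMr// mul1r; lra.
- move=> x /hM; rewrite ler_norml => /andP[h1 h2] dx; apply: step_ge1.
  by rewrite lerBrDr ler_pdivlMr//; lra.
- move=> i x cx; rewrite partial_step// normrM.
  have -> : partial i (fun x => q x * e^-1 - 1) x = partial i q x * e^-1.
    have sc : sm (fun _ : U => - (1 : R)) by exact: sm_cst.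
    have se : sm (fun _ : U => e^-1) by exact: sm_cst.
    rewrite (partial_smD i (sm_mul sq se) sc) (partial_smM i sq se) !partial_cst.
    by rewrite mulr0 !addr0.
  rewrite [`|_ / e|]normrM [`|e^-1|]gtr0_norm ?invr_gt0//.
  apply: ler_pM => //; first by rewrite mulr_ge0// invr_ge0 ltW.
  rewrite ler_piMl ?invr_ge0 ?(ltW e0)//.
  exact: bern_grad_bound.
Qed.

(* The Bernstein polynomial of [w], cut off near the complement of the domain; the
   derivative of the cutoff, of size [1/e], only acts where [w] is of size [e]. *)
Lemma test_approximation w : vanishing w -> exists C : R, forall e : R, forall m : nat,
  0 < e <= 1 -> exists phi, [/\ test_function Omega phi, sm phi,
    forall x, Omega x -> `|phi x| <= C /\ forall i, `|partial i phi x| <= C,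
    forall x, Omega x -> 3 * e < dist x -> `|phi x - zext Omega w x| <= e &
    exists2 M, (m <= M)%N & forall x i, Omega x -> 3 * e < dist x ->
      partial i phi x = partial i (bern (2 * b) M.+1 (fun=> M.+1) (zext Omega w)) x].
Proof.
move=> Ww; have [L [C [L0 C0 hL hC]]] := vanishing_ext dom Ww.
have [Cs Cs0 hCs] := bern_cutoff.
(* [C + 1] bounds the values. For derivatives, the cutoff contributes [Cs / e] times
   [|p| <= (3 L + 1) e] in the layer where it varies, and the polynomial contributes [L]. *)
exists (C + 1 + ((3 * L + 1) * Cs + L)) => e m /andP[e0 e1].
have [chi [schi chi01 chi0 chi1 dchi]] := hCs e e0.
have [N _ hN'] := bern_uniform c_gt0 L0 hL e0.
(* [N] makes the polynomial accurate to [e]; [m] forces the degrees to infinity along a sequence of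
   approximations, for the convergence of gradients. *)
pose M := maxn m N.
pose p := bern (2 * b) M.+1 (fun=> M.+1) (zext Omega w).
have hN x : cube 0 (2 * b) x -> `|p x - zext Omega w x| <= e := hN' M (leq_maxr _ _) x.
have sp : sm p by exact: sm_bern.
pose phi x := chi x * (p x * box_cutoff b x).
have sphi : sm phi by apply: sm_mul => //; apply: sm_mul => //; exact: sm_box_cutoff.
have phiO x : Omega x -> phi x = chi x * p x.
  move=> Ox; rewrite /phi box_cutoff_eq1 ?mulr1// => i.
  by rewrite ltW// (mesh_bound dom)//; exact: subset_closure.
have nO x : Omega x -> nbhs x Omega.
  by move=> Ox; apply: open_nbhs_nbhs; split => //; exact: mesh_open dom.
have dphi x i : Omega x -> partial i phi x = partial i chi x * p x + chi x * partial i p x.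
  move=> Ox; rewrite -partialM; [|exact: sm_derivable..].
  by apply: near_eq_derive; apply: filterS (nO x Ox) => y; exact: phiO.
have dchi0 x i : Omega x -> 3 * e < dist x -> partial i chi x = 0.
  move=> Ox dx; rewrite -[RHS](_ : partial i (fun=> 1) x = 0); last by rewrite partial_cst.
  apply: near_eq_derive.
  have : \forall y \near x, 3 * e < dist y .
    have : nbhs (dist x) [set t : R | 3 * e < t].
      by apply: open_nbhs_nbhs; split => //; exact: open_gt.
    exact: dist_continuous.
  by apply: filterS2 (nO x Ox) => y Oy' dy; rewrite chi1//; exact: Omega_cube2.
have pC x : Omega x -> `|p x| <= C + e.
  move=> Ox; rewrite -[p x](subrK (zext Omega w x)); apply: le_trans (ler_normD _ _) _.
  by rewrite addrC lerD// hN//; exact: Omega_cube2.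
have pe x : Omega x -> dist x <= 3 * e -> `|p x| <= (3 * L + 1) * e.
  move=> Ox dx; rewrite -[p x](subrK (zext Omega w x)); apply: le_trans (ler_normD _ _) _.
  rewrite addrC mulrDl mul1r lerD//; last by rewrite hN//; exact: Omega_cube2.
  apply: le_trans (lipschitz_le_codist mesh_complement x L0 hL (@zext0 _ _ _ w)) _.
  by rewrite [3 * L]mulrC -mulrA ler_wpM2l.
have dp x i : Omega x -> `|partial i p x| <= L.
  by move=> Ox; apply: bern_grad_bound => //; exact: Omega_cube2.
have chiN x : `|chi x| <= 1 by have /andP[h1 h2] := chi01 x; rewrite ger0_norm.
have K0 : 0 <= (3 * L + 1) * Cs + L.
  by rewrite addr_ge0// mulr_ge0// addr_ge0// mulr_ge0.
exists phi; split => //.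
- split; first exact: sm_smooth.
  exists (cube 0 (2 * b) `&` [set x | e / 2 <= dist x]); split.
  + apply: compact_closedI; first exact: compact_cube0.
    rewrite (_ : [set x | _] = dist @^-1` [set t | e / 2 <= t])//.
    by apply: closed_comp => [x _|]; [exact: dist_continuous|exact: closed_ge].
  + move=> x [_ /= dx]; apply: contrapT => /(codist_eq0 mesh_complement) dx0.
    by move: dx; rewrite dx0; lra.
  + move=> x nK; have [cx|ncx] := pselect (cube 0 (2 * b) x).
      rewrite /phi chi0 ?mul0r// ltNge; apply/negP => dx.
      exact: nK.
    by rewrite /phi box_cutoff_eq0 ?mulr0.
- move=> x Ox; split.
    rewrite phiO// normrM; apply: (@le_trans _ _ (1 * (C + 1))); last by lra.
    by apply: ler_pM => //; apply: le_trans (pC x Ox) _; rewrite lerD2l.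
  move=> i; rewrite dphi//; apply: (@le_trans _ _ ((3 * L + 1) * Cs + L)); last by lra.
  apply: le_trans (ler_normD _ _) _; rewrite !normrM; apply: lerD; last first.
    by rewrite -[L]mul1r ler_pM// dp.
  have [dx|dx] := ltP (3 * e) (dist x).
    by rewrite dchi0// normr0 mul0r mulr_ge0// addr_ge0// mulr_ge0.
  rewrite (_ : _ * Cs = (Cs / e) * ((3 * L + 1) * e)); last by field; rewrite gt_eqF.
  by apply: ler_pM => //; [exact: dchi (Omega_cube2 Ox)|exact: pe].
- move=> x Ox dx; rewrite phiO// chi1// ?mul1r; last exact: Omega_cube2.
  by apply: hN; exact: Omega_cube2.
- exists M; first exact: leq_maxl.
  move=> x i Ox dx; rewrite dphi// dchi0// mul0r add0r chi1 ?mul1r//.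
  exact: Omega_cube2.
Qed.

(** The approximations with [e = 1 / (k + 1)] and their derivatives are uniformly bounded. They
    converge at each point off the facets, which eventually satisfies [3 e < dist x]; dominated
    convergence gives convergence in norm. *)
Lemma vanishing_in_H10 w : vanishing w -> in_H10 Omega w.
Proof.
move=> Ww; have [L [C0 [L0 _ hL _]]] := vanishing_ext dom Ww.
have [C hC] := test_approximation Ww.
have e_ok (k : nat) : 0 < (k.+1%:R : R)^-1 <= 1.
  by rewrite invr_gt0 ltr0n/= invf_le1 ?ltr0n// ler1n.
have [phi hphi] := choice (fun k => hC _ k (e_ok k)).
have sw := Ww.1; have bw := bmeas_spline dom sw.
have [Cw hCw] := bw.2.
have pz : pw T Omega' (zext Omega w) by exact: zext_pw' sw.
have zw y : Omega' y -> zext Omega w y = w y by move=> [Oy' _]; exact: zextE.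
have bdw : forall i, exists c, forall x, Omega' x -> `|partial i w x| <= c.
  by move=> i; have [_ []] := bmeas_partial dom i sw => c hc; exists c.
have [Cd hCd] := choice bdw.
have bphi k : bmeas Omega' (phi k).
  have [_ sp _ _ _] := hphi k; have [_ [c hc]] := bmeas_sm_cube b sp.
  by apply: pw_bmeas dom _ _; exact: pw_sm.
have bdphi k i : bmeas Omega' (partial i (phi k)).
  have [_ sp _ _ _] := hphi k.
  by apply: pw_bmeas dom _ _; apply: pw_sm; exact: sm_partial.
have near_dist x : Omega x -> \forall k \near \oo, 3 * (k.+1%:R : R)^-1 < dist x.
  move=> Ox; have dx : 0 < dist x / 3.
    by rewrite divr_gt0// (codist_gt0 mesh_complement _ Ox)//; exact: mesh_open dom.
  have : \forall k \near \oo, (k.+1%:R : R)^-1 < dist x / 3 by exact: near_infty_natSinv_lt (PosNum dx).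
  by apply: filterS => k hk; rewrite mulrC -ltr_pdivlMr.
have cphi x : Omega' x -> (fun k => phi k x) @ \oo --> w x.
  move=> Ox; rewrite -(zw x Ox); apply/cvgrPdist_le => e e0.
  have := near_infty_natSinv_lt (PosNum e0); apply: filterS2 (near_dist x Ox.1) => k dk ek.
  have [_ _ _ h _] := hphi k; rewrite distrC; apply: le_trans (h x Ox.1 dk) _.
  exact: ltW.
have cdphi x i : Omega' x -> (fun k => partial i (phi k) x) @ \oo --> partial i w x.
  move=> Ox; rewrite -(near_partial_Omega' dom i zw Ox).
  have Cx := pw_C1_near dom pz Ox.
  have cb := bern_grad_cvg c_gt0 L0 hL (Omega_cube2 Ox.1) (Cx i).1 (Cx i).2.
  apply/cvgrPdist_le => e e0; have /cvgrPdist_le/(_ e e0)[N _ hN] := cb.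
  have : \forall k \near \oo, (N <= k)%N by exact: nbhs_infty_ge.
  apply: filterS2 (near_dist x Ox.1) => k dk Nk.
  have [_ _ _ _ [M kM ->//]] := hphi k; last exact: Ox.1.
  by apply: hN => /=; exact: leq_trans kM.
pose G k x := (w x - phi k x) ^+ 2 + \sum_i (partial i w x - partial i (phi k) x) ^+ 2.
have bG k : bmeas Omega' (G k).
  apply: bmeasD; first by apply: bmeas_sqr; exact: bmeasB.
  by apply: bmeas_sum => i; apply: bmeas_sqr; exact: bmeasB (bmeas_partial dom i sw) (bdphi k i).
have cG : (fun k => \int[mu]_(x in Omega') G k x) @ \oo --> (0 : R).
  rewrite -[X in _ --> X](_ : \int[mu]_(x in Omega') (cst 0 x : R) = 0); last first.
    by rewrite Rintegral_cst ?mul0r.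
  apply: (@bounded_cvg_Rintegral _ _ _ _ _ mO Oy _ _
    ((Cw + C) ^+ 2 + \sum_i (Cd i + C) ^+ 2)).
  - by move=> k; case: (bG k).
  - exact: measurable_cst.
  - move=> k x Ox; have [_ _ h _ _] := hphi k; have [h1 h2] := h x Ox.1.
    have sq (a c B D : R) : `|a| <= B -> `|c| <= D -> (a - c) ^+ 2 <= (B + D) ^+ 2.
      move=> aB cD; rewrite -real_normK ?num_real// lerXn2r ?nnegrE//.
        by rewrite addr_ge0 ?(le_trans _ aB)// (le_trans _ cD).
      by apply: le_trans (ler_normB _ _) _; exact: lerD.
    rewrite ger0_norm; last by rewrite addr_ge0 ?sqr_ge0// sumr_ge0// => i _; exact: sqr_ge0.
    apply: lerD; first by apply: sq => //; exact: hCw.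
    by apply: ler_sum => i _; apply: sq => //; exact: hCd.
  - move=> x Ox; rewrite /G.
    have -> : cst 0 x = (w x - w x) * (w x - w x) +
        \sum_i (partial i w x - partial i w x) * (partial i w x - partial i w x) :> R.
      by rewrite subrr mul0r big1 ?addr0// => i _; rewrite subrr mul0r.
    apply: cvgD; first by apply: cvgM; apply: cvgB; [exact: cvg_cst|exact: cphi|exact: cvg_cst|exact: cphi].
    apply: (@cvg_big _ _ +%R 0 xpredT add_continuous) => i _.
    by apply: cvgM; apply: cvgB; [exact: cvg_cst|exact: cdphi|exact: cvg_cst|exact: cdphi].
move=> e e0; have e20 : 0 < e ^+ 2 by exact: exprn_gt0.
have /cvgrPdist_lt/(_ _ e20)[k _ /(_ k (leqnn k)) /=] := cG.
rewrite sub0r normrN => hk; exists (phi k); first by have [] := hphi k.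
have sp : sm (phi k) by have [] := hphi k.
have dsub i x : Omega' x -> partial i (w \- phi k) x = partial i w x - partial i (phi k) x.
  move=> Ox; rewrite /partial deriveB//; last exact: sm_derivable.
  exact: pw_derivable dom _ _ _ (spline_pw' sw) Ox.
have bd i : bmeas Omega' (partial i (w \- phi k)).
  apply: (@eq_bmeas _ _ _ _ (fun x => partial i w x - partial i (phi k) x)).
    by move=> x /set_mem Ox; rewrite dsub.
  exact: bmeasB (bmeas_partial dom i sw) (bdphi k i).
rewrite (H1_normE dom)//; last by apply: bmeasB.
rewrite lte_fin -[ltRHS]gtr0_norm// -sqrtr_sqr ltr_sqrt//.
apply: le_lt_trans hk; rewrite le_eqVlt; apply/orP; left; apply/eqP.
have bs : bmeas Omega' (fun x => (w \- phi k) x ^+ 2) by apply: bmeas_sqr; exact: bmeasB.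
have bg : bmeas Omega' (fun x => dotv (grad (w \- phi k) x) (grad (w \- phi k) x)).
  apply: bmeas_dotv => i; apply: eq_bmeas (bd i) => x _; by rewrite mxE.
rewrite -bRintegralD// ger0_norm; last first.
  apply: Rintegral_ge0 => x _.
  by rewrite addr_ge0 ?sqr_ge0// sumr_ge0// => i _; exact: sqr_ge0.
apply: eq_Rintegral => x /set_mem Ox; congr (_ + _).
by apply: eq_bigr => i _; rewrite !mxE dsub.
Qed.

End density.

(** * Boundary values of H^1_0 splines *)

Section trace.
Context {R : realType} {n' : nat}.
Local Notation n := n'.+1.
Local Notation U := 'rV[R]_n.
Local Notation mu := (lebesgue_rV R n).
Variables (Omega : set U) (d : nat) (T : seq 'M[R]_(n.+1, n)) (b : R).
Hypothesis dom : meshed Omega T b.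
Local Notation Omega' := (Omega `\` facets T).
Local Notation spline := (spline_space Omega d T).
Local Notation vanishing := (spline_vanishing Omega d T).
Let mO := measurable_Omega' dom.
Let Oy := Omega'_lty dom.
Let b0 := mesh_bound_gt0 dom.

Lemma Rintegral_Omega'_gt0 (g : U -> R) x1 : continuous g -> (forall x, 0 <= g x) ->
  Omega x1 -> 0 < g x1 -> 0 < \int[mu]_(x in Omega') g x.
Proof.
move=> cg g0 Ox1 gx1; rewrite -(Rintegral_Omega' dom).
have Oo := mesh_open dom; have mOm := open_measurable_rV Oo.
have bg : bmeas Omega g.
  have [mg [C hC]] := bmeas_continuous_cube b cg; split.
    exact: (measurable_funS (measurable_cube 0 b) (Omega_cube dom) mg).
  by exists C => x /(Omega_cube dom); exact: hC.
pose V := g @^-1` [set t | g x1 / 2 < t].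
have oV : open V by apply: open_comp => [x _|]; [exact: cg|exact: open_gt].
have mV := open_measurable_rV oV.
have oOV : open (Omega `&` V) by exact: openI.
have V0 : (0 < mu (Omega `&` V))%E.
  apply: lebesgue_rV_open_gt0 => //; exists x1; split => //; rewrite /V/=; lra.
have Vy : (mu (Omega `&` V) < +oo)%E.
  apply: le_lt_trans (Omega_lty dom).
  exact: (le_measure mu (mem_set (open_measurable_rV oOV)) (mem_set mOm) (@subIsetl _ _ _)).
apply: (@lt_le_trans _ _ (g x1 / 2 * fine (mu (Omega `&` V)))).
  by rewrite mulr_gt0 ?divr_gt0// fine_gt0// V0.
rewrite -Rintegral_cst; last exact: open_measurable_rV oOV.
rewrite Rintegral_mkcondr.
apply: (le_bRintegral mOm (Omega_lty dom)) => //.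
  split; first by apply/measurable_restrict => //; exact: measurable_cst.
  exists `|g x1 / 2| => x _; rewrite /patch; case: ifP => // _.
  by rewrite normr0.
by move=> x _; rewrite /patch; case: ifPn => [/set_mem/ltW//|_]; exact: g0.
Qed.

Lemma test_flux_eq0 (phi : U -> R) (zeta : 'I_n -> U -> R) : test_function Omega phi ->
  (forall i, sm (zeta i)) ->
  \int[mu]_(x in Omega') \sum_i (phi x * partial i (zeta i) x + partial i phi x * zeta i x) = 0.
Proof.
move=> [sphi [K [cK KO phi0]]] sz.
have cphi : continuous phi by exact: (sphi [::]).1.
have dphi i x : derivable phi x (basis_vec R i) by exact: (sphi [::]).2.
have cdphi i : continuous (partial i phi) by exact: (sphi [:: i]).1.
pose G i x := partial i (fun y => phi y * zeta i y) x.
have GE i x : G i x = partial i phi x * zeta i x + phi x * partial i (zeta i) x.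
  by rewrite /G partialM//; exact: sm_derivable.
have cG i : continuous (G i).
  move=> x; rewrite (_ : G i = fun x => partial i phi x * zeta i x + phi x * partial i (zeta i) x).
    have c1 := continuousM (@cdphi i x) (sm_continuous (sz i) (x := x)).
    have c2 := continuousM (@cphi x) (sm_continuous (sm_partial i (sz i)) (x := x)).
    exact: continuousD c1 c2.
  by apply/funext => y; rewrite GE.
have phiO x : ~ Omega x -> phi x = 0 by move=> Ox; apply: phi0 => /KO.
have G0 i x : ~ Omega x -> G i x = 0.
  move=> Ox; rewrite /G -[RHS](_ : partial i (fun=> 0) x = 0); last by rewrite partial_cst.
  apply: near_eq_derive.
  have : nbhs x (~` K).
    apply: open_nbhs_nbhs; split; last by move=> /KO.
    by apply: closed_openC; apply: compact_closed => //; exact: norm_hausdorff.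
  by apply: filterS => y /phi0 ->; rewrite mul0r.
rewrite -(Rintegral_Omega' dom).
have OC : cube 0 b `&` Omega = Omega by apply/setIidr; exact: Omega_cube dom.
rewrite -OC Rintegral_mkcondr.
rewrite (@eq_Rintegral _ _ _ _ _ (fun x => \sum_i G i x)); last first.
  move=> x _; rewrite /patch; case: ifPn => [_|/negP xO].
    by apply: eq_bigr => i _; rewrite GE addrC.
  by rewrite big1// => i _; apply: G0 => Ox; apply: xO; exact: mem_set.
rewrite (bRintegral_sum (measurable_cube 0 b) (cube_lty (ltW b0))); last first.
  by move=> i; exact: bmeas_continuous_cube.
rewrite big1// => i _; rewrite /Rintegral integral_cube_partial//.
- move=> x; apply: derivableM; first exact: dphi.
  exact: sm_derivable.
- exact: cG.
- move=> x xb; rewrite phiO ?mul0r// => Ox.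
  by have := mesh_bound dom (subset_closure Ox) i; rewrite xb ltxx.
Qed.

Lemma bmeas_continuous (g : U -> R) : continuous g -> bmeas Omega' g.
Proof.
move=> cg; have [mg [C hC]] := bmeas_continuous_cube b cg; split.
  apply: (measurable_funS (measurable_cube 0 b) _ mg).
  by move=> x [Ox _]; exact: (Omega_cube dom).
by exists C => x [/(Omega_cube dom) cx _]; exact: hC.
Qed.

(** The integral vanishes for test functions and changes by at most a constant times [e] when [w] is
    replaced by a test function within [e] of it in norm. *)
Lemma H10_flux_eq0 w (zeta : 'I_n -> U -> R) : spline w -> in_H10 Omega w ->
  (forall i, sm (zeta i)) ->
  \int[mu]_(x in Omega') \sum_i (w x * partial i (zeta i) x + partial i w x * zeta i x) = 0.
Proof.
move=> sw hw sz.
have bw := bmeas_spline dom sw; have bdw i := bmeas_partial dom i sw.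
have bz i : bmeas Omega' (zeta i) by apply: bmeas_continuous; exact: sm_continuous.
have bdz i : bmeas Omega' (partial i (zeta i)).
  by apply: bmeas_continuous; apply: sm_continuous; exact: sm_partial.
have [C C0 hC] : exists2 C : R, 0 <= C & forall i x, Omega' x ->
    `|zeta i x| <= C /\ `|partial i (zeta i) x| <= C.
  have h i : exists c : R, 0 <= c /\ forall x, Omega' x ->
      `|zeta i x| <= c /\ `|partial i (zeta i) x| <= c.
    have [_ [c1 h1]] := bz i; have [_ [c2 h2]] := bdz i.
    exists (`|c1| + `|c2|); split; first by rewrite addr_ge0.
    move=> x Ox; split.
      by apply: le_trans (h1 x Ox) _; apply: le_trans (ler_norm _) _; rewrite lerDl.
    by apply: le_trans (h2 x Ox) _; apply: le_trans (ler_norm _) _; rewrite lerDr.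
  have [c hc] := choice h; exists (\sum_i c i).
    by rewrite sumr_ge0// => i _; case: (hc i).
  move=> i x Ox; have [_ /(_ x Ox) [h1 h2]] := hc i.
  have ci : c i <= \sum_i c i.
    by rewrite (bigD1 i)//= lerDl sumr_ge0// => j _; case: (hc j).
  by split; [exact: le_trans h1 ci|exact: le_trans h2 ci].
pose F (v : U -> R) x := \sum_i (v x * partial i (zeta i) x + partial i v x * zeta i x).
have bF v : bmeas Omega' v -> (forall i, bmeas Omega' (partial i v)) -> bmeas Omega' (F v).
  by move=> bv bdv; apply: bmeas_sum => i; apply: bmeasD; exact: bmeasM.
set J := \int[mu]_(x in Omega') _.
pose m0 := fine (mu Omega').
have m00 : 0 <= m0 by exact: fine_ge0.
suff main (e : R) : 0 < e -> `|J| <= n%:R * C * (2 * (1 + m0)) * e.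
  apply/eqP; rewrite -normr_le0; apply/ler_addgt0Pr => e e0; rewrite add0r.
  have K0 : 0 <= n%:R * C * (2 * (1 + m0)) by rewrite !mulr_ge0// addr_ge0.
  apply: le_trans (main (e / (1 + n%:R * C * (2 * (1 + m0)))) _) _.
    by rewrite divr_gt0// ltr_pwDl.
  rewrite mulrCA ler_piMr ?(ltW e0)// ler_pdivrMr ?ltr_pwDl//; lra.
move=> e0; have [phi tphi hphi] := hw e e0.
have [sphi _] := tphi.
have cphi : continuous phi by exact: (sphi [::]).1.
have dphi i x : derivable phi x (basis_vec R i) by exact: (sphi [::]).2.
have cdphi i : continuous (partial i phi) by exact: (sphi [:: i]).1.
have bphi : bmeas Omega' phi by exact: bmeas_continuous.
have bdphi i : bmeas Omega' (partial i phi) by exact: bmeas_continuous.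
pose v := w \- phi.
have dv i x : Omega' x -> partial i v x = partial i w x - partial i phi x.
  move=> Ox; rewrite /partial deriveB//.
  exact: pw_derivable dom _ _ _ (spline_pw' sw) Ox.
have bv : bmeas Omega' v by exact: bmeasB.
have bdv i : bmeas Omega' (partial i v).
  apply: (@eq_bmeas _ _ _ _ (fun x => partial i w x - partial i phi x)).
    by move=> x /set_mem Ox; rewrite dv.
  exact: bmeasB.
pose Q x := v x ^+ 2 + dotv (grad v x) (grad v x).
have bv2 := bmeas_sqr bv.
have bg : bmeas Omega' (fun x => dotv (grad v x) (grad v x)).
  by apply: bmeas_dotv => i; apply: eq_bmeas (bdv i) => x _; rewrite mxE.
have bQ : bmeas Omega' Q by exact: bmeasD.
have IQ : \int[mu]_(x in Omega') Q x < e ^+ 2.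
  rewrite bRintegralD//; move: hphi; rewrite (H1_normE dom)// lte_fin.
  by rewrite -[ltRHS]gtr0_norm// -sqrtr_sqr ltr_sqrt// exprn_gt0.
have -> : J = \int[mu]_(x in Omega') F v x.
  transitivity (\int[mu]_(x in Omega') (F phi x + F v x)).
    apply: eq_Rintegral => x /set_mem Ox; rewrite /F -big_split/=.
    apply: eq_bigr => i _; rewrite (dv i x Ox) /v /=.
    by move: (partial _ _ _) (partial _ _ _) (partial _ _ _) => p q r; ring.
  rewrite (bRintegralD mO Oy (bF _ bphi bdphi) (bF _ bv bdv)).
  by rewrite [X in X + _](test_flux_eq0 tphi sz) add0r.
apply: le_trans (le_normr_Rintegral mO (bmeas_integrable mO Oy (bF v bv bdv))) _.
pose c := n%:R * (C * 2) * e^-1; pose c' := n%:R * (C * 2) * e.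
apply: (@le_trans _ _ (\int[mu]_(x in Omega') (c * Q x + c'))).
  apply: (le_bRintegral mO Oy); first by apply: bmeas_norm; exact: bF.
    by apply: bmeasD; [exact: bmeasZ|exact: bmeas_cst].
  move=> x Ox.
  (* This replaces the Cauchy-Schwarz inequality: since the integral of [Q] is below [e^2], that of
     [Q / e + e] is of order [e]. *)
  have am (a D : R) : a ^+ 2 <= D -> `|a| <= D / e + e.
    move=> aD; rewrite -(ler_pM2r e0) mulrDl mulfVK ?gt_eqF//.
    have : `|a| ^+ 2 = a ^+ 2 by rewrite real_normK ?num_real.
    have := normr_ge0 a; nra.
  have h1 : `|v x| <= Q x / e + e.
    by apply: am; rewrite lerDl; exact: dotvv_ge0.
  have h2 i : `|partial i v x| <= Q x / e + e.
    apply: am; rewrite /Q /dotv (bigD1 i)//= !mxE -expr2 addrCA lerDl addr_ge0 ?sqr_ge0//.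
    by apply: sumr_ge0 => j _; rewrite -expr2 sqr_ge0.
  apply: le_trans (ler_norm_sum _ _ _) _.
  rewrite (_ : c * Q x + c' = \sum_(i < n) (C * (Q x / e + e) + C * (Q x / e + e))); last first.
    by rewrite sumr_const card_ord -[_ *+ n]mulr_natl /c /c'; field; rewrite gt_eqF.
  apply: ler_sum => i _; apply: le_trans (ler_normD _ _) _.
  have [z1 z2] := hC i x Ox; rewrite !normrM.
  by apply: lerD; rewrite [leRHS]mulrC; apply: ler_pM.
rewrite bRintegralD//; [|exact: bmeasZ|exact: bmeas_cst].
rewrite bRintegralZ// Rintegral_cst// -/m0.
have c0 : 0 <= c by rewrite !mulr_ge0// invr_ge0 ltW.
have : c * \int[mu]_(x in Omega') Q x <= c * e ^+ 2 by rewrite ler_wpM2l// ltW.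
have -> : c * e ^+ 2 = n%:R * (C * 2) * e by rewrite /c; field; rewrite gt_eqF.
rewrite /c'; move: (\int[mu]_(x in Omega') Q x) => I hI.
rewrite [leRHS](_ : _ = n%:R * (C * 2) * e + n%:R * (C * 2) * e * m0); last by ring.
by rewrite lerD2r.
Qed.

(* The truncated radial field [(x - z) flat_0 (s^2 - |x - z|^2)], with [z] outside
   the domain and [s] slightly larger than its distance to the domain, has a
   strictly signed divergence on the cap it sees. *)
Lemma in_H10_vanishing w : spline w -> in_H10 Omega w -> vanishing w.
Proof.
move=> sw hw; split => // x0 /(boundary_Omega dom)[cx0 nOx0].
apply/eqP; apply: contraT => a0; set a := w x0 in a0.
have na0 : 0 < `|a| by rewrite normr_gt0.
have a20 : 0 < a ^+ 2 by rewrite -real_normK ?num_real// exprn_gt0.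
have [L /= L0 hL] := pw_lipschitz dom (@subset_refl _ _) (closure_star_convex dom) (spline_pw sw).
(* At distance at most [4 * rho] from [x0], [w] differs from [a] by at most [|a| / 2], hence keeps
   its sign. *)
pose rho := `|a| / (2 * (L + 1)) / 4.
have L1 : 0 < L + 1 by rewrite ltr_wpDl.
have rho0 : 0 < rho by rewrite /rho !divr_gt0// mulr_gt0.
have near_a x : closure Omega x -> `|x - x0| <= 4 * rho -> a ^+ 2 / 2 <= a * w x.
  move=> cx xr; have := hL x x0 cx cx0; rewrite -/a => h.
  have h2 : `|w x - a| <= `|a| / 2.
    apply: le_trans h _; apply: (@le_trans _ _ ((L + 1) * (4 * rho))).
      by apply: ler_pM => //; rewrite lerDl.
    rewrite /rho le_eqVlt; apply/orP; left; apply/eqP; field.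
    by rewrite gt_eqF.
  have h3 : `|a * (w x - a)| <= `|a| * (`|a| / 2) by rewrite normrM ler_wpM2l.
  move: h3; rewrite ler_norml => /andP[h3 _].
  have a2 : `|a| ^+ 2 = a ^+ 2 by rewrite real_normK ?num_real.
  have : `|a| * (`|a| / 2) = a ^+ 2 / 2 by rewrite mulrA -expr2 a2.
  move=> h4; rewrite h4 in h3; rewrite mulrBr in h3; move: h3; rewrite -expr2; lra.
have [c Oc'] := mesh_neq0 dom.
pose D0 := dotv (x0 - c) (x0 - c).
have D00 : 0 <= D0 by exact: dotvv_ge0.
(* This puts the exterior point [z] at Euclidean distance less than [rho] from [x0]. *)
pose s0 := rho / (1 + D0).
have D1 : 0 < 1 + D0 by rewrite ltr_pwDl.
have s00 : 0 < s0 by rewrite divr_gt0.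
pose z := x0 + s0 *: (x0 - c).
have nz : ~ closure Omega z by exact: (closure_exterior dom).
have zx : dotv (x0 - z) (x0 - z) < rho ^+ 2.
  have -> : x0 - z = (- s0) *: (x0 - c).
    by apply/rowP => i; rewrite !mxE; ring.
  rewrite dotvZl dotvZr mulrA mulrNN -expr2 -/D0 /s0 expr_div_n mulrAC.
  rewrite ltr_pdivrMr ?exprn_gt0// ltr_pM2l ?exprn_gt0//; nra.
pose E := [set dotv (x - z) (x - z) | x in closure Omega].
have E0 : has_inf E.
  split; first by exists (dotv (x0 - z) (x0 - z)), x0.
  by exists 0 => _ [x _ <-]; exact: dotvv_ge0.
pose q := inf E.
have q_le x : closure Omega x -> q <= dotv (x - z) (x - z).
  by move=> cx; apply: ge_inf; [case: E0|exists x].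
have q0 : 0 < q.
  have : nbhs z (~` closure Omega).
    by apply: open_nbhs_nbhs; split => //; apply: closed_openC; exact: closed_closure.
  move=> /nbhs_ballP[e /= e0 he].
  apply: (@lt_le_trans _ _ (e ^+ 2)); first exact: exprn_gt0.
  apply: lb_le_inf; first by case: E0.
  move=> _ [x cx <-].
  have ex : e <= `|x - z|.
    rewrite leNgt; apply/negP => xz; apply: (he x) => //.
    by rewrite -ball_normE /ball_/= distrC.
  apply: le_trans (_ : `|x - z| ^+ 2 <= _).
    by rewrite lerXn2r ?nnegrE// ltW.
  apply: le_trans (sqr_norm_le _) _; rewrite le_eqVlt; apply/orP; left; apply/eqP.
  by apply: eq_bigr => i _; rewrite expr2.
have [Cd Cd0 hCd] : exists2 C : R, 0 <= C & forall i x, Omega' x -> `|partial i w x| <= C.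
  have h i : exists c : R, 0 <= c /\ forall x, Omega' x -> `|partial i w x| <= c.
    have [_ [c1 h1]] := bmeas_partial dom i sw.
    by exists `|c1|; split => // x Ox; apply: le_trans (h1 x Ox) _; exact: ler_norm.
  have [f hf] := choice h; exists (\sum_i f i).
    by rewrite sumr_ge0// => i _; case: (hf i).
  move=> i x Ox; have [_ /(_ x Ox) h1] := hf i; apply: le_trans h1 _.
  by rewrite (bigD1 i)//= lerDl sumr_ge0// => j _; case: (hf j).
pose A := `|a| * (n%:R * (Cd * (2 + q))).
have A0 : 0 <= A by rewrite !mulr_ge0// addr_ge0// ltW.
(* The truncation term contributes at most [- a^2 q / 2 = - 2 K] and the gradient of [w] at most
   [K], which leaves [- K]. *)
pose K := a ^+ 2 * q / 4.
have K0 : 0 < K by rewrite divr_gt0// mulr_gt0.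
(* [q + tau] is the squared radius of the field. The bound [n tau <= q] makes the divergence factor
   at most [- q], [tau A <= K] controls the gradient of [w], and [tau <= rho^2] keeps the cap within
   [4 * rho] of [x0]. *)
have [tau [tau0 tau1 tau_n tau_A tau_r]] : exists tau : R, [/\ 0 < tau, tau <= 1,
    n%:R * tau <= q, tau * A <= K & tau <= rho ^+ 2].
  pose t1 := Num.min 1 (rho ^+ 2); pose t2 := Num.min (q / n%:R) (K / (A + 1)).
  have r20 : 0 < rho ^+ 2 by exact: exprn_gt0.
  have A1 : 0 < A + 1 by rewrite ltr_wpDl.
  have t20 : 0 < t2 by rewrite /t2 lt_min (divr_gt0 q0) ?ltr0n// (divr_gt0 K0).
  have t10 : 0 < t1 by rewrite lt_min r20 ltr01.
  exists (Num.min t1 t2); split.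
  - by rewrite lt_min t10.
  - by rewrite ge_min /t1 ge_min lexx.
  - by rewrite mulrC -ler_pdivlMr ?ltr0n// ge_min; apply/orP; right; rewrite /t2 ge_min lexx.
  - apply: (@le_trans _ _ (K / (A + 1) * A)).
      by rewrite ler_wpM2r// ge_min; apply/orP; right; rewrite /t2 ge_min lexx orbT.
    rewrite mulrAC ler_pdivrMr//; nra.
  - by rewrite ge_min /t1 ge_min lexx !orbT.
pose t (x : U) := q + tau - dotv (x - z) (x - z).
have scz i : sm (fun x : U => x ord0 i - z ord0 i) by apply: sm_sub; [exact: sm_coord|exact: sm_cst].
have tE : t = fun x => q + tau - \sum_i (x ord0 i - z ord0 i) * (x ord0 i - z ord0 i).
  apply/funext => x; rewrite /t /dotv; congr (_ - _).
  by apply: eq_bigr => i _; rewrite !mxE.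
have st : sm t.
  rewrite tE; apply: sm_sub; first exact: sm_cst.
  by apply: sm_sum => i; exact: sm_mul.
have dcz i j x : partial i (fun x : U => x ord0 j - z ord0 j) x = (i == j)%:R.
  have sN : sm (fun _ : U => - z ord0 j) by exact: sm_cst.
  by rewrite (partial_smD i (sm_coord j) sN) partial_coord partial_cst addr0.
have dt i x : partial i t x = - (2 * (x ord0 i - z ord0 i)).
  have s2 j : sm (fun x : U => (x ord0 j - z ord0 j) * (x ord0 j - z ord0 j)).
    exact: sm_mul.
  rewrite tE partial_cst_sub ?partial_sm_sum//; last exact: sm_sum.
  rewrite (bigD1 i)//= big1 => [|j ji].
    by rewrite (partial_smM i (scz i) (scz i)) !dcz eqxx (_ : true%:R = 1 :> R)//; ring.
  by rewrite (partial_smM i (scz j) (scz j)) !dcz eq_sym (negbTE ji) mul0r mulr0 addr0.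
pose zeta i (x : U) := (x ord0 i - z ord0 i) * flat 0 (t x).
have sz i : sm (zeta i) by apply: sm_mul => //; exact: sm_flat.
have dz i x : partial i (zeta i) x = flat 0 (t x) - 2 * (x ord0 i - z ord0 i) ^+ 2 * flat 2 (t x).
  rewrite (partial_smM i (scz i) (sm_flat 0 st)) (partial_flat 0 i st) dt dcz eqxx.
  by rewrite (_ : true%:R = 1 :> R)//; ring.
have J0 := H10_flux_eq0 sw hw sz.
have bflat : bmeas Omega' (fun x => flat 2 (t x)).
  by apply: bmeas_continuous; apply: sm_continuous; exact: sm_flat.
have key x : Omega' x ->
    a * (\sum_i (w x * partial i (zeta i) x + partial i w x * zeta i x)) <= - K * flat 2 (t x).
  move=> Ox; pose D := dotv (x - z) (x - z); pose S := \sum_i partial i w x * (x ord0 i - z ord0 i).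
  have -> : \sum_i (w x * partial i (zeta i) x + partial i w x * zeta i x) =
      w x * (n%:R * flat 0 (t x) - 2 * D * flat 2 (t x)) + flat 0 (t x) * S.
    rewrite /S mulr_sumr (_ : n%:R * flat 0 (t x) = \sum_(i < n) flat 0 (t x)); last first.
      by rewrite sumr_const card_ord mulr_natl.
    rewrite /D /dotv mulr_sumr mulr_suml -sumrB mulr_sumr -big_split/=.
    apply: eq_bigr => i _; rewrite dz /zeta !mxE; move: (partial _ _ _) => p; ring.
  have [t0|t0] := leP (t x) 0; first by rewrite !flat_le0// !mulr0 subrr mulr0 mul0r addr0 mulr0.
  have cx : closure Omega x by apply: subset_closure; case: Ox.
  have Dq : q <= D by exact: q_le.
  have ttau : t x <= tau by rewrite /t -/D; lra.
  have Dtau : D <= q + tau by move: t0; rewrite /t -/D subr_gt0; exact: ltW.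
  have qrho : q <= rho ^+ 2 by apply: le_trans (q_le x0 cx0) _; exact: ltW.
  have xz2 i : (x ord0 i - z ord0 i) ^+ 2 <= D.
    by have := dotv_ge_coord (x - z) i; rewrite !mxE.
  have xzq i : `|x ord0 i - z ord0 i| <= 2 + q.
    have := xz2 i; rewrite -real_normK ?num_real//.
    by have := normr_ge0 (x ord0 i - z ord0 i); nra.
  have xx0 : `|x - x0| <= 4 * rho.
    apply: normr_rV_le => [|i]; first by rewrite mulr_ge0// ltW.
    have h1 := xz2 i.
    have h2 : (x0 ord0 i - z ord0 i) ^+ 2 <= dotv (x0 - z) (x0 - z).
      by have := dotv_ge_coord (x0 - z) i; rewrite [(x0 - z) _ _]mxE [(- z) _ _]mxE.
    rewrite [(x - x0) _ _]mxE [(- x0) _ _]mxE; move: h1 h2 zx; move: (x ord0 i) (z ord0 i) (x0 ord0 i) => p r s h1 h2 h3.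
    have h4 : (s - r) ^+ 2 <= rho ^+ 2 by lra.
    have h5 : (p - r) ^+ 2 <= (2 * rho) ^+ 2 by rewrite exprMn; nra.
    have sq (u v : R) : 0 <= v -> u ^+ 2 <= v ^+ 2 -> `|u| <= v.
      by move=> v0; rewrite -real_normK ?num_real// ler_pXn2r ?nnegrE.
    have := sq _ _ (ltW rho0) h4; have := sq _ (2 * rho) (mulr_ge0 (ler0n _ 2) (ltW rho0)) h5.
    rewrite !ler_norml; lra.
  have aw := near_a x cx xx0.
  have SA : a * S <= A.
    apply: le_trans (ler_norm _) _; rewrite normrM ler_wpM2l//.
    apply: le_trans (ler_norm_sum _ _ _) _.
    rewrite (_ : n%:R * _ = \sum_(i < n) (Cd * (2 + q))); last first.
      by rewrite sumr_const card_ord mulr_natl.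
    by apply: ler_sum => i _; rewrite normrM ler_pM// hCd.
  (* Undifferentiated terms carry the small factor [t^2], so the derivative of the truncation
     dominates. *)
  have -> : flat 0 (t x) = t x ^+ 2 * flat 2 (t x) by rewrite -flatS -flatS expr2 mulrA.
  have P0 := flat_gt0 2 t0.
  rewrite (_ : a * _ = (a * w x * (n%:R * t x ^+ 2 - 2 * D) + t x ^+ 2 * (a * S)) * flat 2 (t x)); last by ring.
  rewrite ler_pM2r//.
  have h1 : t x ^+ 2 <= tau by rewrite expr2; nra.
  have h2 : n%:R * t x ^+ 2 <= q.
    by apply: le_trans tau_n; rewrite ler_wpM2l.
  have h3 : t x ^+ 2 * (a * S) <= K.
    apply: le_trans tau_A; apply: (@le_trans _ _ (t x ^+ 2 * A)); first by rewrite ler_wpM2l ?sqr_ge0.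
    by rewrite ler_wpM2r.
  have h4 : a * w x * (n%:R * t x ^+ 2 - 2 * D) <= - (a ^+ 2 / 2 * q).
    rewrite -lerN2 opprK -mulrN; apply: ler_pM => //; [lra|exact: ltW|lra].
  have : a ^+ 2 / 2 * q = 2 * K by rewrite /K; field.
  lra.
have [y cy yE] : exists2 y, closure Omega y & dotv (y - z) (y - z) < q + tau.
  by have [_ [y cy <-] h] := inf_adherent tau0 E0; exists y.
have [x1 [Ox1 tx1]] : exists x, Omega x /\ 0 < t x.
  have ct : continuous t by exact: sm_continuous.
  have : nbhs y (t @^-1` [set s | 0 < s]).
    apply: ct; apply: open_nbhs_nbhs; split; first exact: open_gt.
    by rewrite /t/= subr_gt0.
  by move=> /cy[x [Ox tx]]; exists x.
have I0 : 0 < \int[mu]_(x in Omega') flat 2 (t x).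
  apply: (Rintegral_Omega'_gt0 (x1 := x1)) => //.
  - by apply: sm_continuous; exact: sm_flat.
  - by move=> x; exact: flat_ge0.
  - exact: flat_gt0.
have bz i : bmeas Omega' (zeta i) by apply: bmeas_continuous; exact: sm_continuous.
have bdz i : bmeas Omega' (partial i (zeta i)).
  by apply: bmeas_continuous; apply: sm_continuous; exact: sm_partial.
have bF : bmeas Omega' (fun x => \sum_i (w x * partial i (zeta i) x + partial i w x * zeta i x)).
  apply: bmeas_sum => i; apply: bmeasD; first exact: bmeasM (bmeas_spline dom sw) (bdz i).
  exact: bmeasM (bmeas_partial dom i sw) (bz i).
have := le_bRintegral mO Oy (bmeasZ a bF) (bmeasZ (- K) bflat) key.
rewrite !(bRintegralZ mO Oy)// J0 mulr0 mulNr leNgt oppr_lt0 mulr_gt0//.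
Qed.

End trace.

(** * The discrete Poisson problem *)

Section riesz_representation.
Context {R : realType} {X : Type}.
Local Notation V := (X -> R).
Variables (W : V -> Prop) (B : V -> V -> R) (l : V -> R) (N : nat).
Hypothesis W0 : W (fun=> 0).
Hypothesis WD : forall v w c, W v -> W w -> W (fun x => v x + c * w x).
Hypothesis BD : forall v w c u, W v -> W w -> W u ->
  B (fun x => v x + c * w x) u = B v u + c * B w u.
Hypothesis BC : forall v w, W v -> W w -> B v w = B w v.
Hypothesis B0 : forall v, W v -> 0 <= B v v.
Hypothesis lD : forall v w c, W v -> W w -> l (fun x => v x + c * w x) = l v + c * l w.
Hypothesis l_null : forall v, W v -> B v v = 0 -> l v = 0.
Hypothesis W_finite : forall F : 'I_N.+1 -> V, (forall i, W (F i)) ->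
  exists2 c : 'I_N.+1 -> R, exists i, c i != 0 &
    B (fun x => \sum_i c i * F i x) (fun x => \sum_i c i * F i x) = 0.

Let B00 u : W u -> B (fun=> 0) u = 0.
Proof.
move=> Wu; have := BD 1 W0 W0 Wu; rewrite (_ : (fun x => _) = fun=> 0); first lra.
by apply/funext => x; rewrite mulr0 addr0.
Qed.

Let l00 : l (fun=> 0) = 0.
Proof.
have := lD 1 W0 W0; rewrite (_ : (fun x => _) = fun=> 0); first lra.
by apply/funext => x; rewrite mulr0 addr0.
Qed.

Let combination (I : Type) (s : seq I) (c : I -> R) (F : I -> V) (u : V) :
  (forall i, W (F i)) -> W u ->
  [/\ W (fun x => \sum_(i <- s) c i * F i x),
      B (fun x => \sum_(i <- s) c i * F i x) u = \sum_(i <- s) c i * B (F i) u &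
      l (fun x => \sum_(i <- s) c i * F i x) = \sum_(i <- s) c i * l (F i)].
Proof.
move=> WF Wu; elim: s => [|i s [IH1 IH2 IH3]].
  rewrite (_ : (fun x => _) = fun=> 0) ?big_nil ?B00 ?l00//.
  by apply/funext => x; rewrite big_nil.
rewrite (_ : (fun x => _) = fun x => (\sum_(i <- s) c i * F i x) + c i * F i x).
  by rewrite !big_cons BD// lD// IH2 IH3 ![_ + c i * _]addrC; split => //; exact: WD.
by apply/funext => x; rewrite big_cons addrC.
Qed.

Let orthonormal k := exists2 F : 'I_k -> V, forall i, W (F i) &
  forall i j, B (F i) (F j) = (i == j)%:R.

(** [W_finite] expresses finite dimension modulo the kernel of [B]. On an orthonormal family the
    form of a combination is the sum of the squared coefficients, so a null combination is
    trivial. *)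
Let orthonormal_lt : ~ orthonormal N.+1.
Proof.
move=> [F WF BF]; have [c [i ci] cB] := W_finite WF.
have [Ws _ _] := combination (index_enum _) c WF (WF i).
move: cB; have [_ -> _] := combination (index_enum _) c WF Ws.
rewrite (eq_bigr (fun j => c j ^+ 2)) => [/psumr_eq0P h|j _]; last first.
  rewrite BC//; have [_ -> _] := combination (index_enum _) c WF (WF j).
  rewrite (bigD1 j)//= BF eqxx mulr1 big1 ?addr0 ?expr2// => m mj.
  by rewrite BF (negbTE mj) mulr0.
have /eqP := h (fun j _ => sqr_ge0 (c j)) i isT.
by rewrite sqrf_eq0 (negbTE ci).
Qed.

Let orthonormal_max : exists2 k, orthonormal k & ~ orthonormal k.+1.
Proof.
apply: contrapT => h; apply: orthonormal_lt.
elim: N.+1 => [|k IH]; first by exists (fun=> fun=> 0) => [//|[]].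
by apply: contrapT => nk; apply: h; exists k.
Qed.

(* The representer is expanded on a maximal orthonormal family. *)
Lemma riesz : exists2 w, W w & forall u, W u -> B w u = l u.
Proof.
have [k [F WF BF] kmax] := orthonormal_max.
have [Ww _ _] := combination (index_enum _) (fun i => l (F i)) WF W0.
exists (fun x => \sum_i l (F i) * F i x) => // u Wu.
have [_ -> _] := combination (index_enum _) (fun i => l (F i)) WF Wu.
have [Wp _ pl] := combination (index_enum _) (fun i => B (F i) u) WF W0.
set p := (fun x => _) in Wp pl.
pose r x := u x + -1 * p x.
have Wr : W r by exact: WD.
have rF j : B r (F j) = 0.
  rewrite BD//; have [_ -> _] := combination (index_enum _) (fun i => B (F i) u) WF (WF j).
  rewrite (bigD1 j)//= BF eqxx mulr1 big1 => [|m mj]; last by rewrite BF (negbTE mj) mulr0.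
  by rewrite addr0 BC// mulN1r subrr.
have r0 : B r r = 0.
  apply: contrapT => /eqP rn0; apply: kmax.
  have r0 : 0 < B r r by rewrite lt_neqAle eq_sym rn0 B0.
  pose s := (Num.sqrt (B r r))^-1.
  have ss : s * s * B r r = 1.
    by rewrite -expr2 exprVn sqr_sqrtr ?(ltW r0)// mulVf.
  (* The leading [0] makes the normalised vector an instance of the closure property [WD]. *)
  pose e x := 0 + s * r x.
  have We : W e by exact: WD W0 Wr.
  exists (fun i => if unlift ord_max i is Some j then F j else e).
    by move=> i; case: unliftP => [j _|_].
  have eF j : B e (F j) = 0 by rewrite BD// B00// rF mulr0 addr0.
  move=> i j; case: (unliftP ord_max i) => [i' ->|->]; case: (unliftP ord_max j) => [j' ->|->].
  - by rewrite BF (inj_eq lift_inj).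
  - by rewrite BC// eF eq_sym (negbTE (neq_lift _ _)).
  - by rewrite eF (negbTE (neq_lift _ _)).
  - by rewrite eqxx BD// B00// add0r BC// BD// B00// add0r mulrA ss.
have := l_null Wr r0; rewrite lD// pl mulN1r => /eqP; rewrite subr_eq0 => /eqP ->.
by apply: eq_bigr => i _; rewrite mulrC.
Qed.

End riesz_representation.

Section poisson.
Context {R : realType} {n' : nat}.
Local Notation n := n'.+1.
Local Notation U := 'rV[R]_n.
Local Notation mu := (lebesgue_rV R n).
Variables (Omega : set U) (d : nat) (T : seq 'M[R]_(n.+1, n)) (b : R).
Hypothesis dom : meshed Omega T b.
Local Notation Omega' := (Omega `\` facets T).
Local Notation spline := (spline_space Omega d T).
Local Notation vanishing := (spline_vanishing Omega d T).
Let mO := measurable_Omega' dom.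
Let Oy := Omega'_lty dom.

Definition dirichlet (v w : U -> R) := \int[mu]_(x in Omega') dotv (grad v x) (grad w x).

Lemma bmeas_grad_grad v w : spline v -> spline w ->
  bmeas Omega' (fun x => dotv (grad v x) (grad w x)).
Proof. by move=> sv sw; apply: bmeas_dotv => i; [exact: (bmeas_grad dom i sv)|exact: (bmeas_grad dom i sw)]. Qed.

Lemma spline_gradD v w c x : spline v -> spline w -> Omega' x ->
  grad (fun x => v x + c * w x) x = grad v x + c *: grad w x.
Proof.
move=> [Cv _] [Cw _] [Ox _]; apply/rowP => i; rewrite !mxE.
exact: (C1_onD c i Cv Cw Ox).
Qed.

Lemma dirichletC v w : dirichlet v w = dirichlet w v.
Proof. by apply: eq_Rintegral => x _; exact: dotvC. Qed.

Lemma dirichletD v w c u : spline v -> spline w -> spline u ->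
  dirichlet (fun x => v x + c * w x) u = dirichlet v u + c * dirichlet w u.
Proof.
move=> sv sw su; rewrite /dirichlet -bRintegralZ//; last exact: bmeas_grad_grad.
rewrite -bRintegralD//; [|exact: bmeas_grad_grad|by apply: bmeasZ; exact: bmeas_grad_grad].
by apply: eq_Rintegral => x /set_mem Ox; rewrite spline_gradD// dotvDl dotvZl.
Qed.

Lemma dirichlet_ge0 v : 0 <= dirichlet v v.
Proof. by apply: Rintegral_ge0 => x _; exact: dotvv_ge0. Qed.

(** Poincare's inequality makes the integral of [w^2] vanish, and the zero extension of [w] is
    continuous, which excludes a nonzero value at any point. *)
Lemma dirichlet_eq0 w : vanishing w -> dirichlet w w = 0 ->
  forall x, Omega x -> w x = 0.
Proof.
move=> Ww w0 x Ox; apply/eqP; apply: contraT => wx.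
have [L [C [L0 _ hL _]]] := vanishing_ext dom Ww.
pose g y := zext Omega w y * zext Omega w y.
have cz : continuous (zext Omega w) by exact: lipschitz_continuous hL.
have cg : continuous g by move=> y; exact: continuousM (cz y) (cz y).
have g0 y : 0 <= g y by rewrite /g -expr2 sqr_ge0.
have gx : 0 < g x by rewrite /g zextE// -expr2 lt_neqAle sqr_ge0 andbT eq_sym sqrf_eq0.
have := Rintegral_Omega'_gt0 dom cg g0 Ox gx.
have := poincare dom Ww; rewrite -/(dirichlet w w) w0 mulr0 leNgt => /negP h gt0.
exfalso; apply: h; move: gt0; congr (0 < _).
by apply: eq_Rintegral => y /set_mem[Oy' _]; rewrite /g zextE// expr2.
Qed.

Lemma vanishing0 : vanishing (fun=> 0).
Proof.
split => //; split.
  move=> x Ox i; split; first exact: derivable_cst.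
  by rewrite partial_cst; exact: cst_continuous.
move=> A AT; exists (fun=> 0) => //; exists (fun=> 0) => x.
by rewrite big1// => a _; rewrite mul0r.
Qed.

(** [N] counts pairs of an element and an exponent. The [N + 1] lists of polynomial coefficients are
    linearly dependent, and a dependence between coefficients is one between functions on every
    element. *)
Lemma vanishing_dependent (N := #|{: 'I_(size T) * {ffun 'I_n -> 'I_d.+1}}|)
    (F : 'I_N.+1 -> U -> R) : (forall i, vanishing (F i)) ->
  exists2 c : 'I_N.+1 -> R, exists i, c i != 0 &
    forall x, Omega x -> \sum_i c i * F i x = 0.
Proof.
move=> WF.
have h i (j : 'I_(size T)) : exists a : {ffun 'I_n -> 'I_d.+1} -> R, forall x,
    simplex (tnth (in_tuple T) j) x -> F i x =
      \sum_(k : {ffun 'I_n -> 'I_d.+1} | (\sum_i k i <= d)%N) a k * \prod_i x ord0 i ^+ k i.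
  have [[_ Fp] _] := WF i.
  have [p [a pa] Fpx] := Fp _ (mem_tnth j (in_tuple T)).
  by exists a => x Ax; rewrite Fpx ?pa//; exact: mem_set.
have [a ha] := choice (fun ij : 'I_N.+1 * 'I_(size T) => h ij.1 ij.2).
pose M : 'M[R]_(N.+1, N) := \matrix_(i, j) a (i, (enum_val j).1) (enum_val j).2.
have : kermx M != 0.
  by rewrite kermx_eq0 /row_free neq_ltn ltnS rank_leq_col.
move=> /rowV0Pn[v /sub_kermxP vM v0].
exists (fun i => v ord0 i).
  apply/existsP; apply: contraT; rewrite negb_exists => /forallP h0.
  case/negP: v0; apply/eqP/rowP => i; rewrite mxE; apply/eqP.
  by have := h0 i; rewrite negbK.
move=> x Ox; have := subset_closure Ox; rewrite (mesh_cover dom) => -[A AT Ax].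
have [j jA] : exists j, A = tnth (in_tuple T) j by apply/tnthP.
rewrite (eq_bigr (fun i => \sum_(k : {ffun 'I_n -> 'I_d.+1} | (\sum_i k i <= d)%N)
    v ord0 i * a (i, j) k * \prod_i x ord0 i ^+ k i)); last first.
  move=> i _; rewrite (ha (i, j)) -?jA// mulr_sumr.
  by apply: eq_bigr => k _; rewrite mulrA.
rewrite exchange_big/= big1// => k _; rewrite -mulr_suml.
have := congr1 (fun m : 'M[R]_(1, N) => m ord0 (enum_rank (j, k))) vM; rewrite !mxE.
rewrite (eq_bigr (fun i => v ord0 i * a (i, j) k)); first by move=> ->; rewrite mul0r.
by move=> i _; rewrite mxE enum_rankK.
Qed.

Lemma poisson (l : (U -> R) -> R) :
  (forall v w c, vanishing v -> vanishing w -> l (fun x => v x + c * w x) = l v + c * l w) ->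
  (forall v, vanishing v -> (forall x, Omega x -> v x = 0) -> l v = 0) ->
  exists2 w, vanishing w & forall u, vanishing u -> dirichlet w u = l u.
Proof.
move=> lD l0.
have [N hN] : exists N, forall F : 'I_N.+1 -> U -> R, (forall i, vanishing (F i)) ->
    exists2 c : 'I_N.+1 -> R, exists i, c i != 0 &
      forall x, Omega x -> \sum_i c i * F i x = 0.
  by eexists; exact: vanishing_dependent.
apply: (riesz (W := vanishing) (B := dirichlet) (N := N)).
- exact: vanishing0.
- by move=> v w c Wv Ww; exact: (spline_vanishingD dom c Wv Ww).
- by move=> v w c u [sv _] [sw _] [su _]; exact: dirichletD.
- by move=> v w _ _; exact: dirichletC.
- by move=> v _; exact: dirichlet_ge0.
- exact: lD.
- by move=> v Wv /(dirichlet_eq0 Wv); exact: l0.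
- move=> F WF; have [c c0 hc] := hN F WF; exists c => //.
  have z y : Omega' y -> \sum_i c i * F i y = (fun=> 0) y by move=> [/hc].
  rewrite /dirichlet -[RHS](_ : \int[mu]_(x in Omega') cst 0 x = 0); last first.
    by rewrite Rintegral_cst ?mul0r.
  apply: eq_Rintegral => x /set_mem Ox; rewrite /dotv big1// => i _.
  by rewrite !mxE (near_partial_Omega' dom i z Ox) partial_cst mul0r.
Qed.

End poisson.

(** * The iteration *)

Section iteration.
Context {R : realType} {n' : nat}.
Local Notation n := n'.+1.
Local Notation U := 'rV[R]_n.
Local Notation mu := (lebesgue_rV R n).
Variables (Omega : set U) (d : nat) (T : seq 'M[R]_(n.+1, n)) (b : R).
Hypothesis dom : meshed Omega T b.
Hypothesis n23 : n = 2%N \/ n = 3%N.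
Local Notation Omega' := (Omega `\` facets T).
Local Notation spline := (spline_space Omega d T).
Local Notation vanishing := (spline_vanishing Omega d T).
Local Notation dirichlet := (dirichlet Omega T).
Let mO := measurable_Omega' dom.
Let Oy := Omega'_lty dom.

Lemma hessD v w c x : spline v -> spline w -> Omega' x ->
  hess (fun x => v x + c * w x) x = hess v x + c *: hess w x.
Proof.
move=> sv sw Ox; apply/matrixP => i j; rewrite !mxE.
have h y : Omega' y -> partial j (fun x => v x + c * w x) y = partial j v y + c * partial j w y.
  by move=> [Oy' _]; exact: (C1_onD c j (spline_C1 sv) (spline_C1 sw) Oy').
rewrite (near_partial_Omega' dom i h Ox).
have dv := pw_derivable dom (i := i) (spline_partial dom j sv) Ox.
have dw := pw_derivable dom (i := i) (spline_partial dom j sw) Ox.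
by have [] := derivable_scaled_add c dv dw.
Qed.

Definition flux_mx (v : U -> R) (x : U) : 'M[R]_n := (cofmx (hess v x))^T.

(** The coefficients [0] and [1] are left explicit so that the three nodes are instances of one
    family in [c]. *)
Definition simpson_mx (v e : U -> R) (x : U) : 'M[R]_n :=
  6^-1 *: (flux_mx (fun x => v x + 0 * e x) x +
    4 *: flux_mx (fun x => v x + 2^-1 * e x) x + flux_mx (fun x => v x + 1 * e x) x).

Lemma bmeas_dotv_flux v e p : spline v -> spline e -> spline p ->
  bmeas Omega' (fun x => dotv (grad e x *m flux_mx v x) (grad p x)).
Proof.
move=> sv se sp; apply: bmeas_dotv => i; first exact: (bmeas_flux dom i sv se).
exact: (bmeas_grad dom i sp).
Qed.

(** Here [p] and [q] are the squared seminorms of the old and the new error. *)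
Lemma absorb (m M p q : R) : 2 * ((m + M) * q) <= M * (p + q) -> (2 * m + M) * q <= M * p.
Proof. lra. Qed.

Lemma simpson_average (p q r s t : R) : p <= r <= q -> p <= s <= q -> p <= t <= q ->
  p <= 6^-1 * (r + 4 * s + t) <= q.
Proof. by move=> /andP[? ?] /andP[? ?] /andP[? ?]; apply/andP; split; lra. Qed.

Lemma dotv_simpson v e x (y z : U) : dotv (y *m simpson_mx v e x) z =
  6^-1 * (dotv (y *m flux_mx (fun x => v x + 0 * e x) x) z +
    4 * dotv (y *m flux_mx (fun x => v x + 2^-1 * e x) x) z +
    dotv (y *m flux_mx (fun x => v x + 1 * e x) x) z).
Proof. by rewrite /simpson_mx -scalemxAr dotvZl !mulmxDr !dotvDl -scalemxAr dotvZl. Qed.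

Lemma bmeas_dotv_simpson v e p : spline v -> spline e -> spline p ->
  bmeas Omega' (fun x => dotv (grad e x *m simpson_mx v e x) (grad p x)).
Proof.
move=> sv se sp; have sD c : spline (fun x => v x + c * e x) by exact: (splineD dom c sv se).
apply: (@eq_bmeas _ _ _ _ (fun x => 6^-1 *
  (dotv (grad e x *m flux_mx (fun x => v x + 0 * e x) x) (grad p x) +
  4 * dotv (grad e x *m flux_mx (fun x => v x + 2^-1 * e x) x) (grad p x) +
  dotv (grad e x *m flux_mx (fun x => v x + 1 * e x) x) (grad p x)))).
  by move=> x _; rewrite dotv_simpson.
apply: bmeasZ; apply: bmeasD; last exact: bmeas_dotv_flux.
by apply: bmeasD; [|apply: bmeasZ]; exact: bmeas_dotv_flux.
Qed.

Lemma bmeas_det_hess v : spline v -> bmeas Omega' (fun x => \det (hess v x)).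
Proof. by move=> sv; apply: bmeas_det => i j; exact: (bmeas_hess dom i j sv). Qed.

Lemma det_difference v e psi : spline v -> spline e -> vanishing psi ->
  \int[mu]_(x in Omega') ((\det (hess (fun x => v x + 1 * e x) x) - \det (hess v x)) * psi x) =
  - \int[mu]_(x in Omega') dotv (grad e x *m simpson_mx v e x) (grad psi x).
Proof.
move=> sv se Wpsi; have sp := Wpsi.1; have bp := bmeas_spline dom sp.
have sD c : spline (fun x => v x + c * e x) by exact: (splineD dom c sv se).
pose I c x := cof_sum (hess (fun x => v x + c * e x) x) (hess e x) * psi x.
pose J c x := dotv (grad e x *m flux_mx (fun x => v x + c * e x) x) (grad psi x).
have bI c : bmeas Omega' (I c) by apply: bmeasM => //; exact: (bmeas_cof_sum dom).
have bJ c : bmeas Omega' (J c) by exact: bmeas_dotv_flux.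
have IJ c : \int[mu]_(x in Omega') I c x = - \int[mu]_(x in Omega') J c x.
  exact: (cof_sum_integral dom (sD c) se Wpsi).
transitivity (\int[mu]_(x in Omega') (6^-1 * (I 0 x + 4 * I 2^-1 x + I 1 x))).
  apply: eq_Rintegral => x /set_mem Ox; rewrite /I !(hessD _ sv se Ox).
  rewrite scale0r addr0 scale1r (det_simpson _ _ n23).
  by move: (cof_sum _ _) (cof_sum _ _) (cof_sum _ _) (psi x) => p q r s; ring.
have split3 (K : R -> U -> R) : (forall c, bmeas Omega' (K c)) ->
    \int[mu]_(x in Omega') (6^-1 * (K 0 x + 4 * K 2^-1 x + K 1 x)) =
    6^-1 * (\int[mu]_(x in Omega') K 0 x + 4 * \int[mu]_(x in Omega') K 2^-1 x +
      \int[mu]_(x in Omega') K 1 x).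
  move=> bK; have b4 := bmeasZ 4 (bK 2^-1); have bs := bmeasD (bK 0) b4.
  rewrite (bRintegralZ mO Oy 6^-1 (bmeasD bs (bK 1))) (bRintegralD mO Oy bs (bK 1)).
  by rewrite (bRintegralD mO Oy (bK 0) b4) (bRintegralZ mO Oy 4 (bK 2^-1)).
transitivity (- \int[mu]_(x in Omega') (6^-1 * (J 0 x + 4 * J 2^-1 x + J 1 x))); last first.
  by congr (- _); apply: eq_Rintegral => x _; rewrite dotv_simpson.
clearbody I J; rewrite (split3 I bI) (split3 J bJ) !IJ.
by move: (Rintegral _ _ _) (Rintegral _ _ _) (Rintegral _ _ _) => p q r; ring.
Qed.

(** With [B = m + M - A], polarisation reads [2 (x B . y) = x B . x + y B . y - (x - y) B . (x -
    y)]. The first two terms use [A >= m], and the last is not positive because [A <= M] and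
    [m >= 0]. *)
Lemma sym_form_bound m M (A : 'M[R]_n) (x y : U) : A^T = A ->
  (forall z, m * dotv z z <= dotv (z *m A) z <= M * dotv z z) -> 0 <= m ->
  2 * ((m + M) * dotv x y - dotv (x *m A) y) <= M * (dotv x x + dotv y y).
Proof.
move=> As h m0; have /andP[hx _] := h x; have /andP[hy _] := h y.
have /andP[_ hxy] := h (x + (-1) *: y).
have yAx : dotv (y *m A) x = dotv (x *m A) y by rewrite dotv_mulmx As dotvC.
move: hxy; rewrite !mulmxDl -!scalemxAl !dotvDl !dotvDr !dotvZl !dotvZr yAx (dotvC y x).
have := dotvv_ge0 (x + (-1) *: y).
rewrite !dotvDl !dotvDr !dotvZl !dotvZr (dotvC y x).
move: (dotv x x) (dotv y y) (dotv x y) (dotv (x *m A) x) (dotv (y *m A) y) (dotv (x *m A) y) hx hy => p q r s t u hx hy h1 h2.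
have : 0 <= m * (p + -1 * r + (-1 * r + -1 * (-1 * q))) by exact: mulr_ge0.
nra.
Qed.

Lemma ae_le_bRintegral (F G : U -> R) (P : U -> Prop) : bmeas Omega' F -> bmeas Omega' G ->
  {ae mu, forall x, P x} -> (forall x, Omega' x -> P x -> F x <= G x) ->
  \int[mu]_(x in Omega') F x <= \int[mu]_(x in Omega') G x.
Proof.
move=> [mF [CF hF]] [mG [CG hG]] [N [mN N0 hN]] FG.
rewrite (Rintegral_setD_null _ F mN N0) (Rintegral_setD_null _ G mN N0).
have mD : measurable (Omega' `\` N) by exact: measurableD.
apply: le_bRintegral => //.
- apply: le_lt_trans Oy.
  exact: (le_measure mu (mem_set mD) (mem_set mO) (@subDsetl _ _ _)).
- split; first by apply: measurable_funS mF => //; exact: subDsetl.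
  by exists CF => x [Ox _]; exact: hF.
- split; first by apply: measurable_funS mG => //; exact: subDsetl.
  by exists CG => x [Ox _]; exact: hG.
- by move=> x [Ox nN]; apply: FG => //; apply: contrapT => nP; apply: nN; exact: hN.
Qed.

Variables (f gh uh : U -> R) (m M r0 : R).
Hypothesis m_gt0 : 0 < m.
Hypothesis le_mM : m <= M.
Hypothesis f_int : forall psi, spline_space0 Omega d T psi ->
  mu.-integrable Omega (EFin \o (f \* psi)).
Hypothesis uh_sol : discrete_solution Omega d T f gh uh.
Hypothesis eigen : forall v, spline v -> agree_on_boundary Omega v gh ->
  (H1_norm Omega (v \- uh)%R < r0%:E)%E ->
  {ae mu, forall x, Omega x -> forall lambda,
    eigenvalue (cofmx (hess v x)) lambda -> m <= lambda <= M}.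

Let sh : spline uh. Proof. by case: uh_sol. Qed.
Let ah : agree_on_boundary Omega uh gh. Proof. by case: uh_sol. Qed.

(** The equations are tested with splines in [H^1_0], whereas the integrations by parts require
    boundary values; both directions are used. *)
Lemma vanishing_space0 psi : vanishing psi <-> spline_space0 Omega d T psi.
Proof.
split=> [W|[sp hp]]; first by split; [exact: W.1|exact: (vanishing_in_H10 dom W)].
exact: (in_H10_vanishing dom sp hp).
Qed.

Lemma fpsi_integrable psi : vanishing psi ->
  mu.-integrable Omega' (EFin \o (fun x => f x * psi x)).
Proof.
move=> /vanishing_space0 /f_int h; apply: integrableS h => //.
  exact: open_measurable_rV (mesh_open dom).
Qed.

(** As [cof A : A = n det A], the divergence identity with [v = e = uh] turns the discrete equation
    into the form in which the iteration tests the determinant. *)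
Lemma det_uh psi : vanishing psi ->
  \int[mu]_(x in Omega') (\det (hess uh x) * psi x) = \int[mu]_(x in Omega') (f x * psi x).
Proof.
move=> W; have [_ _ /(_ psi ((vanishing_space0 psi).1 W))] := uh_sol.
rewrite !(Rintegral_Omega' dom) => <-.
have n0 : (n%:R : R) != 0 by rewrite pnatr_eq0.
have := cof_sum_integral dom sh sh W.
rewrite (@eq_Rintegral _ _ _ _ _ (fun x => n%:R * (\det (hess uh x) * psi x))); last first.
  by move=> x _; rewrite cof_sum_diag mulrA.
rewrite bRintegralZ//; last first.
  by apply: bmeasM; [exact: bmeas_det_hess|exact: (bmeas_spline dom W.1)].
move=> h; apply: (mulfI n0); rewrite h mulrA mulrN mulfV// mulN1r.
by [].
Qed.

Definition residual (v psi : U -> R) :=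
  \int[mu]_(x in Omega) ((\det (hess v x) - f x) * psi x).

Lemma residualE v psi : spline v -> vanishing psi ->
  residual v psi = \int[mu]_(x in Omega') (\det (hess v x) * psi x) -
                   \int[mu]_(x in Omega') (f x * psi x).
Proof.
move=> sv W; rewrite /residual (Rintegral_Omega' dom) -RintegralB//.
- by apply: eq_Rintegral => x _; rewrite mulrBl.
- apply: bmeas_integrable => //.
  by apply: bmeasM; [exact: bmeas_det_hess|exact: (bmeas_spline dom W.1)].
- exact: fpsi_integrable.
Qed.

Lemma sub_fctE (v w : U -> R) : v \- w = fun x => v x + -1 * w x.
Proof. by apply/funext => x; rewrite mulN1r. Qed.

Lemma vanishing_sub v w : spline v -> spline w -> agree_on_boundary Omega v gh ->
  agree_on_boundary Omega w gh -> vanishing (v \- w).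
Proof.
move=> sv sw av aw; rewrite sub_fctE; split; first exact: (splineD dom (-1) sv sw).
by move=> x bx; rewrite av ?aw ?mulN1r ?subrr//; exact: mem_set.
Qed.

(* With this relaxation [nu - A] lies between [m] and [M] when [A] does. *)
Definition nu := m + M.
Lemma nu_gt0 : 0 < nu. Proof. exact: addr_gt0 m_gt0 (lt_le_trans m_gt0 le_mM). Qed.

Definition next_iterate (v w : U -> R) := [/\ spline w, agree_on_boundary Omega w gh &
  forall psi, spline_space0 Omega d T psi ->
    nu * \int[mu]_(x in Omega) dotv (grad w x) (grad psi x) =
    nu * \int[mu]_(x in Omega) dotv (grad v x) (grad psi x) + residual v psi].

Lemma next_iterateP v w psi : next_iterate v w -> vanishing psi ->
  nu * dirichlet w psi = nu * dirichlet v psi + residual v psi.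
Proof.
by move=> [_ _ h] /vanishing_space0/h; rewrite !(Rintegral_Omega' dom).
Qed.

(** The increment [z] solves a discrete Poisson problem with right-hand side [residual v / nu]. The
    residual is linear in [psi] because [f psi] is integrable for each test spline. *)
Lemma next_iterate_exists v : spline v -> agree_on_boundary Omega v gh ->
  exists w, next_iterate v w.
Proof.
move=> sv av; have nu0 := nu_gt0.
have [p u c Wp Wu|psi W psi0|z Wz hz] := @poisson R n' Omega d T b dom (fun psi => nu^-1 * residual v psi).
- have sp := Wp.1; have su := Wu.1; have Wpu := spline_vanishingD dom c Wp Wu.
  rewrite !residualE//.
  have -> : \int[mu]_(x in Omega') (\det (hess v x) * (p x + c * u x)) =
      \int[mu]_(x in Omega') (\det (hess v x) * p x) +
      c * \int[mu]_(x in Omega') (\det (hess v x) * u x).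
    have bp := bmeasM (bmeas_det_hess sv) (bmeas_spline dom sp).
    have bu := bmeasM (bmeas_det_hess sv) (bmeas_spline dom su).
    rewrite -(bRintegralZ mO Oy _ bu) -(bRintegralD mO Oy bp (bmeasZ c bu)).
    by apply: eq_Rintegral => x _; ring.
  have -> : \int[mu]_(x in Omega') (f x * (p x + c * u x)) =
      \int[mu]_(x in Omega') (f x * p x) + c * \int[mu]_(x in Omega') (f x * u x).
    have ip := fpsi_integrable Wp; have iu := fpsi_integrable Wu.
    rewrite -RintegralZl// -RintegralD//; last first.
      by apply: eq_integrable (integrableZl mO c iu).
    by apply: eq_Rintegral => x _; ring.
  by move: (Rintegral _ _ _) (Rintegral _ _ _) (Rintegral _ _ _) (Rintegral _ _ _) => *; ring.
- rewrite /residual (@eq_Rintegral _ _ _ _ _ (cst 0)) ?Rintegral_cst ?mul0r ?mulr0//.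
    exact: open_measurable_rV (mesh_open dom).
  by move=> x /set_mem Ox; rewrite psi0// mulr0.
exists (fun x => v x + 1 * z x); split.
- exact: (splineD dom 1 sv Wz.1).
- by move=> x /set_mem bx; rewrite Wz.2// mulr0 addr0 av//; exact: mem_set.
move=> psi /vanishing_space0 W; rewrite !(Rintegral_Omega' dom).
rewrite -!/(dirichlet _ _) (dirichletD dom 1 sv Wz.1 W.1) hz// mul1r mulrDr.
by rewrite mulVKf// gt_eqF.
Qed.

Definition nrm2 (w : U -> R) := \int[mu]_(x in Omega') w x ^+ 2 + dirichlet w w.

Lemma H1_spline w : spline w -> H1_norm Omega w = (Num.sqrt (nrm2 w))%:E.
Proof.
move=> sw; rewrite (H1_normE dom)//; first exact: (bmeas_spline dom sw).
by move=> i; exact: (bmeas_partial dom i sw).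
Qed.

Lemma H1_seminorm_spline w : spline w ->
  H1_seminorm Omega w = (Num.sqrt (dirichlet w w))%:E.
Proof.
by move=> sw; rewrite (H1_seminormE dom)// => i; exact: (bmeas_partial dom i sw).
Qed.

Lemma dirichlet_le_nrm2 w : dirichlet w w <= nrm2 w.
Proof. by rewrite lerDr; apply: Rintegral_ge0 => x _; exact: sqr_ge0. Qed.

Lemma nrm2_scale w t : spline w -> nrm2 (fun x => 0 + t * w x) = t ^+ 2 * nrm2 w.
Proof.
move=> sw; have s0 := (vanishing0 Omega d T).1.
have bw := bmeas_sqr (bmeas_spline dom sw).
rewrite /nrm2 mulrDr -(bRintegralZ mO Oy _ bw); congr (_ + _).
  by apply: eq_Rintegral => x _; rewrite add0r exprMn.
have bg := bmeas_grad_grad dom sw sw.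
rewrite /dirichlet -(bRintegralZ mO Oy _ bg); apply: eq_Rintegral => x /set_mem Ox.
rewrite (spline_gradD t s0 sw Ox).
have -> : grad (fun=> 0 : R) x = 0 :> U.
  by apply/rowP => i; rewrite !mxE partial_cst.
by rewrite add0r dotvZl dotvZr mulrA expr2.
Qed.

(** The constant [4 b^2] of Poincare's inequality bounds the squared norm by [cP^2] times the
    squared seminorm. *)
Definition cP := Num.sqrt (1 + 4 * b ^+ 2).

Lemma cP_ge1 : 1 <= cP.
Proof.
by rewrite -(sqrtr1 R) /cP ler_wsqrtr// lerDl mulr_ge0 ?sqr_ge0.
Qed.

Lemma H1_le_seminorm w : vanishing w ->
  Num.sqrt (nrm2 w) <= cP * Num.sqrt (dirichlet w w).
Proof.
move=> W; have b2 : 0 <= 1 + 4 * b ^+ 2 by rewrite addr_ge0// mulr_ge0 ?sqr_ge0.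
rewrite /cP -sqrtrM// ler_wsqrtr// /nrm2 mulrDl mul1r addrC lerD2l.
exact: (poincare dom W).
Qed.

(** The norm of [t (v - uh)] is [|t|] times that of [v - uh], so the ball is not left. The values
    needed are the Simpson nodes [0], [1 / 2] and [1]. *)
Lemma spline_segment v t : spline v -> agree_on_boundary Omega v gh ->
  (H1_norm Omega (v \- uh)%R < r0%:E)%E -> t ^+ 2 <= 1 ->
  {ae mu, forall x, Omega x -> forall lambda,
    eigenvalue (cofmx (hess (fun x => uh x + t * (v \- uh) x) x)) lambda -> m <= lambda <= M}.
Proof.
move=> sv av hv t1; have se := (vanishing_sub sv sh av ah).1.
apply: eigen.
- exact: (splineD dom t sh se).
- by move=> x bx; rewrite /= av// ah// subrr mulr0 addr0.
- rewrite (_ : _ \- _ = fun x => 0 + t * (v \- uh) x); last first.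
    by apply/funext => x /=; rewrite add0r addrC addKr.
  have s0 := (vanishing0 Omega d T).1.
  apply: le_lt_trans hv; move: (v \- uh) se => e se.
  rewrite (H1_spline (splineD dom t s0 se)) (H1_spline se).
  rewrite (nrm2_scale t se) lee_fin; apply: ler_wsqrtr; rewrite ler_piMl//.
  exact: le_trans (dirichlet_ge0 _ _ _) (dirichlet_le_nrm2 _).
Qed.

(* The errors [e] and [e'] satisfy [nu (De', Dpsi) = ((nu - A) De, Dpsi)], where [A]
   is the Simpson average of the cofactor matrices between [uh] and [v]. *)
Lemma contraction v w : spline v -> agree_on_boundary Omega v gh ->
  (H1_norm Omega (v \- uh)%R < r0%:E)%E -> next_iterate v w ->
  (2 * m + M) * dirichlet (w \- uh) (w \- uh) <= M * dirichlet (v \- uh) (v \- uh).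
Proof.
move=> sv av hv vw; have [sw aw _] := vw.
have We := vanishing_sub sv sh av ah; have We' := vanishing_sub sw sh aw ah.
set e := v \- uh in We *; set e' := w \- uh in We' *.
have se := We.1; have se' := We'.1.
have vE : v = fun x => uh x + 1 * e x by apply/funext => x; rewrite /e/= mul1r addrC subrK.
have wE : w = fun x => uh x + 1 * e' x by apply/funext => x; rewrite /e'/= mul1r addrC subrK.
have res : residual v e' = - \int[mu]_(x in Omega') dotv (grad e x *m simpson_mx uh e x) (grad e' x).
  rewrite residualE// -det_uh// -bRintegralB//.
  - by rewrite -det_difference// -vE; apply: eq_Rintegral => x _; rewrite mulrBl.
  - by apply: bmeasM; [exact: bmeas_det_hess|exact: (bmeas_spline dom se')].
  - by apply: bmeasM; [exact: bmeas_det_hess|exact: (bmeas_spline dom se')].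
have := next_iterateP vw We'.
have -> : dirichlet w e' = dirichlet uh e' + 1 * dirichlet e' e'.
  by rewrite -(dirichletD dom 1 sh se' se') -wE.
have -> : dirichlet v e' = dirichlet uh e' + 1 * dirichlet e e'.
  by rewrite -(dirichletD dom 1 sh se se') -vE.
have cancel (a p q r s : R) : a * (p + 1 * q) = a * (p + 1 * r) + s -> a * q = a * r + s.
  by rewrite !mul1r !mulrDr -addrA => /addrI.
rewrite res => /cancel main.
have bA := bmeas_dotv_simpson sh se se'.
have bgg := bmeas_grad_grad dom se se'.
have bee := bmeas_grad_grad dom se se; have bee' := bmeas_grad_grad dom se' se'.
have bn := bmeasZ nu bgg.
have e0 : (0 : R) ^+ 2 <= 1 by rewrite expr0n ler01.
have e2 : (2^-1 : R) ^+ 2 <= 1 by rewrite expr_le1 ?invr_ge0// invf_le1 ?ler1n.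
have e1 : (1 : R) ^+ 2 <= 1 by rewrite expr1n.
(* Almost everywhere the eigenvalue bounds hold at the three Simpson nodes simultaneously. *)
have E := @filterI _ _ (ae_filter_ringOfSetsType mu) _ _ (spline_segment sv av hv e0)
  (@filterI _ _ (ae_filter_ringOfSetsType mu) _ _ (spline_segment sv av hv e2) (spline_segment sv av hv e1)).
have : \int[mu]_(x in Omega') (2 * (nu * dotv (grad e x) (grad e' x) -
      dotv (grad e x *m simpson_mx uh e x) (grad e' x))) <=
    \int[mu]_(x in Omega') (M * (dotv (grad e x) (grad e x) + dotv (grad e' x) (grad e' x))).
  apply: (ae_le_bRintegral _ _ E).
  - by apply: bmeasZ; exact: bmeasB.
  - by apply: bmeasZ; exact: bmeasD.
  move=> x Ox [E0 [E2 E1]].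
  have fluxE c : let A := flux_mx (fun x => uh x + c * e x) x in A^T = A /\
      (A = cofmx (hess (fun x => uh x + c * e x) x)).
    have hs := hess_sym dom (splineD dom c sh se) Ox.
    by rewrite /flux_mx /= trmxK (cofmx_sym hs).
  apply: sym_form_bound; last exact: ltW.
    have sym3 (A B C : 'M[R]_n) : A^T = A -> B^T = B -> C^T = C ->
        (6^-1 *: (A + 4 *: B + C))^T = 6^-1 *: (A + 4 *: B + C).
      by move=> hA hB hC; rewrite linearZ/= !linearD/= linearZ/= hA hB hC.
    by apply: sym3; [exact: (fluxE 0).1|exact: (fluxE 2^-1).1|exact: (fluxE 1).1].
  move=> z; rewrite dotv_simpson.
  have bnd c (h : forall lambda, eigenvalue (cofmx (hess (fun x => uh x + c * e x) x)) lambda ->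
      m <= lambda <= M) : m * dotv z z <= dotv (z *m flux_mx (fun x => uh x + c * e x) x) z <= M * dotv z z.
    apply: sym_eigenvalue_bounds; first exact: (fluxE c).1.
    by rewrite (fluxE c).2.
  exact: simpson_average (bnd _ (E0 Ox.1)) (bnd _ (E2 Ox.1)) (bnd _ (E1 Ox.1)).
rewrite (bRintegralZ mO Oy _ (bmeasB bn bA)) (bRintegralB mO Oy bn bA) (bRintegralZ mO Oy _ bgg).
rewrite (bRintegralZ mO Oy _ (bmeasD bee bee')) (bRintegralD mO Oy bee bee').
rewrite -/(dirichlet e e) -/(dirichlet e' e') -/(dirichlet e e') -main /nu.
exact: absorb.
Qed.

Definition rho := Num.sqrt (M / (2 * m + M)).

Let M_gt0 : 0 < M. Proof. exact: lt_le_trans m_gt0 le_mM. Qed.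

Lemma rho_itv : 0 < rho < 1.
Proof.
have D0 : 0 < 2 * m + M by rewrite addr_gt0// mulr_gt0.
rewrite /rho sqrtr_gt0 divr_gt0//= -{2}(sqrtr1 R) ltr_sqrt// ltr_pdivrMr// mul1r.
by rewrite ltrDr mulr_gt0.
Qed.

Lemma contraction_sqrt v w : spline v -> agree_on_boundary Omega v gh ->
  (H1_norm Omega (v \- uh)%R < r0%:E)%E -> next_iterate v w ->
  Num.sqrt (dirichlet (w \- uh) (w \- uh)) <= rho * Num.sqrt (dirichlet (v \- uh) (v \- uh)).
Proof.
move=> sv av hv vw; have D0 : 0 < 2 * m + M by rewrite addr_gt0// mulr_gt0.
rewrite /rho -sqrtrM; last by rewrite divr_ge0 ?ltW.
by rewrite ler_wsqrtr// mulrAC ler_pdivlMr// mulrC; exact: contraction.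
Qed.

(** Testing both equations with [w' - w] gives it zero seminorm. Agreement on the domain suffices,
    since derivatives at points of an open set only depend on the values there. *)
Lemma next_iterate_unique v v' w w' : next_iterate v w -> next_iterate v' w' ->
  (forall x, Omega x -> v' x = v x) -> forall x, Omega x -> w' x = w x.
Proof.
move=> vw vw' vv'; have [sw aw hw] := vw; have [sw' aw' hw'] := vw'.
have Wz := vanishing_sub sw' sw aw' aw.
have near x (Ox : Omega x) : \forall y \near x, v' y = v y.
  have : nbhs x Omega by apply: open_nbhs_nbhs; split => //; exact: mesh_open dom.
  by apply: filterS => y; exact: vv'.
have gE x : Omega x -> grad v' x = grad v x.
  by move=> Ox; apply/rowP => i; rewrite !mxE; apply: near_eq_derive; exact: near.
have hE x : Omega x -> hess v' x = hess v x.
  move=> Ox; apply/matrixP => i j; rewrite [LHS]mxE [RHS]mxE.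
  exact: (nbhs_singleton (near_partial i (near_partial j (near x Ox)))).
have d0 : dirichlet (w' \- w) (w' \- w) = 0.
  have /vanishing_space0 Wz0 := Wz.
  have e1 := hw _ Wz0; have e2 := hw' _ Wz0.
  have e3 : residual v' (w' \- w) = residual v (w' \- w).
    by apply: eq_Rintegral => x /set_mem Ox; rewrite hE.
  have e4 : \int[mu]_(x in Omega) dotv (grad v' x) (grad (w' \- w) x) =
      \int[mu]_(x in Omega) dotv (grad v x) (grad (w' \- w) x).
    by apply: eq_Rintegral => x /set_mem Ox; rewrite gE.
  rewrite e3 e4 -e1 !(Rintegral_Omega' dom) in e2.
  have /(mulfI (lt0r_neq0 nu_gt0)) {}e2 := e2.
  rewrite -!/(dirichlet _ _) in e2.
  rewrite {1}sub_fctE (dirichletD dom (-1) sw' sw Wz.1) e2; ring.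
by move=> x Ox; apply/eqP; rewrite -subr_eq0; apply/eqP; exact: (dirichlet_eq0 dom Wz d0 Ox).
Qed.

(** The invariant is [E k < r] for the seminorm of the error. It places the iterate in the ball of
    radius [r0] for the full norm, because [cP r <= r0], and the contraction available there
    preserves it. *)
Lemma iteration_converges u0 r : spline u0 -> agree_on_boundary Omega u0 gh ->
  (H1_norm Omega (u0 \- uh)%R < r%:E)%E -> cP * r <= r0 ->
  exists u : nat -> U -> R,
    [/\ time_marching Omega d T f gh nu u0 u,
        forall u', time_marching Omega d T f gh nu u0 u' ->
          forall k, {in Omega, u' k =1 u k},
        (fun k => H1_norm Omega (u k \- uh)) @ \oo --> 0%E &
        exists2 rho : R, 0 < rho < 1 &
          forall k, (H1_seminorm Omega (u k.+1 \- uh)%R <=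
                     rho%:E * H1_seminorm Omega (u k \- uh)%R)%E].
Proof.
move=> su0 au0 hu0 cr.
(* The condition sits under the existential so that choice yields a total [next]; its values off the
   admissible splines are arbitrary. *)
have h v : exists w, spline v /\ agree_on_boundary Omega v gh -> next_iterate v w.
  have [[sv av]|nv] := pselect (spline v /\ agree_on_boundary Omega v gh).
    by have [w vw] := next_iterate_exists sv av; exists w.
  by exists v => /nv.
have [next hnext] := choice h.
pose u k := iter k next u0.
have inv k : spline (u k) /\ agree_on_boundary Omega (u k) gh.
  elim: k => [//|k IH]; have [] := hnext _ IH.
  by move=> s a _; split.
have step k : next_iterate (u k) (u k.+1) by exact: hnext (inv k).
pose E k := Num.sqrt (dirichlet (u k \- uh) (u k \- uh)).
have We k : vanishing (u k \- uh).
  by have [s a] := inv k; exact: vanishing_sub.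
have /andP[rho0 rho1] := rho_itv.
have E0 k : 0 <= E k by exact: sqrtr_ge0.
have in_ball k : E k < r -> (H1_norm Omega (u k \- uh)%R < r0%:E)%E.
  move=> Er; rewrite (H1_spline (We k).1) lte_fin; apply: le_lt_trans (H1_le_seminorm (We k)) _.
  by apply: lt_le_trans cr; rewrite ltr_pM2l// (lt_le_trans ltr01 cP_ge1).
have Er k : E k < r.
  elim: k => [|k IH].
    move: hu0; rewrite (H1_spline (We 0%N).1) lte_fin; apply: le_lt_trans.
    by rewrite ler_wsqrtr//; exact: dirichlet_le_nrm2.
  have [s a] := inv k.
  apply: le_lt_trans (contraction_sqrt s a (in_ball k IH) (step k)) _.
  by apply: le_lt_trans IH; rewrite -/(E k) ler_piMl ?E0 ?(ltW rho1).
have contr k : E k.+1 <= rho * E k.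
  have [s a] := inv k; exact: contraction_sqrt s a (in_ball k (Er k)) (step k).
exists u; split.
- by split => // k; exact: step.
- move=> u' [u'0 hu'] k x /set_mem Ox; elim: k x Ox => [|k IH] x Ox; first by rewrite u'0.
  exact: (next_iterate_unique (step k) (hu' k) IH Ox).
- have hE k : E k <= rho ^+ k * E 0%N.
    elim: k => [|k IH]; first by rewrite mul1r.
    by apply: le_trans (contr k) _; rewrite exprS -mulrA ler_pM2l.
  have -> : (fun k => H1_norm Omega (u k \- uh)) = EFin \o (fun k => Num.sqrt (nrm2 (u k \- uh))).
    by apply/funext => k /=; rewrite (H1_spline (We k).1).
  apply: cvg_EFin; first by near=> k.
  apply: (@squeeze_cvgr _ _ _ _ (fun=> 0) (fun k => cP * (rho ^+ k * E 0%N))).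
  + near=> k; rewrite sqrtr_ge0/=; apply: le_trans (H1_le_seminorm (We k)) _.
    apply: ler_wpM2l; [exact: le_trans ler01 cP_ge1|exact: hE].
  + exact: cvg_cst.
  + rewrite -[X in _ --> X](mulr0 cP); apply: cvgM; first exact: cvg_cst.
    rewrite -[X in _ --> X](mul0r (E 0%N)); apply: cvgM; last exact: cvg_cst.
    by apply: cvg_expr; rewrite gtr0_norm.
- exists rho; first by rewrite rho0.
  move=> k; rewrite !(H1_seminorm_spline (We _).1) -EFinM lee_fin.
  exact: contr.
Unshelve. all: by end_near. Qed.

End iteration.

(** The bound [b] is chosen before the triangulation, which makes [cP b] independent of [h]. Adding
    [1] to the radius makes the bound strict on the closure. *)
Lemma convex_bounded_mesh (R : realType) (n' : nat) (Omega : set 'rV[R]_n'.+1) :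
  open Omega -> Omega !=set0 -> bounded_set Omega ->
  convex_set (Omega : set (convex_lmodType 'rV[R]_n'.+1)) ->
  exists b, forall T, triangulation Omega T -> meshed Omega T b.
Proof.
move=> Oo O0 /pinfty_ex_gt0[B /= B0 hB] Oc; exists (B + 1) => T [_ Ti Tc _].
split=> //.
- move=> x y t /mem_set Ox /mem_set Oy /andP[t0 t1].
  have /set_mem := Oc y x (Itv01 t0 t1) Oy Ox.
  suff -> : x + t *: (y - x) = t *: y + (1 - t) *: x by [].
  by apply/rowP => i; rewrite !mxE; ring.
- move=> x cx i; rewrite (@le_lt_trans _ _ B)// ?ltrDl//.
  apply: le_trans (normr_coord x i) _.
  have cB : closed [set x : 'rV[R]_n'.+1 | `|x| <= B].
    rewrite (_ : [set x | _] = (fun x : 'rV[R]_n'.+1 => `|x|) @^-1` [set t | t <= B])//.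
    by apply: closed_comp => [y _|]; [exact: norm_continuous|exact: closed_le].
  by have := closureS hB cx; rewrite -((closure_id _).1 cB).
Qed.

Theorem theorem4p5 (R : realType) (n d : nat) (Omega : set 'rV[R]_n)
    (H : set R) (T : R -> seq 'M[R]_(n.+1, n))
    (f g G : 'rV[R]_n -> R) (gh uh : R -> 'rV[R]_n -> R)
    (delta0 m M : R)
    (n23 : n = 2%N \/ n = 3%N)
    (Omega_open : open Omega) (Omega_neq0 : Omega !=set0)
    (Omega_bounded : bounded_set Omega)
    (Omega_convex : convex_set (Omega : set (convex_lmodType 'rV[R]_n)))
    (Omega_lipschitz : lipschitz_boundary Omega)
    (T_triangulation : forall h, H h ->
       triangulation Omega (T h) /\ max_diameter (T h) h)
    (T_shape_regular : shape_regular H T)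
    (T_quasi_uniform : quasi_uniform H T)
    (V_approximation : approximation_property Omega d H T)
    (V_inverse : inverse_estimates Omega d H T)
    (f_continuous : {in Omega, continuous f})
    (f_gt0 : forall x, Omega x -> 0 < f x)
    (f_functional : forall h, H h ->
       forall psi, spline_space0 Omega d (T h) psi ->
       (lebesgue_rV R n).-integrable Omega (EFin \o (f \* psi)))
    (g_continuous : {within boundary Omega, continuous g})
    (G_smooth : smooth G) (G_extends : agree_on_boundary Omega G g)
    (gh_interpolant : forall h, H h -> interpolant Omega d (T h) G (gh h))
    (uh_solution : forall h, H h ->
       discrete_solution Omega d (T h) f (gh h) (uh h))
    (uh_convex : forall h, H h -> strictly_convex_on Omega (uh h))
    (uh_unique : forall h, H h -> forall v,
       discrete_solution Omega d (T h) f (gh h) v ->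
       strictly_convex_on Omega v -> {in Omega, v =1 uh h})
    (delta0_gt0 : 0 < delta0) (m_gt0 : 0 < m) (le_mM : m <= M)
    (cof_eigenvalues : forall h, H h ->
       forall v, Yset Omega d (T h) (gh h) (uh h) delta0 h v ->
       {ae lebesgue_rV R n, forall x, Omega x -> forall lambda,
          eigenvalue (cofmx (hess v x)) lambda -> m <= lambda <= M}) :
  exists2 nu : R, 0 < nu &
  exists2 delta1 : R, 0 < delta1 <= delta0 &
  forall delta, 0 < delta <= delta1 ->
  forall h, H h ->
  forall u0, Yset Omega d (T h) (gh h) (uh h) delta h u0 ->
  exists u : nat -> 'rV[R]_n -> R,
    [/\ time_marching Omega d (T h) f (gh h) nu u0 u,
        forall u', time_marching Omega d (T h) f (gh h) nu u0 u' ->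
          forall k, {in Omega, u' k =1 u k},
        (fun k => H1_norm Omega (u k \- uh h)) @ \oo --> 0%E &
        exists2 rho : R, 0 < rho < 1 &
          forall k, (H1_seminorm Omega (u k.+1 \- uh h)%R <=
                     rho%:E * H1_seminorm Omega (u k \- uh h)%R)%E].
Proof.
case: n n23 Omega T f g G gh uh Omega_open Omega_neq0 Omega_bounded Omega_convex
  Omega_lipschitz T_triangulation T_shape_regular T_quasi_uniform V_approximation
  V_inverse f_continuous f_gt0 f_functional g_continuous G_smooth G_extends
  gh_interpolant uh_solution uh_convex uh_unique cof_eigenvalues => [[]//|n'] n23
  Omega T f g G gh uh Omega_open Omega_neq0 Omega_bounded Omega_convex _
  T_triangulation _ _ _ _ _ _ f_functional _ _ _ _ uh_solution _ _ cof_eigenvalues.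
have [b dom] := convex_bounded_mesh Omega_open Omega_neq0 Omega_bounded Omega_convex.
have c1 := cP_ge1 b; have c0 : 0 < cP b by exact: lt_le_trans ltr01 c1.
exists (nu m M); first exact: nu_gt0.
(* A start within radius [delta1] keeps all iterates in the neighbourhood of radius [delta0], where
   the eigenvalue bounds are given. *)
exists (delta0 / cP b).
  by rewrite divr_gt0//= ler_pdivrMr// ler_peMr// ltW.
move=> delta /andP[delta_gt0 delta_le] h Hh u0 [su0 au0 hu0].
pose q := h `^ (1 + n'.+1%:R / 2) / 4.
have q0 : 0 <= q by rewrite divr_ge0 ?powR_ge0.
have := @iteration_converges R n' Omega d (T h) b (dom _ (T_triangulation h Hh).1) n23
  f (gh h) (uh h) m M (delta0 * q) m_gt0 le_mM (f_functional h Hh) (uh_solution h Hh) _ u0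
  (delta * q) su0 au0.
apply.
- by move=> v sv av hv; apply: (cof_eigenvalues h Hh); split => //; rewrite -mulrA.
- by rewrite /q mulrA.
- rewrite mulrA ler_wpM2r//; rewrite mulrC -ler_pdivlMr//.
Qed.
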